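(* Any totally umbilic null hypersurface in a Robertson-Walker space $I\times_f\mathbb{S}^{n-1}$ ($n>3$) with $$\int_I\frac{1}{f(r)}\,dr>\pi$$ is an open set of a nullcone. In particular, there cannot exist totally geodesic null hypersurfaces.
   Context: $I\subset\mathbb{R}$ is an open interval, $f\in C^\infty(I)$ is positive, and $I\times_f\mathbb{S}^{n-1}$ is $I\times\mathbb{S}^{n-1}$ with the Lorentzian metric $g=-dt^2+f(t)^2g_0$, where $g_0$ is the canonical metric (curvature $1$) of the unit sphere. Put $\zeta=f\partial_t$. For a point $p$ of a Lorentzian manifold $M$, the future and past nullcones at $p$ are the images under $\exp_p$ (where defined) of the future and past nullcones of $T_pM$. A null hypersurface $L$ is a hypersurface on which the induced metric is degenerate. On $L$ take the unique null vector field $\xi\in\mathfrak{X}(L)$ with $g(\zeta,\xi)=1$, and $\mathcal{S}=\zeta^\perp\cap TL$. The null second fundamental form is $B(X,Y)=-g(\nabla_X\xi,Y)$ for $X,Y\in\mathcal{S}$. $L$ is totally geodesic if $B\equiv0$ and totally umbilic if $B=\rho g$ for some $\rho\in C^\infty(L)$.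
   Formalization: Nonexistence of totally geodesic null hypersurfaces is claimed only for those that are not a proper part of a larger totally umbilic null hypersurface (small pieces can be totally geodesic, e.g. where f = cosh); hypersurfaces are taken nonempty, connected and embedded. *)

(* Defs.v *)
From HB Require Import structures.
From mathcomp Require Import all_boot all_order all_algebra.
From mathcomp Require Import all_classical all_reals all_analysis.
Set Implicit Arguments.
Unset Strict Implicit.
Unset Printing Implicit Defensive.
Import Order.TTheory GRing.Theory Num.Theory.
Import numFieldNormedType.Exports.
Local Open Scope classical_set_scope.
Local Open Scope ring_scope.

(* I x_f S^{n-1} is realised as the set of (t, x) in R^{n+1} with t in I and
   |x| = 1.  It is a semi-Riemannian submanifold of I x (R^n \ {0}) with the
   metric -dt^2 + f(t)^2 |dx|^2, so its Levi-Civita connection is the tangential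
   part of the ambient one, which is given by Christoffel symbols. *)

Fixpoint Ck (R : realType) (V W : normedModType R) (k : nat) (U : set V)
    (h : V -> W) : Prop :=
  match k with
  | 0%N => forall x, U x -> {for x, continuous h}
  | k'.+1 => (forall x, U x -> differentiable h x) /\
             forall v : V, Ck k' U (fun x => 'D_v h x)
  end.

Definition smooth (R : realType) (V W : normedModType R) (U : set V)
    (h : V -> W) : Prop :=
  open U /\ forall k, Ck k U h.

(* A function on an embedded submanifold A is smooth iff it is the restriction
   of a smooth function on a neighbourhood of A; here h itself is such an
   extension, and only its values on A are meaningful. *)
Definition smooth_along (R : realType) (V W : normedModType R) (A : set V)
    (h : V -> W) : Prop :=
  exists2 U : set V, A `<=` U & smooth U h.

(* Velocities at p of smooth curves contained in A. *)
Definition tangent (R : realType) (V : normedModType R) (A : set V)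
    (p : V) : set V :=
  [set v | exists J : set R, exists c : R -> V,
     [/\ J 0, smooth (V := R^o) J c, (forall s, J s -> A (c s)), c 0 = p
       & derive1 c 0 = v]].

(* In R^{n+1}, index 0 is time and the other indices are those of R^n. *)
Definition tcoord (R : realType) (n : nat) (p : 'rV[R]_n.+1) : R := p ord0 ord0.

Definition xcoord (R : realType) (n : nat) (p : 'rV[R]_n.+1) : 'rV[R]_n :=
  \row_i p ord0 (lift ord0 i).

Definition partial_t (R : realType) (n : nat) : 'rV[R]_n.+1 :=
  delta_mx ord0 ord0.

Definition rw_space (R : realType) (n : nat) (I : set R) :
    set 'rV[R]_n.+1 :=
  [set p | I (tcoord p) /\ \sum_i xcoord p ord0 i ^+ 2 = 1].

Definition metric (R : realType) (n : nat) (f : R -> R) (p : 'rV[R]_n.+1) :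
    'M[R]_n.+1 :=
  \matrix_(i, j)
    (if i != j then 0 else if i == ord0 then -1 else f (tcoord p) ^+ 2).

Definition rwg (R : realType) (n : nat) (f : R -> R) (p u v : 'rV[R]_n.+1) :
    R :=
  (u *m metric f p *m v^T) ord0 ord0.

(* Christoffel symbol with upper index k and lower indices i, j of a metric
   given by its Gram matrix G in the coordinates of R^m. *)
Definition christoffel (R : realType) (m : nat) (G : 'rV[R]_m.+1 -> 'M[R]_m.+1)
    (p : 'rV[R]_m.+1) (k i j : 'I_m.+1) : R :=
  let d (a b c : 'I_m.+1) : R :=
    'D_(delta_mx ord0 a) (fun q => G q b c : R^o) p in
  2^-1 * \sum_l invmx (G p) k l * (d i j l + d j i l - d l i j).

(* The radial vector (0, x), orthogonal to the tangent space of
   I x S^{n-1} at (t, x). *)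
Definition radial (R : realType) (n : nat) (p : 'rV[R]_n.+1) : 'rV[R]_n.+1 :=
  p - tcoord p *: @partial_t R n.

Definition tanproj (R : realType) (n : nat) (f : R -> R) (p w : 'rV[R]_n.+1) :
    'rV[R]_n.+1 :=
  w - (rwg f p w (radial p) / rwg f p (radial p) (radial p)) *: radial p.

(* Covariant derivative at p, in the direction X, of a vector field with value
   V at p and componentwise derivative dV in the direction X. *)
Definition covariant (R : realType) (n : nat) (f : R -> R)
    (p X V dV : 'rV[R]_n.+1) : 'rV[R]_n.+1 :=
  tanproj f p
    (dV + \row_k \sum_i \sum_j
            christoffel (metric f) p k i j * X ord0 i * V ord0 j).

Definition nabla (R : realType) (n : nat) (f : R -> R)
    (X : 'rV[R]_n.+1) (xi : 'rV[R]_n.+1 -> 'rV[R]_n.+1) (p : 'rV[R]_n.+1) :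
    'rV[R]_n.+1 :=
  covariant f p X (xi p) ('D_X xi p).

Definition geodesic (R : realType) (n : nat) (I : set R) (f : R -> R)
    (J : set R) (c : R -> 'rV[R]_n.+1) : Prop :=
  smooth (V := R^o) J c /\
  forall s, J s ->
    rw_space I (c s) /\
    covariant f (c s) (derive1 c s) (derive1 c s) (derive1 (derive1 c) s) = 0.

(* v is in the domain of exp_p and exp_p v = q. *)
Definition exp_eq (R : realType) (n : nat) (I : set R) (f : R -> R)
    (p v q : 'rV[R]_n.+1) : Prop :=
  exists J : set R, exists c : R -> 'rV[R]_n.+1,
    [/\ `[0, 1] `<=` J, geodesic I f J c, c 0 = p, derive1 c 0 = v & c 1 = q].

Definition null_vector (R : realType) (n : nat) (I : set R) (f : R -> R)
    (p : 'rV[R]_n.+1) : set 'rV[R]_n.+1 :=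
  [set v | [/\ tangent (@rw_space R n I) p v, v != 0 & rwg f p v v = 0]].

(* The time orientation is the one of partial_t. *)
Definition future_nullcone (R : realType) (n : nat) (I : set R) (f : R -> R)
    (p : 'rV[R]_n.+1) : set 'rV[R]_n.+1 :=
  [set q | exists v,
     [/\ null_vector I f p v, rwg f p v (@partial_t R n) < 0
       & exp_eq I f p v q]].

Definition past_nullcone (R : realType) (n : nat) (I : set R) (f : R -> R)
    (p : 'rV[R]_n.+1) : set 'rV[R]_n.+1 :=
  [set q | exists v,
     [/\ null_vector I f p v, 0 < rwg f p v (@partial_t R n)
       & exp_eq I f p v q]].

Definition open_in (T : topologicalType) (L A : set T) : Prop :=
  exists2 O : set T, open O & L = A `&` O.

Definition open_set_of_nullcone (R : realType) (n : nat) (I : set R)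
    (f : R -> R) (L : set 'rV[R]_n.+1) : Prop :=
  exists2 p, rw_space I p &
    open_in L (future_nullcone I f p) \/ open_in L (past_nullcone I f p).

(* Embedded hypersurfaces of I x S^{n-1}, as local regular zero sets.
   As usual for manifolds, they are nonempty and connected. *)
Definition hypersurface (R : realType) (n : nat) (I : set R)
    (L : set 'rV[R]_n.+1) : Prop :=
  [/\ L !=set0, connected L, L `<=` rw_space I &
   forall p, L p -> exists U : set 'rV[R]_n.+1, exists F : 'rV[R]_n.+1 -> R^o,
     [/\ U p, smooth U F,
         (forall q, U q -> rw_space I q -> (L q <-> F q = 0)) &
         forall q, U q -> L q ->
           exists2 v, tangent (@rw_space R n I) q v & 'D_v F q != 0]].

Definition null_hypersurface (R : realType) (n : nat) (I : set R) (f : R -> R)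
    (L : set 'rV[R]_n.+1) : Prop :=
  hypersurface I L /\
  forall p, L p -> exists v,
    [/\ tangent L p v, v != 0 & forall w, tangent L p w -> rwg f p v w = 0].

Definition zeta (R : realType) (n : nat) (f : R -> R) (p : 'rV[R]_n.+1) :
    'rV[R]_n.+1 :=
  f (tcoord p) *: @partial_t R n.

(* On a null hypersurface L there is exactly one such field on L. *)
Definition associated_null_field (R : realType) (n : nat) (f : R -> R)
    (L : set 'rV[R]_n.+1) (xi : 'rV[R]_n.+1 -> 'rV[R]_n.+1) : Prop :=
  smooth_along L xi /\
  forall p, L p ->
    [/\ tangent L p (xi p), rwg f p (xi p) (xi p) = 0
      & rwg f p (zeta f p) (xi p) = 1].

Definition screen (R : realType) (n : nat) (f : R -> R)
    (L : set 'rV[R]_n.+1) (p : 'rV[R]_n.+1) : set 'rV[R]_n.+1 :=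
  [set X | tangent L p X /\ rwg f p (zeta f p) X = 0].

Definition null_second_form (R : realType) (n : nat) (f : R -> R)
    (xi : 'rV[R]_n.+1 -> 'rV[R]_n.+1) (p X Y : 'rV[R]_n.+1) : R :=
  - rwg f p (nabla f X xi p) Y.

Definition totally_geodesic (R : realType) (n : nat) (f : R -> R)
    (L : set 'rV[R]_n.+1) : Prop :=
  exists2 xi, associated_null_field f L xi &
    forall p X Y, L p -> screen f L p X -> screen f L p Y ->
      null_second_form f xi p X Y = 0.

Definition totally_umbilic (R : realType) (n : nat) (f : R -> R)
    (L : set 'rV[R]_n.+1) : Prop :=
  exists2 xi, associated_null_field f L xi &
  exists2 rho : 'rV[R]_n.+1 -> R^o, smooth_along L rho &
    forall p X Y, L p -> screen f L p X -> screen f L p Y ->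
      null_second_form f xi p X Y = rho p * rwg f p X Y.

(* L is not a proper part of a larger totally umbilic null hypersurface.
   Nonexistence of totally geodesic null hypersurfaces has to be understood up
   to extension: where f coincides with cosh, as in de Sitter space, small
   pieces of some nullcones are totally geodesic, whatever f is elsewhere. *)
Definition inextendible (R : realType) (n : nat) (I : set R) (f : R -> R)
    (L : set 'rV[R]_n.+1) : Prop :=
  forall L' : set 'rV[R]_n.+1, null_hypersurface I f L' ->
    totally_umbilic f L' -> L `<=` L' -> L' = L.

(* Main.v *)
Require Import Defs.
From mathcomp Require Import all_boot all_order all_algebra.
From mathcomp Require Import all_classical all_reals all_analysis.
From mathcomp Require Import measurable_realfun.
From mathcomp Require Import ring lra.
Set Implicit Arguments.
Unset Strict Implicit.
Unset Printing Implicit Defensive.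
Import Order.TTheory GRing.Theory Num.Theory.
Import numFieldNormedType.Exports.
Local Open Scope classical_set_scope.
Local Open Scope ring_scope.

(** A Robertson-Walker metric is conformal to a product metric, so its null
    geometry can be read off the sphere. Let [S] be a primitive of [1 / f], the
    conformal time, and let [x] be the spatial part of a point of a null
    hypersurface [L]; it is a point of the unit sphere.

    The spatial part of the null field [xi], rescaled to length one, is a unit
    vector [u] tangent to the sphere ([null_direction]). With [eta = <u, dx>]
    the tangent spaces of [L] are given by [dt = - f eta] ([tangent_nullE]).
    Hence [L] is locally a graph over the sphere, the form [eta] is [- dS] and
    therefore closed ([null_direction_sym]), and the sections of [L] at
    constant time project to parallel hypersurfaces of the sphere with unit
    normal [u].

    Umbilicity, [B = rho g], says that these hypersurfaces are umbilic in the
    sphere, with principal curvature [kap = f' - rho f^2]. This is the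
    structure equation [du = kap (dx - eta u) - eta x] ([umbilic_derive]).
    Differentiating it again and using the symmetry of second derivatives in
    the direction of a screen vector orthogonal to a given one, which exists
    as [n > 3], gives [d kap = - (1 + kap^2) eta] ([null_curvature_derive]).
    So the angle [th] in [(0, pi)] with [cot th = kap] satisfies
    [d th = eta = - dS], and the point [cos th x - sin th u] has derivative
    zero. As [L] is connected, there are a point [q0] of the sphere and a
    number [s0] such that every section of [L] lies in the sphere of radius
    [th] about [q0], and [S = s0 - th] ([umbilic_cone]).

    Null geodesics project to great circles, with the conformal time as arc
    length ([null_geodesic_exists], [null_geodesic_cone]). The null geodesics
    from conformal time [s0] over [q0] thus meet again at conformal time
    [s0 - pi] over [- q0], and [L] lies between these two vertices. Since the
    conformal time ranges over an interval longer than [pi], one of the two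
    vertices is a point of the space ([cone_vertex]), and [L] lies in the
    nullcone of this vertex. It is open there because both [L] and the cone
    are graphs over the sphere ([cone_sub_near]).

    Now let [L] be totally geodesic and inextendible. The whole cone
    [0 < s0 - S < pi] is a totally umbilic null hypersurface
    ([full_cone_null], [full_cone_umbilic]) that contains [L], so it is [L].
    Since [rho = 0], this means that [f' = cot (s0 - S)] at all times with
    [0 < s0 - S < pi]. But [f'] is finite at the time of the vertex that
    belongs to the space, while [s0 - S] tends to [0] or to [pi] there
    ([no_inextendible_totally_geodesic]). *)

(** * Differentiable maps between normed spaces *)

Section differentiability.
Context {R : realType}.
Implicit Types V W : normedModType R.

(** This form of differentiability is the one that can be checked for a
    function that is defined implicitly. *)
Lemma diff_epsP V W (h : V -> W) (x : V) (l : {linear V -> W}) :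
  continuous l ->
  (forall e : R, 0 < e -> \forall k \near (0 : V), `|h (k + x) - h x - l k| <= e * `|k|) ->
  is_diff x h l.
Proof.
move=> lc hl.
have E : h \o shift x = cst (h x) + l +o_ (0 : V) id.
  apply/eqaddoP => e e0; apply: filterS (hl e e0) => k /=.
  by rewrite /= opprD addrA.
have dE := diff_unique lc E.
apply: DiffDef => //; apply/diff_locallyP; rewrite dE; split=> //.
Qed.

Lemma diff_eps V W (h : V -> W) (x : V) : differentiable h x ->
  forall e : R, 0 < e ->
  \forall k \near (0 : V), `|h (k + x) - h x - 'd h x k| <= e * `|k|.
Proof.
move=> dh e e0; have /diff_locallyP [_ /eqaddoP] := dh => /(_ e e0).
by apply: filterS => k /=; rewrite opprD addrA.
Qed.

Lemma near_shift0 V (x : V) (P : V -> Prop) :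
  (\forall y \near x, P y) -> \forall k \near (0 : V), P (k + x).
Proof.
rewrite (near_shift 0); apply: filterS => k /=; by rewrite subr0.
Qed.

Lemma near_eq_diff V W (h h' : V -> W) x : (\near x, h x = h' x) ->
  differentiable h x -> differentiable h' x.
Proof.
move=> hh' dh; suff : is_diff x h' ('d h x) by case.
apply: diff_epsP => [|e e0]; first exact: diff_continuous.
have h0 := nbhs_singleton hh'.
near=> k; rewrite -h0 -(near (near_shift0 hh') k)//.
by near: k; apply: diff_eps.
Unshelve. all: by end_near. Qed.

Lemma differentiable_entries V (m n : nat) (h : V -> 'M[R]_(m.+1, n.+1)) x :
  (forall i j, differentiable (fun z => h z i j : R^o) x) -> differentiable h x.
Proof.
move=> hd.
have -> : h = fun z => \sum_i \sum_j h z i j *: delta_mx i j.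
  by apply/funext => z; exact: matrix_sum_delta.
have -> : (fun z => \sum_i \sum_j h z i j *: delta_mx i j) =
    \sum_(i < m.+1) (fun z => (\sum_(j < n.+1) (fun z =>
      h z i j *: delta_mx i j : 'M[R]_(m.+1, n.+1))) z).
  by apply/funext => z; rewrite fct_sumE; apply: eq_bigr => i _; rewrite fct_sumE.
apply: differentiable_sum => i; apply: differentiable_sum => j.
exact: differentiableZl.
Qed.

Lemma derive_entry V (m n : nat) (h : V -> 'M[R]_(m.+1, n.+1)) x v i j :
  differentiable h x -> 'D_v (fun z => h z i j : R^o) x = ('D_v h x) i j.
Proof. by move=> hd; rewrite derive_mx ?mxE//; exact: diff_derivable. Qed.

Lemma differentiable_entry V (m n : nat) (h : V -> 'M[R]_(m.+1, n.+1)) x i j :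
  differentiable h x -> differentiable (fun z => h z i j : R^o) x.
Proof.
move=> hd.
exact: (differentiable_comp hd (differentiable_coord (h x) i j)).
Qed.

Lemma derive_lincomb V W (h : V -> W) x a b v w : differentiable h x ->
  'D_(a *: v + b *: w) h x = a *: 'D_v h x + b *: 'D_w h x.
Proof. by move=> hd; rewrite !deriveE// linearP linearZ. Qed.

Lemma derive_comp V W (Z : normedModType R) (h : V -> W) (g : W -> Z) x v :
  differentiable h x -> differentiable g (h x) ->
  'D_v (g \o h) x = 'D_('D_v h x) g (h x).
Proof.
move=> hd gd; have cd := differentiable_comp hd gd.
by rewrite (deriveE v cd) (diff_comp hd gd) (deriveE v hd) (deriveE _ gd).
Qed.

Lemma derive_real V (g : R^o -> V) (x : R^o) (a : R) :
  differentiable g x -> 'D_a g x = a *: 'D_1 g x.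
Proof. by move=> gd; rewrite !deriveE// -linearZ /= [_ *: _]mulr1. Qed.

Lemma derive_rV V (m : nat) (g : 'rV[R]_m.+1 -> V) x v : differentiable g x ->
  'D_v g x = \sum_i v ord0 i *: 'D_(delta_mx ord0 i) g x.
Proof.
move=> gd; rewrite deriveE// [in LHS](row_sum_delta v) linear_sum.
by apply: eq_bigr => i _; rewrite linearZ deriveE.
Qed.

End differentiability.

Section rules.
Context {R : realType} {V : normedModType R}.
Implicit Types (a b : V -> R^o) (x v : V).

Lemma diffD_fun (W : normedModType R) (f g : V -> W) x :
  differentiable f x -> differentiable g x ->
  differentiable (fun z => f z + g z) x.
Proof. exact: differentiableD. Qed.

Lemma deriveD_fun (W : normedModType R) (f g : V -> W) x v :
  differentiable f x -> differentiable g x ->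
  'D_v (fun z => f z + g z) x = 'D_v f x + 'D_v g x.
Proof. by move=> fd gd; apply: deriveD; exact: diff_derivable. Qed.

Lemma diffM_fun a b x :
  differentiable a x -> differentiable b x ->
  differentiable (fun z => a z * b z : R^o) x.
Proof. exact: differentiableM. Qed.

Lemma deriveM_fun a b x v :
  differentiable a x -> differentiable b x ->
  'D_v (fun z => a z * b z : R^o) x = a x * 'D_v b x + b x * 'D_v a x.
Proof. by move=> fd gd; apply: deriveM; exact: diff_derivable. Qed.

Lemma diffN_fun (W : normedModType R) (f : V -> W) x :
  differentiable f x -> differentiable (fun z => - f z) x.
Proof. exact: differentiableN. Qed.

Lemma deriveN_fun (W : normedModType R) (f : V -> W) x v :
  differentiable f x -> 'D_v (fun z => - f z) x = - 'D_v f x.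
Proof. by move=> fd; apply: deriveN; exact: diff_derivable. Qed.

Lemma diffsum_fun (W : normedModType R) n (h : 'I_n -> V -> W) x :
  (forall i, differentiable (h i) x) -> differentiable (fun z => \sum_i h i z) x.
Proof.
move=> hd; rewrite (_ : (fun z => _) = \sum_i h i); first exact: differentiable_sum.
by apply/funext => z; rewrite fct_sumE.
Qed.

Lemma derivesum_fun (W : normedModType R) n (h : 'I_n -> V -> W) x v :
  (forall i, differentiable (h i) x) ->
  'D_v (fun z => \sum_i h i z) x = \sum_i 'D_v (h i) x.
Proof.
move=> hd; rewrite (_ : (fun z => _) = \sum_i h i).
  by apply: derive_sum => i; exact: diff_derivable.
by apply/funext => z; rewrite fct_sumE.
Qed.

Lemma diff_scale (m : nat) a (h : V -> 'rV[R]_m.+1) x :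
  differentiable a x -> differentiable h x -> differentiable (fun z => a z *: h z) x.
Proof.
move=> ad hd; apply: differentiable_entries => i j.
rewrite (_ : (fun _ => _) = (fun z => a z * h z i j : R^o)); last by apply/funext => z; rewrite mxE.
by apply: diffM_fun => //; exact: differentiable_entry.
Qed.

Lemma derive_scale (m : nat) a (h : V -> 'rV[R]_m.+1) x v :
  differentiable a x -> differentiable h x ->
  'D_v (fun z => a z *: h z) x = 'D_v a x *: h x + a x *: 'D_v h x.
Proof.
move=> ad hd; apply/rowP => j; rewrite -derive_entry; last exact: diff_scale.
rewrite (_ : (fun _ => _) = (fun z => a z * h z ord0 j : R^o)); last by apply/funext => z; rewrite mxE.
rewrite deriveM_fun//; last exact: differentiable_entry.
rewrite derive_entry// !mxE addrC. by congr (_ + _); rewrite mulrC.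
Qed.
End rules.

(** * Calculus of smooth maps *)

Section Ck_calculus.
Context {R : realType}.
Implicit Types V W : normedModType R.

Lemma Ck_differentiable V W k (U : set V) (h : V -> W) x :
  Ck k.+1 U h -> U x -> differentiable h x.
Proof. by case=> + _; exact. Qed.

Lemma Ck_continuous V W k (U : set V) (h : V -> W) x :
  Ck k U h -> U x -> {for x, continuous h}.
Proof.
case: k => [|k]; first exact.
by move=> /Ck_differentiable hd /hd; exact: differentiable_continuous.
Qed.

Lemma Ck_mono V W k (U : set V) (h : V -> W) : Ck k.+1 U h -> Ck k U h.
Proof.
elim: k h => [h hC x Ux|k IH h [hd hD]]; first exact: (Ck_continuous hC Ux).
by split=> // v; apply/IH/hD.
Qed.

Lemma Ck_ext V W k (U : set V) (h h' : V -> W) : open U ->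
  {in U, h =1 h'} -> Ck k U h -> Ck k U h'.
Proof.
move=> oU; elim: k h h' => [|k IH] h h' hh'.
  move=> hC x Ux; apply: cvg_trans (_ : h @ x --> _); last first.
    by rewrite -hh' ?inE//; exact: hC.
  apply: near_eq_cvg; apply: filterS (open_nbhs_nbhs (conj oU Ux)) => y Uy.
  by rewrite /= hh' ?inE.
have near_hh' x : U x -> \near x, h x = h' x.
  move=> Ux; apply: filterS (open_nbhs_nbhs (conj oU Ux)) => y Uy.
  by rewrite hh' ?inE.
move=> [hd hD]; split=> [x Ux|v].
  by apply: near_eq_diff (hd x Ux); exact: near_hh'.
apply: IH (hD v) => x; rewrite inE => Ux.
exact/near_eq_derive/near_hh'.
Qed.

Lemma Ck_subset V W k (U U' : set V) (h : V -> W) :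
  U' `<=` U -> Ck k U h -> Ck k U' h.
Proof.
move=> sU; elim: k h => [|k IH] h; first by move=> hC x /sU; exact: hC.
by move=> [hd hD]; split=> [x /sU|v]; [exact: hd|exact/IH/hD].
Qed.

Lemma Ck_cst V W k (U : set V) (c : W) : Ck k U (fun=> c).
Proof.
elim: k c => [|k IH] c; first by move=> x _; exact: cvg_cst.
split=> [x _|v]; first exact: differentiable_cst.
rewrite (_ : (fun x => 'D_v (fun=> c) x) = fun=> 0); first exact: IH.
by apply/funext => x; exact: derive_cst.
Qed.

Lemma Ck_linear V W k (U : set V) (l : {linear V -> W}) :
  continuous l -> Ck k U l.
Proof.
move=> lc; case: k => [|k]; first by move=> x _; exact: lc.
split=> [x _|v]; first exact: linear_differentiable.
rewrite (_ : (fun x => 'D_v l x) = fun=> l v); first exact: Ck_cst.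
apply/funext => x; rewrite deriveE; last exact: linear_differentiable.
by rewrite diff_lin.
Qed.

Lemma CkD V W k (U : set V) (g h : V -> W) : open U ->
  Ck k U g -> Ck k U h -> Ck k U (fun z => g z + h z).
Proof.
move=> oU; elim: k g h => [|k IH] g h.
  by move=> gC hC x Ux; exact: cvgD (gC x Ux) (hC x Ux).
move=> [gd gD] [hd hD]; split=> [x Ux|v].
  by apply: diffD_fun; [exact: gd|exact: hd].
apply: (Ck_ext oU _ (IH _ _ (gD v) (hD v))) => x; rewrite inE => Ux.
by rewrite deriveD_fun//; [exact: gd|exact: hd].
Qed.

Lemma Ck_sum V W k (U : set V) m (h : 'I_m -> V -> W) : open U ->
  (forall i, Ck k U (h i)) -> Ck k U (fun z => \sum_i h i z).
Proof.
move=> oU; elim: m h => [|m IH] h hC.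
  rewrite (_ : (fun z => \sum_i h i z) = fun=> 0); first exact: Ck_cst.
  by apply/funext => x; rewrite big_ord0.
rewrite (_ : (fun z => \sum_i h i z) = fun z => h ord0 z + \sum_i h (lift ord0 i) z).
  by apply: CkD => //; apply: IH.
by apply/funext => x; rewrite big_ord_recl.
Qed.

Lemma CkM V k (U : set V) (a b : V -> R^o) : open U ->
  Ck k U a -> Ck k U b -> Ck k U (fun z => a z * b z : R^o).
Proof.
move=> oU; elim: k a b => [|k IH] a b.
  by move=> aC bC x Ux; exact: cvgM (aC x Ux) (bC x Ux).
move=> aC bC; have [[ad aD] [bd bD]] := (aC, bC); split=> [x Ux|v].
  by apply: diffM_fun; [exact: ad|exact: bd].
have CkDv : Ck k U (fun z => a z * 'D_v b z + b z * 'D_v a z : R^o).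
  by apply: (CkD oU); apply: IH; [exact: (Ck_mono aC)|exact: bD|exact: (Ck_mono bC)|exact: aD].
apply: (Ck_ext oU _ CkDv) => x; rewrite inE => Ux.
by rewrite (deriveM_fun v (ad x Ux) (bd x Ux)).
Qed.

Lemma CkN V k (U : set V) (a : V -> R^o) : open U ->
  Ck k U a -> Ck k U (fun z => - a z : R^o).
Proof.
move=> oU aC; rewrite (_ : (fun z => - a z : R^o) = fun z => -1 * a z : R^o).
  by apply: CkM => //; exact: Ck_cst.
by apply/funext => x; rewrite mulN1r.
Qed.

Lemma Ck_entries V m k (U : set V) (h : V -> 'rV[R]_m.+1) : open U ->
  (forall j, Ck k U (fun z => h z ord0 j : R^o)) -> Ck k U h.
Proof.
move=> oU; elim: k h => [|k IH] h hC.
  move=> x Ux Q [P /= Pn PQ].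
  rewrite /nbhs/=; apply: (@filterS _ (nbhs x) _ _ _ (fun y H => PQ (h y) H)) => /=.
  apply: filter_forall => i; apply: filter_forall => j.
  have := hC j x Ux (P i j); rewrite (ord1 i); apply; exact: Pn.
split=> [x Ux|v].
  apply: differentiable_entries => i j; rewrite (ord1 i).
  exact: Ck_differentiable (hC j) Ux.
apply: IH => j; have [hd hD] := hC j.
apply: (Ck_ext oU _ (hD v)) => x; rewrite inE => Ux.
rewrite derive_entry//; apply: differentiable_entries => i' j'; rewrite (ord1 i').
exact: Ck_differentiable (hC j') Ux.
Qed.

Lemma Ck_entry V m k (U : set V) (h : V -> 'rV[R]_m.+1) j : open U ->
  Ck k U h -> Ck k U (fun z => h z ord0 j : R^o).
Proof.
move=> oU; elim: k h => [|k IH] h.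
  move=> hC x Ux; apply: (@continuous_comp _ _ _ h (fun M : 'rV[R]_m.+1 => M ord0 j) x (hC x Ux)).
  exact: coord_continuous.
move=> [hd hD]; split=> [x Ux|v]; first exact: (differentiable_entry ord0 j (hd x Ux)).
apply: (Ck_ext oU _ (IH _ (hD v))) => x; rewrite inE => Ux.
by rewrite derive_entry//; exact: hd.
Qed.

Lemma Ck_scale V m k (U : set V) (a : V -> R^o) (h : V -> 'rV[R]_m.+1) : open U ->
  Ck k U a -> Ck k U h -> Ck k U (fun z => a z *: h z).
Proof.
move=> oU aC hC; apply: Ck_entries => // j.
rewrite (_ : (fun z => (a z *: h z) ord0 j : R^o) = fun z => a z * h z ord0 j : R^o).
  by apply: CkM => //; exact: Ck_entry.
by apply/funext => x; rewrite mxE.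
Qed.

(** The outer function is real valued, because then the derivatives of the
    composite are sums of products of functions to which the induction
    hypothesis applies. *)
Lemma Ck_comp_row V m k (U : set V) (U' : set 'rV[R]_m.+1) (h : V -> 'rV[R]_m.+1)
    (g : 'rV[R]_m.+1 -> R^o) : open U ->
  (forall x, U x -> U' (h x)) -> Ck k U h -> Ck k U' g ->
  Ck k U (g \o h).
Proof.
move=> oU hU; elim: k g h hU => [|k IH] g h hU.
  by move=> hC gC x Ux; apply: continuous_comp; [exact: hC|apply/gC/hU].
move=> hC gC; have [[hd hD] [gd gD]] := (hC, gC); split=> [x Ux|v].
  by apply: differentiable_comp; [exact: hd|apply/gd/hU].
have CkDv : Ck k U (fun z => \sum_i ('D_v h z) ord0 i *
    ('D_(delta_mx ord0 i) g \o h) z : R^o).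
  apply: (Ck_sum oU) => i; apply: (CkM oU); first exact: Ck_entry oU (hD v).
  by apply: IH => //; [exact: (Ck_mono hC)|exact: gD].
apply: (Ck_ext oU _ CkDv) => x; rewrite inE => Ux.
rewrite (derive_comp v (hd x Ux) (gd _ (hU _ Ux))).
by rewrite (derive_rV _ (gd _ (hU _ Ux))).
Qed.

Lemma Ck_comp_real V k (U : set V) (U' : set R^o) (h : V -> R^o)
    (g : R^o -> R^o) : open U ->
  (forall x, U x -> U' (h x)) -> Ck k U h -> Ck k U' g ->
  Ck k U (g \o h).
Proof.
move=> oU hU; elim: k g h hU => [|k IH] g h hU.
  by move=> hC gC x Ux; apply: continuous_comp; [exact: hC|apply/gC/hU].
move=> hC gC; have [[hd hD] [gd gD]] := (hC, gC); split=> [x Ux|v].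
  by apply: differentiable_comp; [exact: hd|apply/gd/hU].
have CkDv : Ck k U (fun z => 'D_v h z * ('D_1 g \o h) z : R^o).
  apply: (CkM oU (hD v)).
  by apply: IH => //; [exact: (Ck_mono hC)|exact: gD].
apply: (Ck_ext oU _ CkDv) => x; rewrite inE => Ux.
rewrite (derive_comp v (hd x Ux) (gd _ (hU _ Ux))).
by rewrite (derive_real _ (gd _ (hU _ Ux))).
Qed.

(** Used when the derivatives of [h] are expressed by [h] itself: each degree
    of smoothness of [h] then passes to its derivatives. *)
Lemma Ck_bootstrap V W (U : set V) (h : V -> W) :
  (forall x, U x -> differentiable h x) ->
  (forall k, Ck k U h -> forall v, Ck k U (fun x => 'D_v h x)) ->
  forall k, Ck k U h.
Proof.
move=> hd hD; elim=> [x Ux|k IH]; first exact: differentiable_continuous (hd x Ux).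
by split=> // v; exact: hD.
Qed.

End Ck_calculus.

Section smooth_calculus.
Context {R : realType}.
Implicit Types V W : normedModType R.

Lemma smooth_open V W (U : set V) (h : V -> W) : smooth U h -> open U.
Proof. by case. Qed.

Lemma smooth_diff V W (U : set V) (h : V -> W) x :
  smooth U h -> U x -> differentiable h x.
Proof. by move=> [_ /(_ 1)] /Ck_differentiable; apply. Qed.

Lemma smooth_cont V W (U : set V) (h : V -> W) x :
  smooth U h -> U x -> {for x, continuous h}.
Proof. by move=> [_ /(_ 0)] /Ck_continuous; apply. Qed.

Lemma smoothDer V W (U : set V) (h : V -> W) v :
  smooth U h -> smooth U (fun x => 'D_v h x).
Proof. by move=> [oU hC]; split=> // k; have [_] := hC k.+1; exact. Qed.

Lemma smooth_subset V W (U U' : set V) (h : V -> W) :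
  open U' -> U' `<=` U -> smooth U h -> smooth U' h.
Proof. by move=> oU' sU [oU hC]; split=> // k; exact: Ck_subset sU (hC k). Qed.

Lemma smooth_cst V W (U : set V) (c : W) : open U -> smooth U (fun=> c).
Proof. by move=> oU; split=> // k; exact: Ck_cst. Qed.

Lemma smooth_linear V W (U : set V) (l : {linear V -> W}) :
  open U -> continuous l -> smooth U l.
Proof. by move=> oU lc; split=> // k; exact: Ck_linear. Qed.

Lemma smooth_id V (U : set V) : open U -> smooth U (fun x => x).
Proof. by move=> oU; apply: (@smooth_linear V V U idfun) => // x; exact: cvg_id. Qed.

Lemma smoothD V W (U : set V) (g h : V -> W) :
  smooth U g -> smooth U h -> smooth U (fun z => g z + h z).
Proof. by move=> [oU gC] [_ hC]; split=> // k; exact: CkD. Qed.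

Lemma smoothM V (U : set V) (a b : V -> R^o) :
  smooth U a -> smooth U b -> smooth U (fun z => a z * b z : R^o).
Proof. by move=> [oU gC] [_ hC]; split=> // k; exact: CkM. Qed.

Lemma smoothN V (U : set V) (a : V -> R^o) :
  smooth U a -> smooth U (fun z => - a z : R^o).
Proof. by move=> [oU gC]; split=> // k; exact: CkN. Qed.

Lemma smooth_sum V W (U : set V) m (h : 'I_m -> V -> W) : open U ->
  (forall i, smooth U (h i)) -> smooth U (fun z => \sum_i h i z).
Proof.
move=> oU hC; split=> // k; apply: Ck_sum => // i.
by have [_] := hC i; exact.
Qed.

Lemma smooth_entries V m (U : set V) (h : V -> 'rV[R]_m.+1) : open U ->
  (forall j, smooth U (fun z => h z ord0 j : R^o)) -> smooth U h.
Proof.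
move=> oU hC; split=> // k; apply: Ck_entries => // i.
by have [_] := hC i; exact.
Qed.

Lemma smooth_entry V m (U : set V) (h : V -> 'rV[R]_m.+1) j :
  smooth U h -> smooth U (fun z => h z ord0 j : R^o).
Proof. by move=> [oU hC]; split=> // k; exact: Ck_entry. Qed.

Lemma smooth_scale V m (U : set V) (a : V -> R^o) (h : V -> 'rV[R]_m.+1) :
  smooth U a -> smooth U h -> smooth U (fun z => a z *: h z).
Proof. by move=> [oU gC] [_ hC]; split=> // k; exact: Ck_scale. Qed.

Lemma smooth_comp_row V m (U : set V) (U' : set 'rV[R]_m.+1)
    (h : V -> 'rV[R]_m.+1) (g : 'rV[R]_m.+1 -> R^o) :
  (forall x, U x -> U' (h x)) -> smooth U h -> smooth U' g ->
  smooth U (fun z => g (h z)).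
Proof.
by move=> hU [oU hC] [_ gC]; split=> // k; exact: (Ck_comp_row oU hU (hC k) (gC k)).
Qed.

Lemma smooth_comp_rowrow V m p (U : set V) (U' : set 'rV[R]_m.+1)
    (h : V -> 'rV[R]_m.+1) (g : 'rV[R]_m.+1 -> 'rV[R]_p.+1) :
  (forall x, U x -> U' (h x)) -> smooth U h -> smooth U' g ->
  smooth U (fun z => g (h z)).
Proof.
move=> hU hC gC; apply: smooth_entries => [|j]; first by case: hC.
by apply: (smooth_comp_row hU hC (g := fun z => g z ord0 j)); exact: smooth_entry.
Qed.

Lemma smooth_comp_real V (U : set V) (U' : set R^o) (h : V -> R^o)
    (g : R^o -> R^o) :
  (forall x, U x -> U' (h x)) -> smooth U h -> smooth U' g ->
  smooth U (fun z => g (h z) : R^o).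
Proof.
by move=> hU [oU hC] [_ gC]; split=> // k; exact: (Ck_comp_real oU hU (hC k) (gC k)).
Qed.

Lemma smooth_comp_realrow V m (U : set V) (U' : set R^o) (h : V -> R^o)
    (g : R^o -> 'rV[R]_m.+1) :
  (forall x, U x -> U' (h x)) -> smooth U h -> smooth U' g ->
  smooth U (fun z => g (h z)).
Proof.
move=> hU hC gC; apply: smooth_entries => [|j]; first by case: hC.
by apply: (smooth_comp_real hU hC (g := fun z => g z ord0 j)); exact: smooth_entry.
Qed.

End smooth_calculus.

Section smooth_functions.
Context {R : realType}.

Lemma smooth_primitive (U : set R^o) (g g' : R^o -> R^o) :
  (forall x, U x -> is_derive x (1 : R) g (g' x)) -> smooth U g' -> smooth U g.
Proof.
move=> gd [oU gC]; split=> // -[x Ux|k].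
  have [? _] := gd x Ux.
  by apply: differentiable_continuous; exact/derivable1_diffP.
have gdf x : U x -> differentiable g x.
  by move=> /gd[? _]; exact/derivable1_diffP.
split=> [//|v].
have C : Ck k U (fun x => v * g' x : R^o) by apply: CkM => //; exact: Ck_cst.
apply: (Ck_ext oU _ C) => x; rewrite inE => Ux.
rewrite derive_real; last exact: gdf.
by have [_ ->] := gd x Ux.
Qed.

(** For solutions of an autonomous differential equation [g' = F (g)], such as
    the inverse and the square root. *)
Lemma smooth_real_bootstrap (U : set R^o) (g g' : R^o -> R^o) : open U ->
  (forall x, U x -> is_derive x (1 : R) g (g' x)) ->
  (forall k, Ck k U g -> Ck k U g') -> smooth U g.
Proof.
move=> oU gd gC; have gdf x : U x -> differentiable g x.
  by move=> /gd[? _]; exact/derivable1_diffP.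
split=> //; apply: Ck_bootstrap => // k /gC g'C v.
have C : Ck k U (fun x => v * g' x : R^o) by apply: CkM => //; exact: Ck_cst.
apply: (Ck_ext oU _ C) => x; rewrite inE => Ux.
rewrite derive_real; last exact: gdf.
by have [_ ->] := gd x Ux.
Qed.

Lemma smooth_inv : smooth [set x : R^o | x != 0] (fun x : R^o => x^-1 : R^o).
Proof.
apply: (@smooth_real_bootstrap _ _ (fun x => - (x^-1 * x^-1))).
- exact: open_neq.
- move=> x /= x0; apply: is_derive_eq (is_deriveV _ _) _ => //.
  by rewrite -[_ *: _]/(_ * _) mulr1 expr2 invfM.
- by move=> k C; apply: CkN; [exact: open_neq|apply: CkM => //; exact: open_neq].
Qed.

Lemma smooth_sqrt : smooth [set x : R^o | 0 < x] (Num.sqrt : R^o -> R^o).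
Proof.
have o : open [set x : R^o | 0 < x] by exact: open_gt.
apply: (@smooth_real_bootstrap _ _ (fun x => (2 * Num.sqrt x)^-1)) => //.
move=> k C; have [_ /(_ k) iC] := smooth_inv.
apply: (@Ck_comp_real R R^o k _ _ (fun x => 2 * Num.sqrt x) _ o _ _ iC).
  by move=> x /= x0; rewrite mulf_neq0// gt_eqF// sqrtr_gt0.
by apply: CkM => //; exact: Ck_cst.
Qed.

Lemma smooth_trig : smooth (setT : set R^o) (cos : R^o -> R^o) /\
  smooth (setT : set R^o) (sin : R^o -> R^o).
Proof.
have : forall k, Ck k setT (cos : R^o -> R^o) /\ Ck k setT (sin : R^o -> R^o).
  have cd x : differentiable (cos : R^o -> R^o) x by exact/derivable1_diffP.
  have sd x : differentiable (sin : R^o -> R^o) x by exact/derivable1_diffP.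
  have oT : open [set: R^o] := openT.
  elim=> [|k [cC sC]].
    by split=> x _; apply: differentiable_continuous.
  split; split=> // v.
    have C : Ck k setT (fun x : R^o => v * - sin x : R^o).
      by apply: CkM => //; [exact: Ck_cst|exact: CkN].
    apply: (Ck_ext oT _ C) => x _; rewrite (derive_real _ (cd x)).
    by rewrite derive_val.
  have C : Ck k setT (fun x : R^o => v * cos x : R^o).
    by apply: CkM => //; exact: Ck_cst.
  apply: (Ck_ext oT _ C) => x _; rewrite (derive_real _ (sd x)).
  by rewrite derive_val.
by move=> C; split; split; [exact: openT|move=> k; case: (C k)|exact: openT|move=> k; case: (C k)].
Qed.

Definition smooth_cos := smooth_trig.1.
Definition smooth_sin := smooth_trig.2.

End smooth_functions.

(** * Mean values on lines and symmetry of second derivatives *)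

Section lines.
Context {R : realType} {V : normedModType R}.

Lemma is_derive_line (W : normedModType R) (h : V -> W) (v q : V) (c : R) :
  differentiable h (c *: v + q) ->
  is_derive c (1 : R) (fun a : R => h (a *: v + q)) ('D_v h (c *: v + q)).
Proof.
move=> hd; pose g (a : R^o) : V := a *: v + q.
have ld : is_diff (c : R^o) (fun a : R^o => a *: v) (fun a => a *: v).
  exact: is_diff_scalel.
have ldf : differentiable (fun a : R^o => a *: v) c by case: ld.
have gdf : differentiable g c.
  by apply: diffD_fun => //; exact: differentiable_cst.
have gv : 'D_1 g c = v.
  rewrite (@deriveD_fun R R^o V _ _ c 1 ldf (differentiable_cst q (c : R^o))) derive_cst addr0
    (deriveE _ ldf).
  by case: ld => _ ->; rewrite scale1r.
have cd : differentiable (h \o g) c by exact: differentiable_comp.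
apply: DeriveDef; first exact: diff_derivable.
by rewrite -[LHS]/('D_1 (h \o g) c) (@derive_comp R R^o V W g h c 1 gdf hd) gv.
Qed.

Lemma MVT_line (h : V -> R^o) (v q : V) (a b : R) : a < b ->
  (forall c, a <= c <= b -> differentiable h (c *: v + q)) ->
  exists2 c, a < c < b &
    h (b *: v + q) - h (a *: v + q) = 'D_v h (c *: v + q) * (b - a).
Proof.
move=> ab hd.
have hd' c : a <= c <= b ->
    is_derive c (1 : R) (fun a : R => h (a *: v + q) : R) ('D_v h (c *: v + q)).
  by move=> /hd; exact: is_derive_line.
have dd c : c \in `]a, b[ -> is_derive c (1 : R)
    (fun a : R => h (a *: v + q) : R) ('D_v h (c *: v + q)).
  by rewrite in_itv/= => /andP[ac cb]; apply: hd'; rewrite !ltW.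
have cc : {within `[a, b], continuous (fun a : R => h (a *: v + q) : R)}.
  apply: derivable_within_continuous => c; rewrite in_itv/= => /hd'.
  by case.
have [c cab E] := MVT ab dd cc.
by exists c => //; move: cab; rewrite in_itv.
Qed.

End lines.

Section schwarz.
Context {R : realType} {V : normedModType R}.

Let Delta (h : V -> R^o) (p v w : V) (s : R) : R :=
  h (s *: v + (s *: w + p)) - h (s *: v + p) - h (s *: w + p) + h p.

(** The mean value theorem along [v] turns the second difference of [h] into
    [s] times a first difference of [D_v h], which is linear in its increment
    up to a small error. *)
Let Delta_approx (U : set V) (h : V -> R^o) (p v w : V) (e : R) :
  smooth U h -> U p -> 0 < e ->
  \forall s \near (0 : R)^'+,
    `|Delta h p v w s - s ^+ 2 * 'D_w (fun z => 'D_v h z) p| <= e * s ^+ 2.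
Proof.
move=> hs Up e0; set g := fun z => 'D_v h z.
have gd : differentiable g p by exact: smooth_diff (smoothDer v hs) Up.
pose c := `|v| + (`|w| + `|v|).
have c0 : 0 <= c by rewrite !addr_ge0.
have e'0 : 0 < e / (c + 1) by rewrite divr_gt0// ltr_wpDl.
have /nbhs_ballP [r /= r0 rU] : nbhs p U.
  by apply: open_nbhs_nbhs; split=> //; exact: smooth_open hs.
have /nbhs_ballP [d /= d0 dg] := diff_eps gd e'0.
pose rd := Num.min r d.
have rd0 : 0 < rd by rewrite lt_min r0 d0.
near=> s.
have s0 : 0 < s by near: s; exact: nbhs_right_gt.
have sc : s * (c + 1) < rd.
  by rewrite -ltr_pdivlMr ?ltr_wpDl//; near: s; apply: nbhs_right_lt; rewrite divr_gt0// ltr_wpDl.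
have small a b : 0 <= a <= s -> 0 <= b <= s ->
  `|a *: v + b *: w| <= s * (`|v| + `|w|) /\ `|a *: v + b *: w| < rd.
  move=> /andP[a0 ass] /andP[b0 bs].
  have H : `|a *: v + b *: w| <= s * (`|v| + `|w|).
    rewrite (le_trans (ler_normD _ _))// !normrZ (ger0_norm a0) (ger0_norm b0).
    by rewrite mulrDr lerD ?ler_wpM2r.
  split=> //; apply: le_lt_trans sc; rewrite (le_trans H)// ler_wpM2l ?(ltW s0)//.
  by rewrite /c [`|v| + (_ + _)]addrA -[leRHS]addrA lerDl addr_ge0.
have inU a b : 0 <= a <= s -> 0 <= b <= s -> U (a *: v + (b *: w + p)).
  move=> /small H /H [_ {}H]; apply: rU; rewrite -ball_normE/= addrA opprD addrCA subrr addr0 normrN.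
  by rewrite (lt_le_trans H)// ge_min lexx.
have ss : 0 <= s <= s by rewrite lexx ltW.
have z0 : 0 <= (0 : R) <= s by rewrite lexx ltW.
pose phi (z : V) : R^o := h (z + s *: w) - h z.
have phid a : 0 <= a <= s -> differentiable phi (a *: v + p) /\
    'D_v phi (a *: v + p) = g (a *: v + (s *: w + p)) - g (a *: v + p).
  move=> a0.
  have h1 : differentiable h (a *: v + p).
    by apply: (smooth_diff hs); have := inU a 0 a0 z0; rewrite scale0r add0r.
  have h2 : differentiable h ((a *: v + p) + s *: w).
    by apply: (smooth_diff hs); rewrite -addrA (addrC p); exact: inU.
  have h3 : is_diff (a *: v + p) (fun z => z + s *: w) id.
    by apply: is_diff_eq; rewrite addr0.
  have h4 : differentiable (fun z : V => z + s *: w) (a *: v + p) by case: h3.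
  have h5 := differentiable_comp h4 h2.
  split; first by apply: diffD_fun => //; exact: diffN_fun.
  rewrite (deriveD_fun v h5 (diffN_fun h1)) (deriveN_fun v h1) (derive_comp v h4 h2).
  have -> : 'D_v (fun z : V => z + s *: w) (a *: v + p) = v.
    by rewrite (deriveE v h4); case: h3 => _ ->.
  by rewrite /g -addrA (addrC p).
have [a /andP[a0 ass] E] := @MVT_line R V phi v p 0 s s0 (fun a H => (phid a H).1).
have as' : 0 <= a <= s by rewrite !ltW.
have DE : Delta h p v w s = s * (g (a *: v + (s *: w + p)) - g (a *: v + p)).
  rewrite -(phid a as').2 mulrC; move: E; rewrite subr0 => <-.
  rewrite /Delta /phi scale0r add0r (addrC (s *: w) p) (addrA (s *: v)) opprB.
  by rewrite !addrA; ring.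
have G1 := dg (a *: v + s *: w); have G2 := dg (a *: v).
have [b1 b2] := small a s as' ss.
have [b3 b4] := small a 0 as' z0.
rewrite scale0r addr0 in b3 b4.
have {}G1 : `|g (a *: v + s *: w + p) - g p - 'd g p (a *: v + s *: w)| <= e / (c
  + 1) * (s * (`|v| + `|w|)).
  apply: le_trans (G1 _) _.
    by rewrite -ball_normE/= sub0r normrN (lt_le_trans b2)// ge_min lexx orbT.
  by rewrite ler_wpM2l// ltW.
have {}G2 : `|g (a *: v + p) - g p - 'd g p (a *: v)| <= e / (c + 1) * (s * `|v|).
  apply: le_trans (G2 _) _.
    by rewrite -ball_normE/= sub0r normrN (lt_le_trans b4)// ge_min lexx orbT.
  rewrite ler_wpM2l// ?(ltW e'0)// normrZ gtr0_norm// ler_wpM2r// ltW//.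
rewrite DE deriveE//.
have -> : s * (g (a *: v + (s *: w + p)) - g (a *: v + p)) - s ^+ 2 * 'd g p w =
   s * ((g (a *: v + s *: w + p) - g p - 'd g p (a *: v + s *: w)) -
        (g (a *: v + p) - g p - 'd g p (a *: v))).
  have lZ : 'd g p (s *: w) = s * 'd g p w by rewrite linearZ.
  rewrite addrA linearD lZ.
  set A := g _; set B := g _; set C := g _; set E1 := 'd g p w; set E2 := 'd g p (_ *: _).
  by rewrite expr2; lra.
rewrite normrM gtr0_norm// expr2 mulrCA ler_wpM2l// ?(ltW s0)//.
apply: le_trans (ler_normB _ _) _.
apply: le_trans (lerD G1 G2) _.
have -> : e / (c + 1) * (s * (`|v| + `|w|)) + e / (c + 1) * (s * `|v|) =
    e * s * (c / (c + 1)) by rewrite /c; field; rewrite gt_eqF// ltr_wpDl.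
by rewrite ler_piMr ?mulr_ge0 ?(ltW e0) ?(ltW s0)// ler_pdivrMr ?mul1r ?lerDl// ltr_wpDl.
Unshelve. all: by end_near. Qed.

(** The second difference [Delta h p v w s] is symmetric in [v] and [w]. *)
Lemma derive_sym (U : set V) (h : V -> R^o) (p v w : V) :
  smooth U h -> U p ->
  'D_w (fun z => 'D_v h z) p = 'D_v (fun z => 'D_w h z) p.
Proof.
move=> hs Up; apply/eqP; rewrite -subr_eq0 -normr_le0; apply/ler_addgt0Pl => e e0.
rewrite addr0; have e20 : 0 < e / 2 by rewrite divr_gt0.
have D1 := @Delta_approx U h p v w _ hs Up e20.
have D2 := @Delta_approx U h p w v _ hs Up e20.
have D3 : \forall s \near (0 : R)^'+, (
    `|Delta h p v w s - s ^+ 2 * 'D_w (fun z => 'D_v h z) p| <= e / 2 * s ^+ 2 /\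
    `|Delta h p w v s - s ^+ 2 * 'D_v (fun z => 'D_w h z) p| <= e / 2 * s ^+ 2) /\
    0 < s.
  by apply: filterI; [exact: filterI D1 D2|exact: nbhs_right_gt].
have [s [[A1 A2] s0]] := @filter_ex _ _ (at_right_proper_filter 0) _ D3.
have sym : Delta h p w v s = Delta h p v w s.
  rewrite /Delta (addrCA (s *: w)); congr (_ + _); exact: addrAC.
rewrite sym in A2; have s20 : 0 < s ^+ 2 by rewrite exprn_gt0.
rewrite -(ler_pM2r s20) -{1}(ger0_norm (ltW s20)) -normrM.
set A := 'D_w _ p in A1 *; set B := 'D_v _ p in A2 *; set D := Delta _ _ _ _ _ in A1 A2.
have -> : (A - B) * s ^+ 2 = (D - s ^+ 2 * B) - (D - s ^+ 2 * A) by ring.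
apply: le_trans (ler_normB _ _) _; apply: le_trans (lerD A2 A1) _.
by rewrite -mulrDl -splitr.
Qed.
End schwarz.

Lemma derive_sym_row (R : realType) (V : normedModType R) (m : nat) (U : set V)
    (h : V -> 'rV[R]_m.+1) (p v w : V) : smooth U h -> U p ->
  'D_w (fun z => 'D_v h z) p = 'D_v (fun z => 'D_w h z) p.
Proof.
move=> hs Up; apply/rowP => j.
have oU := smooth_open hs.
have H a b : ('D_a (fun z => 'D_b h z) p) ord0 j =
    'D_a (fun z => 'D_b (fun z => h z ord0 j : R^o) z) p.
  rewrite -derive_entry; last exact: smooth_diff (smoothDer b hs) Up.
  apply: near_eq_derive; apply: filterS (open_nbhs_nbhs (conj oU Up)) => z Uz.
  by rewrite derive_entry//; exact: smooth_diff hs Uz.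
have E := @derive_sym R V U (fun z => h z ord0 j : R^o) p v w (smooth_entry j hs) Up.
exact: (etrans (H w v) (etrans E (esym (H v w)))).
Qed.

(** * The implicit function theorem *)

Section nearness.
Context {R : realType} {V : normedModType R}.

Lemma near_gt (g : V -> R^o) (x : V) (a : R) :
  {for x, continuous g} -> a < g x -> \forall z \near x, a < g z.
Proof. by move=> gc ag; exact: (gc _ (lt_nbhsr ag)). Qed.

Lemma near_lt (g : V -> R^o) (x : V) (a : R) :
  {for x, continuous g} -> g x < a -> \forall z \near x, g z < a.
Proof. by move=> gc ag; exact: (gc _ (lt_nbhsl ag)). Qed.

Lemma near_dist (x : V) (e : R) : 0 < e -> \forall z \near x, `|z - x| < e.
Proof.
move=> e0; apply: filterS (nbhsx_ballx x e e0) => z.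
by rewrite -ball_normE/= distrC.
Qed.

Lemma near_distP (x : V) (P : V -> Prop) : (\forall z \near x, P z) ->
  exists2 e : R, 0 < e & forall z, `|z - x| < e -> P z.
Proof.
move=> /nbhs_ballP [e /= e0 eP]; exists e => // z zx; apply: eP.
by rewrite -ball_normE/= distrC.
Qed.

Lemma open_dist (x : V) (e : R) : open [set z : V | `|z - x| < e].
Proof.
have -> : [set z : V | `|z - x| < e] = ball x e.
  by rewrite -ball_normE; apply/seteqP; split=> z /=; rewrite distrC.
exact: ball_open.
Qed.
End nearness.

Section implicit_function.
Context {R : realType} {m : nat}.
Let V := 'rV[R]_m.+1.

(** [beta z] is the parameter at which the line through [z] with direction [v]
    meets the zero set of [G]. On such lines near [p] the function [G] is
    increasing and changes sign, which gives existence, uniqueness and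
    continuity of [beta]; the first-order expansion of [G] then gives
    [d beta = - dG / D_v G] at the point of the zero set, an expression in
    [beta] from which smoothness follows by bootstrapping. *)
Lemma implicit_function_pos (U : set V) (G : V -> R^o) (p v : V) :
  smooth U G -> U p -> G p = 0 -> 0 < 'D_v G p ->
  exists N : set V, exists beta : V -> R^o,
    [/\ N p, smooth N beta,
       (forall z, N z -> U (z + beta z *: v) /\ G (z + beta z *: v) = 0) &
       (forall z, N z -> G z = 0 -> beta z = 0)].
Proof.
move=> Gs Up Gp0 DGp.
have oU := smooth_open Gs.
have [r r0 rU] : exists2 r : R, 0 < r &
    forall z : V, `|z - p| < r -> U z /\ 0 < 'D_v G z.
  apply: near_distP; apply: filterI; first exact: open_nbhs_nbhs.
  exact: near_gt (smooth_cont (smoothDer v Gs) Up) DGp.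
pose d := r / 2 / (`|v| + 1).
have v1 : 0 < `|v| + 1 by rewrite ltr_wpDl.
have d0 : 0 < d by rewrite !divr_gt0.
have inr (z : V) (b : R) : `|z - p| < r / 2 -> `|b| <= d -> `|z + b *: v - p| < r.
  move=> zp bd; rewrite addrAC (le_lt_trans (ler_normD _ _))//.
  rewrite [ltRHS]splitr ltr_leD// normrZ.
  rewrite (@le_trans _ _ (d * (`|v| + 1)))//; last by rewrite divfK// gt_eqF.
  by rewrite ler_pM// lerDl.
have mono (z : V) (b1 b2 : R) : `|z - p| < r / 2 -> -d <= b1 -> b1 < b2 -> b2 <= d ->
    G (z + b1 *: v) < G (z + b2 *: v).
  move=> zp db b12 bd; rewrite -subr_gt0.
  have H c : b1 <= c <= b2 -> U (c *: v + z) /\ 0 < 'D_v G (c *: v + z).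
    move=> /andP[bc cb]; rewrite addrC; apply/rU/inr => //.
    by rewrite ler_norml (le_trans db)// (le_trans cb).
  have [c /andP[bc cb] E] := @MVT_line R V G v z b1 b2 b12
    (fun c h => smooth_diff Gs (H c h).1).
  rewrite (addrC z) (addrC z) E mulr_gt0 ?subr_gt0//.
  by have [] := H c; rewrite ?ltW// !ltW.
have dd : -d < d by rewrite gtrN.
have pr : `|p - p| < r / 2 by rewrite subrr normr0 divr_gt0.
have Gd : 0 < G (p + d *: v).
  have := mono p 0 d pr _ d0 (lexx _).
  by rewrite scale0r addr0 Gp0 oppr_le0 ltW//; exact.
have GNd : G (p + (- d) *: v) < 0.
  have := mono p (- d) 0 pr (lexx _) _ (ltW d0).
  by rewrite scale0r addr0 Gp0 oppr_lt0; exact.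
have Gcont (b : R) (z : V) : `|z - p| < r / 2 -> `|b| <= d ->
    {for z, continuous (fun z : V => G (z + b *: v : V))}.
  move=> zp bd; apply: (@continuous_comp _ _ _ (fun z : V => z + b *: v : V) G).
    apply: differentiable_continuous.
    have idd : differentiable (fun z : V => z) z by case: (is_diff_id z).
    exact: (diffD_fun idd (differentiable_cst (b *: v) z)).
  exact: (smooth_cont Gs (rU _ (inr _ _ zp bd)).1).
have nd : `|d| <= d by rewrite gtr0_norm.
have nNd : `|- d| <= d by rewrite normrN gtr0_norm.
have r20 : 0 < r / 2 by rewrite divr_gt0.
have [r' r'0 r'G] : exists2 r' : R, 0 < r' & forall z : V, `|z - p| < r' ->
    (0 < G (z + d *: v) /\ G (z + (- d) *: v) < 0) /\ `|z - p| < r / 2.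
  apply: near_distP; apply: filterI; last exact: (@near_dist R V p _ r20).
  apply: filterI; first exact: near_gt (Gcont d p pr nd) Gd.
  exact: near_lt (Gcont (- d) p pr nNd) GNd.
pose N := [set z : V | `|z - p| < r'].
have betaP (z : V) : exists b, N z -> [/\ - d < b, b < d & G (z + b *: v) = 0].
  have [Nz|] := pselect (N z); last by exists 0.
  have [[Gp Gn] zp] := r'G z Nz.
  have cG : {within `[-d, d], continuous (fun b : R => G (b *: v + z) : R)}.
    apply: derivable_within_continuous => b; rewrite in_itv/= -ler_norml => bd.
    have Gd' : differentiable G (b *: v + z).
      by rewrite addrC; exact: (smooth_diff Gs (rU _ (inr _ _ zp bd)).1).
    by case: (is_derive_line Gd').
  have Gpn : G (z + (- d) *: v) < G (z + d *: v) by exact: lt_trans Gn Gp.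
  have [|b] := @IVT R _ (-d) d 0 (ltW dd) cG.
    rewrite !(addrC _ z) (min_l (ltW Gpn)) (max_r (ltW Gpn)).
    by rewrite !ltW.
  rewrite in_itv/= (addrC _ z) => /andP[db bd] Gb; exists b => _; split=> //.
  - rewrite lt_neqAle db andbT; apply/eqP => E.
    by rewrite -E in Gb; rewrite Gb ltxx in Gn.
  - rewrite lt_neqAle bd andbT; apply/eqP => E.
    by rewrite E in Gb; rewrite Gb ltxx in Gp.
have [beta betaN] := choice betaP.
have lt_beta (z : V) (b : R) : N z -> - d <= b -> b < beta z -> G (z + b *: v) < 0.
  move=> Nz db bb; have [bN b1 b2] := betaN z Nz.
  by rewrite -b2 mono ?(ltW b1)//; have [_] := r'G z Nz.
have gt_beta (z : V) (b : R) : N z -> b <= d -> beta z < b -> 0 < G (z + b *: v).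
  move=> Nz db bb; have [bN b1 b2] := betaN z Nz.
  by rewrite -b2 mono ?(ltW bN)//; have [_] := r'G z Nz.
have oN : open N by exact: open_dist.
have bcont (z0 : V) : N z0 -> forall e : R, 0 < e ->
    \forall z \near z0, `|beta z - beta z0| < e.
  move=> Nz0 e e0; have [b1 b2 Gb] := betaN z0 Nz0.
  have [_ z0p] := r'G z0 Nz0.
  pose e1 := Num.min (e / 2) (Num.min (beta z0 + d) (d - beta z0)).
  have e10 : 0 < e1 by rewrite !lt_min divr_gt0//=; lra.
  have e1e : e1 <= e / 2 by rewrite ge_min lexx.
  have e1l : e1 <= beta z0 + d by rewrite !ge_min lexx orbT.
  have e1r : e1 <= d - beta z0 by rewrite !ge_min lexx !orbT.
  have nl : `|beta z0 - e1| <= d by rewrite ler_norml; lra.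
  have nr : `|beta z0 + e1| <= d by rewrite ler_norml; lra.
  have Gl : G (z0 + (beta z0 - e1) *: v) < 0 by apply: lt_beta => //; lra.
  have Gr : 0 < G (z0 + (beta z0 + e1) *: v) by apply: gt_beta => //; lra.
  have N1 := near_lt (Gcont _ z0 z0p nl) Gl.
  have N2 := near_gt (Gcont _ z0 z0p nr) Gr.
  have N3 : \forall z \near z0, N z by exact: open_nbhs_nbhs.
  have N4 : \forall z \near z0, (G (z + (beta z0 - e1) *: v) < 0 /\
      0 < G (z + (beta z0 + e1) *: v)) /\ N z.
    by apply: filterI N3; exact: filterI N1 N2.
  apply: filterS N4 => z [[Gl' Gr'] Nz].
  rewrite ltr_norml; apply/andP; split.
    rewrite ltNge; apply/negP => H.
    have : 0 < G (z + (beta z0 - e1) *: v) by apply: gt_beta => //; lra.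
    by move=> /(lt_trans Gl'); rewrite ltxx.
  rewrite ltNge; apply/negP => H.
  have : G (z + (beta z0 + e1) *: v) < 0 by apply: lt_beta => //; lra.
  by move=> /(lt_trans Gr'); rewrite ltxx.
pose P (z : V) : V := z + beta z *: v.
have NP (z : V) : N z -> [/\ U (P z), G (P z) = 0 & 0 < 'D_v G (P z)].
  move=> Nz; have [b1 b2 Gb] := betaN z Nz; have [_ zp] := r'G z Nz.
  by have [] := rU (P z) (inr _ _ zp _); rewrite // ler_norml !ltW.
have bdiff (z0 : V) : N z0 -> differentiable beta z0 /\
    forall w, 'D_w beta z0 = - ('D_v G (P z0))^-1 * 'D_w G (P z0).
  move=> Nz0; have [UP GP DP] := NP z0 Nz0.
  have Gd' := smooth_diff Gs UP.
  pose a := 'D_v G (P z0).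
  have lc : continuous ('d G (P z0)) by exact: diff_continuous.
  pose L : {linear V -> R^o} := (- a^-1) \*: 'd G (P z0).
  have LE h : L h = - a^-1 * 'd G (P z0) h by [].
  have [C C0 CP] := linear_lipschitz lc.
  have bd : is_diff z0 beta L.
    apply: diff_epsP => [|e e0].
      by move=> h; apply: continuousZl_tmp; exact: lc.
    (* [B] is the constant of the estimate [|k| <= a B |h|] for the increment
       [k = h + D v] of the point, which holds once the error in the expansion
       of [G] is below [a / (2 (|v| + 1))] and can be absorbed. *)
    pose B := 1 / a * (1 + 2 * `|v| * (C + 1) / a).
    have B0 : 0 < B.
      rewrite mulr_gt0 ?divr_gt0// ltr_wpDr// divr_ge0 ?(ltW DP)//.
      by rewrite !mulr_ge0// addr_ge0// ltW.
    pose e' := Num.min (Num.min 1 (a / (2 * (`|v| + 1)))) (e / B).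
    have e'0 : 0 < e'.
      by rewrite !lt_min ltr01 !divr_gt0// mulr_gt0.
    have e'1 : e' <= 1 by rewrite !ge_min lexx.
    have e'2 : e' <= a / (2 * (`|v| + 1)) by rewrite !ge_min lexx orbT.
    have e'3 : e' <= e / B by rewrite !ge_min lexx orbT.
    have [d1 d10 d1P] := near_distP (diff_eps Gd' e'0).
    have nb : \forall k \near (0 : V), (N (k + z0) /\
        `|beta (k + z0) - beta z0| < d1 / (2 * (`|v| + 1))) /\ `|k - 0| < d1 / 2.
      have d12 : 0 < d1 / 2 by rewrite divr_gt0.
      apply: filterI; last exact: (@near_dist R V 0 _ d12).
      apply: (@near_shift0 R V z0 (fun z => N z /\ `|beta z - beta z0| < d1 / (2 * (`|v| + 1)))).
      apply: filterI; first exact: open_nbhs_nbhs.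
      by apply: bcont => //; rewrite divr_gt0// mulr_gt0.
    apply: filterS nb => h [[Nh bh] hh].
    rewrite subr0 in hh.
    pose D := beta (h + z0) - beta z0.
    pose k := h + D *: v.
    have Pk : P (h + z0) = k + P z0.
      by rewrite /P /k /D scalerBl addrACA subrK.
    have kn : `|k| <= `|h| + `|D| * `|v|.
      by rewrite (le_trans (ler_normD _ _))// normrZ.
    have kd : `|k - 0| < d1.
      rewrite subr0 (le_lt_trans kn)// [ltRHS]splitr ltr_leD//.
      rewrite (@le_trans _ _ (d1 / (2 * (`|v| + 1)) * (`|v| + 1)))//.
        by rewrite ler_pM// ?(ltW bh)// lerDl.
      by rewrite invfM mulrA divfK ?gt_eqF.
    have [_ GPh _] := NP _ Nh; rewrite Pk in GPh.
    have := d1P k kd; rewrite GPh GP subr0 sub0r normrN.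
    have -> : 'd G (P z0) k = 'd G (P z0) h + D * a.
      by rewrite /k linearD linearZ /a deriveE.
    set l := 'd G (P z0) h => kl.
    have lC : `|l| <= C * `|h| by exact: CP.
    have a0 : 0 < a := DP.
    rewrite LE -/l -/D.
    have -> : D - - a^-1 * l = (l + D * a) / a by field; rewrite gt_eqF.
    rewrite normrM normfV (gtr0_norm a0) ler_pdivrMr//.
    have Da : `|D| * a <= `|l + D * a| + `|l|.
      have -> : `|D| * a = `|(l + D * a) - l|.
        by rewrite -{1}(gtr0_norm a0) -normrM; congr `|_|; ring.
      exact: ler_normB.
    have e'v : e' * (`|v| + 1) <= a / 2.
      by move: e'2; rewrite invfM mulrA ler_pdivlMr.
    have e'B : e' * B <= e by rewrite -ler_pdivlMr.
    set X := `|l + D * a| in kl Da *; set nh := `|h| in kn hh lC kl *.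
    set nD := `|D| in kn Da *; set nv := `|v| in kn e'v v1 *.
    have nh0 : 0 <= nh by exact: normr_ge0.
    have nD0 : 0 <= nD by exact: normr_ge0.
    have nv0 : 0 <= nv by exact: normr_ge0.
    have kl' : X <= e' * (nh + nD * nv).
      by apply: le_trans kl _; rewrite ler_wpM2l// ltW.
    have H1 : e' * (nD * nv) <= nD * (a / 2).
      rewrite mulrCA ler_wpM2l//; apply: le_trans e'v.
      by rewrite ler_wpM2l ?lerDl// ltW.
    have H2 : e' * nh <= nh by rewrite ler_piMl.
    have H3 : nD * a <= 2 * (1 + C) * nh by lra.
    have H4 : nD <= 2 * (1 + C) * nh / a by rewrite ler_pdivlMr.
    have H5 : nh + nD * nv <= nh * (B * a).
      have -> : nh * (B * a) = nh + 2 * (1 + C) * nh / a * nv.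
        by rewrite /B -/nv; field; rewrite gt_eqF.
      by rewrite lerD2l ler_wpM2r.
    apply: le_trans kl' _.
    apply: (@le_trans _ _ (e' * (nh * (B * a)))); first by rewrite ler_wpM2l// ltW.
    have -> : e' * (nh * (B * a)) = e' * B * (nh * a) by ring.
    by rewrite -[leRHS]mulrA ler_wpM2r// mulr_ge0// ltW.
  have bdf : differentiable beta z0 by case: bd.
  split=> // w; rewrite (deriveE w bdf); case: bd => _ ->.
  by rewrite LE (deriveE w Gd').
have bs : smooth N beta.
  split=> //; apply: Ck_bootstrap => [z /bdiff[]//|k bC w].
  have PC : Ck k N P.
    apply: CkD => //; first by have [_] := smooth_id oN; exact.
    by apply: Ck_scale => //; exact: Ck_cst.
  have NP1 (z : V) : N z -> U (P z) by case/NP.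
  have C1 : Ck k N (fun z => 'D_v G (P z) : R^o).
    exact: (Ck_comp_row oN NP1 PC ((smoothDer v Gs).2 k)).
  have C2 : Ck k N (fun z => 'D_w G (P z) : R^o).
    exact: (Ck_comp_row oN NP1 PC ((smoothDer w Gs).2 k)).
  have C3 : Ck k N (fun z => ('D_v G (P z))^-1 : R^o).
    have [_ /(_ k) iC] := @smooth_inv R.
    apply: (Ck_comp_real oN _ C1 iC) => z /NP[_ _ H] /=.
    by rewrite gt_eqF.
  have C4 : Ck k N (fun z => - ('D_v G (P z))^-1 * 'D_w G (P z) : R^o).
    by apply: CkM => //; exact: CkN.
  apply: (Ck_ext oN _ C4) => z; rewrite inE => Nz.
  by rewrite (bdiff z Nz).2.
exists N, beta; split=> //.
- by rewrite /N/= subrr normr0.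
- by move=> z /NP[].
move=> z Nz Gz; have [b1 b2 Gb] := betaN z Nz.
have [bn|bp|//] := ltgtP (beta z) 0.
- have := gt_beta z 0 Nz (ltW d0) bn.
  by rewrite scale0r addr0 Gz ltxx.
- have := lt_beta z 0 Nz _ bp.
  by rewrite scale0r addr0 Gz ltxx oppr_le0 ltW// => /(_ isT).
Qed.

Lemma implicit_function (U : set V) (G : V -> R^o) (p v : V) :
  smooth U G -> U p -> G p = 0 -> 'D_v G p != 0 ->
  exists N : set V, exists beta : V -> R^o,
    [/\ N p, smooth N beta,
       (forall z, N z -> U (z + beta z *: v) /\ G (z + beta z *: v) = 0) &
       (forall z, N z -> G z = 0 -> beta z = 0)].
Proof.
move=> Gs Up Gp0; rewrite neq_lt => /orP[D0|]; last exact: implicit_function_pos Gs Up Gp0.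
have Gd := smooth_diff Gs Up.
have G0 : - G p = 0 by rewrite Gp0 oppr0.
have GD : 0 < 'D_v (fun z => - G z : R^o) p by rewrite (deriveN_fun v Gd) oppr_gt0.
have [N [beta [Np bs b1 b2]]] := implicit_function_pos (smoothN Gs) Up G0 GD.
exists N, beta; split=> // z Nz; last by move=> Gz; apply: b2; rewrite ?Gz ?oppr0.
by have [? /eqP] := b1 z Nz; rewrite oppr_eq0 => /eqP.
Qed.

End implicit_function.

(** * Coordinates of the ambient space *)

Section coordinates.
Context {R : realType} {n : nat}.
Local Notation V := 'rV[R]_n.+1.
Implicit Types a b c : V.
Local Notation dt := (@partial_t R n).

Definition dot (a b : V) : R^o := \sum_i a ord0 i * b ord0 i.

Lemma dotC a b : dot a b = dot b a.
Proof. by apply: eq_bigr => i _; rewrite mulrC. Qed.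

Lemma dotDl a b c : dot (a + b) c = dot a c + dot b c.
Proof. by rewrite -big_split; apply: eq_bigr => i _; rewrite mxE mulrDl. Qed.

Lemma dotZl (k : R) a b : dot (k *: a) b = k * dot a b.
Proof. by rewrite /dot mulr_sumr; apply: eq_bigr => i _; rewrite mxE mulrA. Qed.

Lemma dotDr a b c : dot a (b + c) = dot a b + dot a c.
Proof. by rewrite dotC dotDl !(dotC a). Qed.

Lemma dotZr (k : R) a b : dot a (k *: b) = k * dot a b.
Proof. by rewrite dotC dotZl (dotC b). Qed.

Lemma dotNl a b : dot (- a) b = - dot a b.
Proof. by rewrite -scaleN1r dotZl mulN1r. Qed.

Lemma dotNr a b : dot a (- b) = - dot a b.
Proof. by rewrite dotC dotNl dotC. Qed.

Lemma dot0l a : dot 0 a = 0.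
Proof. by rewrite -(scale0r 0) dotZl mul0r. Qed.

Lemma dot0r a : dot a 0 = 0.
Proof. by rewrite dotC dot0l. Qed.

Lemma dot_ge0 a : 0 <= dot a a.
Proof. by apply: sumr_ge0 => i _; rewrite -expr2 sqr_ge0. Qed.

Lemma dot_eq0 a : dot a a = 0 -> a = 0.
Proof.
move=> /eqP; rewrite psumr_eq0 => [/allP h|i _]; last by rewrite -expr2 sqr_ge0.
apply/rowP => i; rewrite mxE; have := h i (mem_index_enum _).
by rewrite /= mulf_eq0 orbb => /eqP.
Qed.

Definition dotE := (dotDl, dotDr, dotZl, dotZr, dotNl, dotNr).

Lemma tcoordD a b : tcoord (a + b) = tcoord a + tcoord b.
Proof. by rewrite /tcoord mxE. Qed.

Lemma tcoordZ (k : R) a : tcoord (k *: a) = k * tcoord a.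
Proof. by rewrite /tcoord mxE. Qed.

Lemma tcoordN a : tcoord (- a) = - tcoord a.
Proof. by rewrite /tcoord mxE. Qed.

Lemma tcoord_dt : tcoord dt = 1.
Proof. by rewrite /tcoord mxE !eqxx. Qed.

Fact spat_key : unit. Proof. exact: tt. Qed.

(** The spatial part of a vector, locked so that rewriting with the linearity
    of [dot] stops there. *)
Definition spat : V -> V := locked_with spat_key (@radial R n).

Lemma spatE : @radial R n = spat.
Proof. by rewrite /spat unlock. Qed.

Let spatDef a : spat a = a - tcoord a *: dt.
Proof. by rewrite -spatE. Qed.

Lemma spatD a b : spat (a + b) = spat a + spat b.
Proof. by rewrite !spatDef tcoordD scalerDl opprD addrACA. Qed.

Lemma spatZ (k : R) a : spat (k *: a) = k *: spat a.
Proof. by rewrite !spatDef tcoordZ scalerBr scalerA. Qed.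

Lemma spat0 : spat 0 = 0.
Proof. by rewrite -{1}(scale0r (0 : V)) spatZ scale0r. Qed.

Lemma spatN a : spat (- a) = - spat a.
Proof. by rewrite -scaleN1r spatZ scaleN1r. Qed.

Lemma spat_dt : spat dt = 0.
Proof. by rewrite !spatDef tcoord_dt scale1r subrr. Qed.

Lemma tcoord_spat a : tcoord (spat a) = 0.
Proof. by rewrite !spatDef tcoordD tcoordN tcoordZ tcoord_dt mulr1 subrr. Qed.

Lemma spatK a : spat (spat a) = spat a.
Proof. by rewrite {1}spatDef tcoord_spat scale0r subr0. Qed.

Lemma time_space_split a : a = tcoord a *: dt + spat a.
Proof. by rewrite spatDef addrC subrK. Qed.

Lemma time_space_eq a b : tcoord a = tcoord b -> spat a = spat b -> a = b.
Proof. by move=> h1 h2; rewrite (time_space_split a) (time_space_split b) h1 h2. Qed.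

Lemma dot_dt a : dot dt a = tcoord a.
Proof.
rewrite /dot (bigD1 ord0)//= big1 ?addr0 => [|i i0]; first by rewrite mxE !eqxx mul1r.
by rewrite mxE (negbTE i0) andbF mul0r.
Qed.

Lemma rwgE (f : R -> R) p a b :
  rwg f p a b = - (tcoord a * tcoord b) + f (tcoord p) ^+ 2 * dot (spat a) (spat b).
Proof.
have re c i : spat c ord0 (lift ord0 i) = c ord0 (lift ord0 i).
  by rewrite spatDef !mxE/= mulr0 subr0.
have r0 c : spat c ord0 ord0 = 0 by exact: tcoord_spat.
rewrite /rwg !mxE big_ord_recl /dot [in RHS]big_ord_recl r0 mul0r add0r; congr (_ + _).
  rewrite !mxE big_ord_recl big1 => [|i _]; last by rewrite !mxE/= mulr0.
  by rewrite !mxE !eqxx/= /tcoord addr0 mulrN1 mulNr.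
rewrite mulr_sumr; apply: eq_bigr => i _; rewrite !re !mxE (bigD1 (lift ord0 i))//=.
rewrite big1 ?addr0 => [|j ji]; last by rewrite !mxE (negbTE ji) mulr0.
by rewrite !mxE !eqxx/= mulrAC mulrC mulrA.
Qed.

Lemma rw_spaceE (I : set R) p :
  rw_space I p <-> I (tcoord p) /\ dot (spat p) (spat p) = 1.
Proof.
have -> : dot (spat p) (spat p) = \sum_i xcoord p ord0 i ^+ 2.
  rewrite /dot big_ord_recl -[spat p ord0 ord0]/(tcoord (spat p)) tcoord_spat mul0r add0r.
  by apply: eq_bigr => i _; rewrite spatDef !mxE/= mulr0 subr0 expr2.
by [].
Qed.

(** The hypothesis on the dimension of the sphere enters through this lemma. *)
Lemma exists_unit_normal (s : seq V) : (size s <= n)%N ->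
  exists2 e : V, dot e e = 1 & {in s, forall a, dot e a = 0}.
Proof.
move=> sn; pose M : 'M[R]_(n.+1, size s) := \matrix_(i, j) nth 0 s j ord0 i.
have : (0 < \rank (kermx M))%N.
  by rewrite mxrank_ker subn_gt0 (leq_ltn_trans (rank_leq_col _)).
rewrite lt0n mxrank_eq0 => /rowV0Pn [e /sub_kermxP eM e0].
have ee : 0 < dot e e.
  by rewrite lt_neqAle dot_ge0 andbT eq_sym; apply: contra_neq e0 => /dot_eq0.
exists ((Num.sqrt (dot e e))^-1 *: e).
  rewrite dotZl dotZr mulrA -invfM -expr2 sqr_sqrtr ?dot_ge0// mulVf// gt_eqF//.
move=> a as_; rewrite dotZl [dot e a](_ : _ = 0) ?mulr0//.
have ia : (index a s < size s)%N by rewrite index_mem.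
have := congr1 (fun N : 'rV__ => N ord0 (Ordinal ia)) eM.
rewrite [in RHS]mxE => <-; rewrite mxE; apply: eq_bigr => i _.
by rewrite mxE/= nth_index.
Qed.

Section derivatives.
Context {W : normedModType R}.
Implicit Types (A B : W -> V) (z w : W).

Lemma diff_tcoord A z : differentiable A z -> differentiable (fun z => tcoord (A z) : R^o) z.
Proof. exact: differentiable_entry. Qed.

Lemma derive_tcoord A z w : differentiable A z ->
  'D_w (fun z => tcoord (A z) : R^o) z = tcoord ('D_w A z).
Proof. exact: derive_entry. Qed.

Lemma diff_spat A z : differentiable A z -> differentiable (fun z => spat (A z)) z.
Proof.
move=> Ad; under eq_fun do rewrite spatDef.
apply: diffD_fun => //; apply: diffN_fun; apply: differentiableZl.
exact: diff_tcoord.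
Qed.

Lemma derive_spat A z w : differentiable A z ->
  'D_w (fun z => spat (A z)) z = spat ('D_w A z).
Proof.
move=> Ad; have td := diff_tcoord Ad.
have sd : differentiable (fun z => tcoord (A z) *: dt) z by exact: differentiableZl.
rewrite (_ : (fun z => spat (A z)) = fun z => A z + - (tcoord (A z) *: dt)); last first.
  by apply/funext => y; rewrite spatDef.
rewrite spatDef (deriveD_fun w Ad (diffN_fun sd)) (deriveN_fun w sd).
rewrite (derive_scale w td (differentiable_cst dt z)) derive_cst scaler0 addr0.
by rewrite derive_tcoord.
Qed.

Lemma diff_dot A B z : differentiable A z -> differentiable B z ->
  differentiable (fun z => dot (A z) (B z)) z.
Proof.
move=> Ad Bd; apply: diffsum_fun => i.
by apply: diffM_fun; exact: differentiable_entry.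
Qed.

Lemma derive_dot A B z w : differentiable A z -> differentiable B z ->
  'D_w (fun z => dot (A z) (B z)) z = dot ('D_w A z) (B z) + dot (A z) ('D_w B z).
Proof.
move=> Ad Bd.
have dA i : differentiable (fun z => A z ord0 i : R^o) z by exact: differentiable_entry.
have dB i : differentiable (fun z => B z ord0 i : R^o) z by exact: differentiable_entry.
rewrite (derivesum_fun w (fun i => diffM_fun (dA i) (dB i))) -big_split.
apply: eq_bigr => i _; rewrite (deriveM_fun w (dA i) (dB i)).
rewrite (derive_entry w ord0 i Ad) (derive_entry w ord0 i Bd).
by rewrite addrC; congr (_ + _); rewrite mulrC.
Qed.

Lemma smooth_tcoord (U : set W) A : smooth U A -> smooth U (fun z => tcoord (A z) : R^o).
Proof. exact: smooth_entry. Qed.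

Lemma smooth_spat (U : set W) A : smooth U A -> smooth U (fun z => spat (A z)).
Proof.
move=> As; have oU := smooth_open As.
rewrite (_ : (fun z => spat (A z)) = fun z => A z + (- tcoord (A z)) *: dt).
  apply: smoothD => //; apply: smooth_scale; last exact: smooth_cst.
  by apply: smoothN; exact: smooth_tcoord.
by apply/funext => z; rewrite scaleNr spatDef.
Qed.

Lemma smooth_dot (U : set W) A B : smooth U A -> smooth U B ->
  smooth U (fun z => dot (A z) (B z)).
Proof.
move=> As Bs; apply: smooth_sum => [|i]; first exact: smooth_open As.
by apply: smoothM; exact: smooth_entry.
Qed.

End derivatives.

(** * Tangent vectors and retractions *)

Lemma near_at0 (J : set R) (P : R -> Prop) (s : R) : open J -> J s ->
  (forall s, J s -> P s) -> \forall r \near (s : R^o), P r.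
Proof. by move=> oJ Js JP; apply: filterS JP _; exact: open_nbhs_nbhs. Qed.

Lemma tangent_subset (W : normedModType R) (A B : set W) p :
  A `<=` B -> tangent A p `<=` tangent B p.
Proof. by move=> AB v [J [c [J0 cs cA c0 cv]]]; exists J, c; split=> // s /cA /AB. Qed.

(** An equation of [A] bounds the tangent spaces of [A] from above; the next
    lemma bounds them from below by means of maps into [A]. *)
Lemma tangent_const (A : set V) (g : V -> R^o) (p v : V) (k : R) :
  differentiable g p -> (\forall q \near p, A q -> g q = k) -> tangent A p v ->
  'D_v g p = 0.
Proof.
move=> gd gk [J [c [J0 cs cA c0 cv]]].
have cd := smooth_diff cs J0.
rewrite -c0 in gd gk; have E := @derive_comp R R^o V R^o c g 0 1 cd gd.
have cv' : 'D_1 c 0 = v by rewrite -derive1E.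
rewrite -c0 -cv' -E.
have N1 : \forall s \near (0 : R^o), A (c s).
  exact: near_at0 (smooth_open cs) J0 cA.
have N2 := differentiable_continuous cd gk.
rewrite (_ : 'D_1 (g \o c) 0 = 'D_1 (fun=> k : R^o) (0 : R^o)); first exact: derive_cst.
apply: near_eq_derive; have N3 : \forall s \near (0 : R^o), A (c s) /\ (A (c s) -> g (c s) = k).
  exact: filterI N1 N2.
by apply: filterS N3 => s [cAs /(_ cAs)].
Qed.

Lemma tangent_image (A : set V) (N : set V) (P : V -> V) (z w : V) :
  smooth N P -> (forall z, N z -> A (P z)) -> N z ->
  tangent A (P z) ('D_w P z).
Proof.
move=> Ps PA Nz; have oN := smooth_open Ps.
pose l (s : R^o) : V := s *: w + z.
have ls : smooth setT l.
  apply: smoothD; last by apply: smooth_cst; exact: openT.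
  apply: (@smooth_scale _ R^o); last by apply: smooth_cst; exact: openT.
  by apply: smooth_id; exact: openT.
pose J : set R := [set s | N (l s)].
have oJ : open J.
  apply: open_comp => // s _; exact: smooth_cont ls I.
have J0 : J 0 by rewrite /J/= /l scale0r add0r.
exists J, (fun s => P (l s)); split=> //.
- apply: (@smooth_comp_rowrow _ R^o n n J N l P) => //.
  exact: smooth_subset oJ _ ls.
- by move=> s; exact: PA.
- by rewrite /l scale0r add0r.
have Pd : differentiable P (0 *: w + z).
  by rewrite scale0r add0r; exact: smooth_diff Ps Nz.
rewrite derive1E; case: (is_derive_line Pd) => _ ->.
by rewrite scale0r add0r.
Qed.

Lemma tangent_orth (I : set R) (p v : V) : tangent (rw_space I) p v ->
  dot (spat p) (spat v) = 0.
Proof.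
move=> tv; have idd : differentiable (fun z : V => z) p by case: (is_diff_id p).
have rd := diff_spat idd.
have D0 : 'D_v (fun z : V => dot (spat z) (spat z)) p = 0.
  apply: (tangent_const (k := 1) (diff_dot rd rd) _ tv).
  by apply: (@filterE _ (nbhs p)) => q /rw_spaceE[].
move: D0; rewrite (derive_dot v rd rd) (derive_spat v idd).
have -> : 'D_v (fun z : V => z) p = v by exact: derive_id.
by rewrite (dotC (spat v)) => D0; lra.
Qed.

(** The retraction [(t, x) |-> (t, x / |x|)] onto the Robertson-Walker
    space. *)
Definition normz (z : V) : V :=
  tcoord z *: dt + (Num.sqrt (dot (spat z) (spat z)))^-1 *: spat z.

Definition off_axis : set V := [set z | 0 < dot (spat z) (spat z)].

Lemma smooth_normsq : smooth (setT : set V) (fun z : V => dot (spat z) (spat z)).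
Proof. by apply: smooth_dot; apply: smooth_spat; apply: smooth_id; exact: openT. Qed.

Lemma smooth_preimage_open (V0 W : normedModType R) (U : set V0) (h : V0 -> W) (O : set W) :
  smooth U h -> open O -> open (U `&` h @^-1` O).
Proof.
move=> hs oO; rewrite openE => z [Uz Oz]; rewrite /interior.
apply: filterI; first by apply: open_nbhs_nbhs; split=> //; exact: smooth_open hs.
by apply: (smooth_cont hs Uz); exact: open_nbhs_nbhs.
Qed.

Lemma open_off_axis : open off_axis.
Proof.
have := smooth_preimage_open smooth_normsq (@open_gt R 0).
by rewrite setTI.
Qed.

Lemma smooth_normz : smooth off_axis normz.
Proof.
have oo := open_off_axis.
have ids : smooth off_axis (fun z : V => z) by exact: smooth_id.
apply: smoothD.
  apply: smooth_scale; [exact: smooth_tcoord|exact: smooth_cst].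
apply: smooth_scale; last exact: smooth_spat.
apply: (smooth_comp_real (U' := [set x : R^o | x != 0]) (g := fun x : R^o => x^-1 : R^o)).
- by move=> z /= z0; rewrite gt_eqF// sqrtr_gt0.
- apply: (smooth_comp_real (U' := [set x : R^o | 0 < x])) => //; last exact: smooth_sqrt.
  exact: smooth_subset oo _ smooth_normsq.
- exact: smooth_inv.
Qed.

Lemma tcoord_normz z : tcoord (normz z) = tcoord z.
Proof. by rewrite /normz tcoordD !tcoordZ tcoord_dt tcoord_spat mulr1 mulr0 addr0. Qed.

Lemma spat_normz z :
  spat (normz z) = (Num.sqrt (dot (spat z) (spat z)))^-1 *: spat z.
Proof. by rewrite /normz spatD !spatZ spat_dt spatK scaler0 add0r. Qed.

Lemma normz_space (I : set R) z : off_axis z -> I (tcoord z) -> rw_space I (normz z).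
Proof.
move=> z0 Iz; apply/rw_spaceE; split; first by rewrite tcoord_normz.
rewrite spat_normz !dotE mulrA -invfM -expr2 sqr_sqrtr ?ltW//.
by rewrite mulVf// gt_eqF.
Qed.

Lemma normz_id (z : V) : dot (spat z) (spat z) = 1 -> normz z = z.
Proof. by move=> h; rewrite /normz h sqrtr1 invr1 scale1r -time_space_split. Qed.

Lemma unit_off_axis (z : V) : dot (spat z) (spat z) = 1 -> off_axis z.
Proof. by rewrite /off_axis/= => ->. Qed.

Lemma derive_normz (p v : V) : dot (spat p) (spat p) = 1 ->
  dot (spat p) (spat v) = 0 -> 'D_v normz p = v.
Proof.
move=> p1 pv; have oo := open_off_axis.
have pp := unit_off_axis p1.
pose l : R^o -> R^o := fun x => (Num.sqrt x)^-1.
have ls : smooth [set x : R^o | 0 < x] l.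
  apply: (smooth_comp_real (U' := [set x : R^o | x != 0]) (g := fun x : R^o => x^-1 : R^o)).
  - by move=> z /= z0; rewrite gt_eqF// sqrtr_gt0.
  - exact: smooth_sqrt.
  - exact: smooth_inv.
pose q (z : V) := dot (spat z) (spat z).
have idd : differentiable (fun z : V => z) p by case: (is_diff_id p).
have idD : 'D_v (fun z : V => z) p = v by exact: derive_id.
have rd := diff_spat idd.
have qd : differentiable q p by exact: diff_dot.
have q0 : 'D_v q p = 0.
  by rewrite (derive_dot v rd rd) derive_spat// idD dotC pv addr0.
have ld : differentiable l (q p) by exact: smooth_diff ls pp.
have lqd : differentiable (l \o q) p by exact: differentiable_comp.
have td := diff_tcoord idd.
have d1 : differentiable (fun z : V => tcoord z *: dt) p by exact: differentiableZl.
have d2 : differentiable (fun z : V => (l \o q) z *: spat z) p by exact: diff_scale.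
rewrite -[normz]/(fun z => tcoord z *: dt + (l \o q) z *: spat z).
rewrite (deriveD_fun v d1 d2) (derive_scale v td (differentiable_cst dt p)).
rewrite (derive_scale v lqd rd) derive_cst derive_tcoord// derive_spat// idD.
rewrite (derive_comp v qd ld) q0 derive0 scale0r add0r scaler0 addr0 /= /l /q p1.
by rewrite sqrtr1 invr1 scale1r -time_space_split.
Qed.

Lemma tangent_rw_space (I : set R) (p v : V) : open I -> rw_space I p ->
  dot (spat p) (spat v) = 0 -> tangent (rw_space I) p v.
Proof.
move=> oI /rw_spaceE[Ip p1] pv; have pp := unit_off_axis p1.
have ts : smooth (setT : set V) (fun z : V => tcoord z : R^o).
  by apply: smooth_tcoord; apply: smooth_id; exact: openT.
have oN : open (off_axis `&` [set z : V | I (tcoord z)]).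
  apply: openI; first exact: open_off_axis.
  by have := smooth_preimage_open ts oI; rewrite setTI.
have : tangent (rw_space I) (normz p) ('D_v normz p).
  apply: (@tangent_image _ (off_axis `&` [set z : V | I (tcoord z)])) => //.
    by apply: smooth_subset smooth_normz => // z [].
  by move=> z [z0 Iz]; exact: normz_space.
by rewrite derive_normz// normz_id.
Qed.

(** A hypersurface [F = 0] of the Robertson-Walker space is the image of the
    smooth retraction which moves [z] along [v] until [F] vanishes at the
    normalised point. *)
Lemma hypersurface_retraction (I : set R) (L U : set V) (F : V -> R^o) (p v : V) :
  open I -> L `<=` rw_space I -> L p -> U p -> smooth U F ->
  (forall q, U q -> rw_space I q -> (L q <-> F q = 0)) ->
  dot (spat p) (spat v) = 0 -> 'D_v F p != 0 ->
  exists N : set V, exists beta : V -> R^o, let P z := normz (z + beta z *: v) in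
    [/\ N p, smooth N beta, smooth N P, beta p = 0 &
    [/\ forall z, N z -> L (P z), forall z, N z -> L z -> P z = z &
        forall w, dot (spat p) (spat w) = 0 -> 'D_w F p = 0 -> 'D_w P p = w]].
Proof.
move=> oI LM Lp Up Fs LF pv DF.
have /rw_spaceE[Ip p1] := LM p Lp; have pp := unit_off_axis p1.
have ts : smooth (setT : set V) (fun z : V => tcoord z : R^o).
  by apply: smooth_tcoord; apply: smooth_id; exact: openT.
pose U' := (off_axis `&` normz @^-1` U) `&` [set z : V | I (tcoord z)].
have oU' : open U'.
  apply: openI; first exact: smooth_preimage_open smooth_normz (smooth_open Fs).
  by have := smooth_preimage_open ts oI; rewrite setTI.
have U'p : U' p by split=> //; split=> //; rewrite /= normz_id.
pose G (z : V) : R^o := F (normz z).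
have nzs : smooth U' normz by apply: smooth_subset oU' _ smooth_normz => z [[]].
have Gs : smooth U' G by apply: (smooth_comp_row _ nzs Fs) => z [[]].
have nzd : differentiable normz p by exact: smooth_diff nzs U'p.
have Fd : differentiable F (normz p) by rewrite normz_id//; exact: smooth_diff Fs Up.
have DG w : dot (spat p) (spat w) = 0 -> 'D_w G p = 'D_w F p.
  move=> pw; rewrite -[G]/(F \o normz) (derive_comp w nzd Fd).
  by rewrite derive_normz// normz_id.
have Gp0 : G p = 0 by rewrite /G normz_id//; apply/(LF p Up (LM p Lp)).
have DGv : 'D_v G p != 0 by rewrite DG.
have [N [beta [Np bs b1 b2]]] := implicit_function Gs U'p Gp0 DGv.
pose N' := N `&` U'.
have oN' : open N' by apply: openI => //; exact: smooth_open bs.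
have N'p : N' p by [].
have bs' : smooth N' beta by apply: smooth_subset oN' _ bs => z [].
have qs : smooth N' (fun z : V => z + beta z *: v).
  apply: smoothD; first exact: smooth_id.
  by apply: smooth_scale => //; exact: smooth_cst.
have bp0 : beta p = 0 by exact: b2.
exists N', beta => P; split=> //.
  by apply: (smooth_comp_rowrow _ qs nzs) => z [/b1[]].
split.
- move=> z [/b1[[[U1 U2] U3] Gz] _].
  apply/(LF _ U2); last exact: Gz.
  exact: normz_space.
- move=> z [Nz [[_ Uz] _]] Lz; have /rw_spaceE[_ z1] := LM z Lz.
  have zn := normz_id z1; rewrite /= zn in Uz.
  by rewrite /P b2// ?scale0r ?addr0// /G zn; apply/(LF z Uz (LM z Lz)).
move=> w pw Fw.
have idd : differentiable (fun z : V => z) p by case: (is_diff_id p).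
have bd := smooth_diff bs' N'p.
have vd := differentiable_cst v p.
have bvd := diff_scale bd vd.
have qd : differentiable (fun z : V => z + beta z *: v) p by exact: diffD_fun.
have qp : p + beta p *: v = p by rewrite bp0 scale0r addr0.
have qD : 'D_w (fun z : V => z + beta z *: v) p = w + 'D_w beta p *: v.
  rewrite (deriveD_fun w idd bvd) (derive_scale w bd vd) derive_cst scaler0 addr0.
  by congr (_ + _); exact: derive_id.
have Gd : differentiable G (p + beta p *: v) by rewrite qp; exact: smooth_diff Gs U'p.
have b'0 : 'D_w beta p = 0.
  have : 'D_w (G \o (fun z : V => z + beta z *: v)) p = 0.
    rewrite (_ : 'D_w _ p = 'D_w (fun=> 0 : R^o) p); first exact: derive_cst.
    apply: near_eq_derive; apply: filterS (open_nbhs_nbhs (conj oN' N'p)).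
    by move=> z [/b1[]].
  rewrite (derive_comp w qd Gd) qD qp.
  rewrite -[w in w + _]scale1r derive_lincomb; last by rewrite -[p]qp.
  rewrite scale1r DG// Fw add0r -[_ *: _]/(_ * _) => /eqP.
  by rewrite mulf_eq0 (negbTE DGv) orbF => /eqP.
have nzd' : differentiable normz (p + beta p *: v) by rewrite qp.
rewrite -[P]/(normz \o (fun z : V => z + beta z *: v)) (derive_comp w qd nzd') qD qp.
by rewrite b'0 scale0r addr0 derive_normz.
Qed.

End coordinates.

(** * The Levi-Civita connection *)

Section connection.
Context {R : realType} {n : nat} (f : R -> R).
Local Notation V := 'rV[R]_n.+1.
Local Notation dt := (@partial_t R n).
Implicit Types p X Y : V.
Local Notation df t := ('D_1 (f : R^o -> R^o) (t : R^o)).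

Lemma tcoord_delta (a : 'I_n.+1) : tcoord (delta_mx ord0 a : V) = (a == ord0)%:R.
Proof. by rewrite /tcoord mxE eqxx eq_sym. Qed.

Lemma derive_tcoord_id p v : 'D_v (fun q : V => tcoord q : R^o) p = tcoord v.
Proof.
have idd : differentiable (fun z : V => z) p by case: (is_diff_id p).
by rewrite derive_tcoord//; congr tcoord; exact: derive_id.
Qed.

Lemma diff_tcoord_id p : differentiable (fun q : V => tcoord q : R^o) p.
Proof. by apply: diff_tcoord; case: (is_diff_id p). Qed.

Lemma derive_time (g : R^o -> R^o) p v : differentiable g (tcoord p) ->
  differentiable (fun q : V => g (tcoord q) : R^o) p /\
  'D_v (fun q : V => g (tcoord q) : R^o) p = tcoord v * 'D_1 g (tcoord p).
Proof.
move=> gd; have td := diff_tcoord_id p.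
split; first exact: (differentiable_comp td gd).
have := derive_comp v td gd; rewrite derive_tcoord_id derive_real// => <-.
Qed.

Lemma derive_metric p (a b c : 'I_n.+1) :
  differentiable (f : R^o -> R^o) (tcoord p) ->
  'D_(delta_mx ord0 a) (fun q : V => metric f q b c : R^o) p =
  (if [&& b == c, b != ord0 & a == ord0] then 2 * f (tcoord p) * df (tcoord p) else 0).
Proof.
move=> fd; have [E|bc] := eqVneq b c; last first.
  rewrite (_ : (fun q => _) = fun=> 0 :> R^o) ?derive_cst//.
  by apply/funext => q; rewrite mxE bc.
rewrite -E /=; have [E0|b0] /= := eqVneq b ord0.
  rewrite (_ : (fun q => _) = fun=> -1 :> R^o) ?derive_cst//.
  by apply/funext => q; rewrite mxE E0 !eqxx.
rewrite (_ : (fun q => _) = fun q : V => f (tcoord q) * f (tcoord q) : R^o); last first.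
  by apply/funext => q; rewrite mxE eqxx (negbTE b0) expr2.
have [d1 d2] := derive_time (delta_mx ord0 a) fd.
rewrite (deriveM_fun _ d1 d1) d2 tcoord_delta.
by case: eqP => _ /=; rewrite ?mul1r ?mul0r; ring.
Qed.

Lemma invmx_metric p : f (tcoord p) != 0 -> invmx (metric f p) =
  \matrix_(i, j) (if i != j then 0 else if i == ord0 then -1 else f (tcoord p) ^- 2).
Proof.
move=> f0; set M := (X in _ = X).
have MM : metric f p *m M = 1%:M.
  apply/matrixP => i j; rewrite !mxE (bigD1 i)//= big1 ?addr0 => [|k ki]; last first.
    by rewrite !mxE eq_sym ki mul0r.
  rewrite !mxE eqxx /=; have [_|ij] /= := eqVneq i j; last by rewrite mulr0.
  by case: ifP => _ /=; rewrite ?mulrNN ?mulr1// mulfV// expf_neq0.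
have /mulmx1_unit[U _] := MM.
by rewrite -[RHS]mul1mx -(mulVmx U) -mulmxA MM mulmx1.
Qed.

Definition connection_term p X Y : V :=
  \row_k \sum_i \sum_j christoffel (metric f) p k i j * X ord0 i * Y ord0 j.

Lemma connection_termE p X Y : differentiable (f : R^o -> R^o) (tcoord p) ->
  f (tcoord p) != 0 ->
  tcoord (connection_term p X Y) =
    f (tcoord p) * df (tcoord p) * dot (spat X) (spat Y) /\
  spat (connection_term p X Y) =
    (df (tcoord p) / f (tcoord p)) *: (tcoord X *: spat Y + tcoord Y *: spat X).
Proof.
move=> fd f0; set F := f (tcoord p) in f0 *; set F' := df (tcoord p).
have re c i : spat c ord0 (lift ord0 i) = c ord0 (lift ord0 i).
  by rewrite -spatE !mxE/= mulr0 subr0.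
have r0 c : spat c ord0 ord0 = 0 by exact: tcoord_spat.
have sum_delta k : \sum_j Y ord0 j *+ (j == k) = Y ord0 k.
  rewrite (bigD1 k)//= eqxx big1 ?addr0 => [|j jk]; first by rewrite mulr1n.
  by rewrite (negbTE jk).
have chE k i j : christoffel (metric f) p k i j =
  if k == ord0 then (if (i == j) && (i != ord0) then F * F' else 0)
  else (F' / F) * ((i == ord0) && (j == k))%:R + (F' / F) * ((j == ord0) && (i == k))%:R.
  rewrite /christoffel (bigD1 k)//= big1 ?addr0 => [|l lk]; last first.
    by rewrite invmx_metric// mxE eq_sym lk mul0r.
  rewrite invmx_metric// mxE eqxx/= !derive_metric// -/F -/F'.
  have [->|k0] := eqVneq k ord0.
    by case: (i == ord0); case: (j == ord0); case: (i == j) => /=; field.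
  have kk i' : (i' == k) && (i' != ord0) = (i' == k).
    by case: eqVneq => //= ->.
  rewrite !andbA !kk andbF.
  by case: (i == ord0); case: (j == ord0); case: (i == k); case: (j == k) => /=; field.
split.
  rewrite /tcoord mxE /dot mulr_sumr; apply: eq_bigr => i _.
  rewrite (bigD1 i)//= big1 ?addr0 => [|j ji]; last first.
    by rewrite chE eqxx eq_sym (negbTE ji)/= !mul0r.
  rewrite chE !eqxx/=; case: (unliftP ord0 i) => [k ->|->]/=.
    by rewrite !re mulrA.
  by rewrite !r0 !mul0r mulr0.
apply/rowP => k; case: (unliftP ord0 k) => [l ->|->]; last first.
  by rewrite r0 !mxE !r0; ring.
rewrite re !mxE !re; set k0 := lift ord0 l.
rewrite (eq_bigr (fun i => F' / F * (i == ord0)%:R * X ord0 i * Y ord0 k0 +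
   F' / F * (i == k0)%:R * X ord0 i * Y ord0 ord0)) => [|i _]; last first.
  rewrite (eq_bigr (fun j => (F' / F * (i == ord0)%:R * X ord0 i) * (Y ord0 j *+ (j == k0)) +
     (F' / F * (i == k0)%:R * X ord0 i) * (Y ord0 j *+ (j == ord0)))) => [|j _]; last first.
    rewrite chE eq_sym (negbTE (neq_lift _ _)) -!mulnb !natrM -![Y ord0 j *+ _]mulr_natl.
    by ring.
  by rewrite big_split/= -!mulr_sumr !sum_delta.
rewrite big_split/= (bigD1 ord0)//= [in X in _ + X](bigD1 k0)//= !eqxx.
rewrite big1 ?addr0 => [|i i0]; last by rewrite (negbTE i0) mulr0 !mul0r.
rewrite big1 ?addr0 => [|i i0]; last by rewrite (negbTE i0) mulr0 !mul0r.
by rewrite /= !mulr1 mulrDr !mulrA [in X in _ + X]mulrAC.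
Qed.

Lemma tanproj_spat p w : dot (spat p) (spat p) = 1 -> f (tcoord p) != 0 ->
  tanproj f p w = w - dot (spat w) (spat p) *: spat p.
Proof.
move=> p1 f0; rewrite /tanproj spatE !rwgE !tcoord_spat !spatK p1.
by rewrite !mulr0 oppr0 !add0r mulr1 mulrAC mulfV ?mul1r// expf_neq0.
Qed.

(** The tangential projection removes exactly the radial part of the ambient
    derivative, which stays undetermined as [k]. *)
Lemma covariant_eq0 p X Y D : dot (spat p) (spat p) = 1 -> f (tcoord p) != 0 ->
  differentiable (f : R^o -> R^o) (tcoord p) ->
  covariant f p X Y D = 0 <->
  tcoord D + f (tcoord p) * df (tcoord p) * dot (spat X) (spat Y) = 0 /\
  exists k : R, spat D + (df (tcoord p) / f (tcoord p)) *:
    (tcoord X *: spat Y + tcoord Y *: spat X) = k *: spat p.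
Proof.
move=> p1 f0 fd; have [E1 E2] := connection_termE X Y fd f0.
rewrite /covariant -[\row_k _]/(connection_term p X Y) tanproj_spat//.
set w := D + _; rewrite -E1 -E2 -tcoordD -spatD -/w; split.
  move=> /subr0_eq E; split; first by rewrite E tcoordZ tcoord_spat mulr0.
  by exists (dot (spat w) (spat p)); rewrite {1}E spatZ spatK.
move=> [w0 [k wk]]; rewrite wk dotZl p1 mulr1; apply/subr0_eq.
by rewrite subr0 [w]time_space_split w0 scale0r add0r wk subrr.
Qed.

(** Between vectors without time component the Christoffel symbols contribute
    only the multiple [f' / f] of the time component of [xi]. *)
Lemma null_second_formE (xi : V -> V) p X Y :
  dot (spat p) (spat p) = 1 -> f (tcoord p) != 0 ->
  differentiable (f : R^o -> R^o) (tcoord p) ->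
  tcoord X = 0 -> tcoord Y = 0 -> dot (spat p) (spat Y) = 0 ->
  null_second_form f xi p X Y =
  - (f (tcoord p) ^+ 2 * (dot (spat ('D_X xi p)) (spat Y) +
      df (tcoord p) / f (tcoord p) * tcoord (xi p) * dot (spat X) (spat Y))).
Proof.
move=> p1 f0 fd X0 Y0 pY; have [E1 E2] := connection_termE X (xi p) fd f0.
rewrite /null_second_form /nabla /covariant -[\row_k _]/(connection_term p X (xi p)).
rewrite tanproj_spat// rwgE Y0 mulr0 oppr0 add0r; congr (- (_ * _)).
rewrite spatD spatN spatZ spatK spatD E2 X0 scale0r add0r scalerA.
by rewrite !(dotDl, dotNl) !dotZl pY mulr0 subr0.
Qed.

End connection.

(** * Null hypersurfaces *)

Section null_hypersurfaces.
Context {R : realType} {n : nat}.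
Variables (I : set R) (f : R -> R).
Hypotheses (I_open : open I) (f_smooth : smooth (V := R^o) (W := R^o) I f)
  (f_pos : forall t, I t -> 0 < f t).
Local Notation V := 'rV[R]_n.+1.
Local Notation dt := (@partial_t R n).
Local Notation df t := ('D_1 (f : R^o -> R^o) (t : R^o)).
Variables (L : set V) (xi : V -> V).
Hypotheses (L_null : null_hypersurface I f L) (xi_null : associated_null_field f L xi).
Implicit Types p v w : V.

(** The factor [f ^ 2] makes this vector of the sphere a unit vector on [L]. It
    is locked so that rewriting with the linearity of [dot] stops there. *)
Definition null_direction : V -> V :=
  locked_with spat_key (fun z : V => f (tcoord z) ^+ 2 *: spat (xi z)).
Local Notation u := null_direction.

Lemma null_directionE z : u z = f (tcoord z) ^+ 2 *: spat (xi z).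
Proof. by rewrite /null_direction unlock. Qed.

Let LM : L `<=` rw_space I. Proof. by case: L_null => -[]. Qed.

Let LI p : L p -> I (tcoord p). Proof. by move=> /LM /rw_spaceE[]. Qed.

Let L1 p : L p -> dot (spat p) (spat p) = 1. Proof. by move=> /LM /rw_spaceE[]. Qed.

Let f0 p : L p -> f (tcoord p) != 0. Proof. by move=> /LI /f_pos /lt0r_neq0. Qed.

Let fd p : L p -> differentiable (f : R^o -> R^o) (tcoord p).
Proof. by move=> /LI; exact: smooth_diff. Qed.

Lemma tcoord_null_field p : L p -> tcoord (xi p) = - (f (tcoord p))^-1.
Proof.
move=> Lp; have [_ /(_ p Lp)[_ _]] := xi_null.
rewrite rwgE /zeta spatZ spat_dt scaler0 dot0l mulr0 addr0 tcoordZ tcoord_dt mulr1.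
by move=> E; apply: (mulfI (f0 Lp)); rewrite mulrN mulfV ?f0// -E opprK.
Qed.

Lemma tcoord_null_direction z : tcoord (u z) = 0.
Proof. by rewrite null_directionE tcoordZ tcoord_spat mulr0. Qed.

Lemma spat_null_direction z : spat (u z) = u z.
Proof. by rewrite null_directionE spatZ spatK. Qed.

Lemma null_direction_unit p : L p -> dot (u p) (u p) = 1.
Proof.
move=> Lp; have [_ /(_ p Lp)[_ + _]] := xi_null.
rewrite rwgE tcoord_null_field// => E; have fp := f0 Lp.
rewrite null_directionE !dotZl !dotZr; apply: (mulfI (expf_neq0 2 fp)); rewrite mulr1.
have -> : f (tcoord p) ^+ 2 * dot (spat (xi p)) (spat (xi p)) = (f (tcoord p))^-1 ^+ 2.
  by apply/eqP; rewrite -subr_eq0 addrC -E; apply/eqP; ring.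
by field.
Qed.

Lemma null_direction_orth p : L p -> dot (u p) (spat p) = 0.
Proof.
move=> Lp; have [_ /(_ p Lp)[xt _ _]] := xi_null.
by rewrite null_directionE dotZl dotC (tangent_orth (tangent_subset LM xt)) mulr0.
Qed.

Lemma rwg_null_field p w : L p ->
  rwg f p (xi p) w = tcoord w / f (tcoord p) + dot (u p) (spat w).
Proof. by move=> Lp; rewrite rwgE tcoord_null_field// null_directionE dotZl; ring. Qed.

(** The vector [v] that is orthogonal to [T_p L] is itself null, hence
    proportional to [xi p]: both are orthogonal to [xi p]. *)
Let tangent_null p w : L p -> tangent L p w -> tcoord w = - f (tcoord p) * dot (u p) (spat w).
Proof.
move=> Lp tw; have [_ /(_ p Lp)[v [tv v0 vL]]] := L_null.
have [_ /(_ p Lp)[xt _ _]] := xi_null.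
have fp := f0 Lp; have u1 := null_direction_unit Lp.
have vv := vL v tv; have vx := vL _ xt; have vw := vL w tw.
have g_sym a b : rwg f p a b = rwg f p b a by rewrite !rwgE dotC (mulrC (tcoord a)).
rewrite g_sym rwg_null_field// in vx.
have uv : dot (u p) (spat v) = - (tcoord v / f (tcoord p)).
  by apply/eqP; rewrite -addr_eq0 addrC vx.
have vs : dot (spat v) (spat v) = (tcoord v / f (tcoord p)) ^+ 2.
  rewrite rwgE in vv; apply: (mulfI (expf_neq0 2 fp)).
  have -> : f (tcoord p) ^+ 2 * (tcoord v / f (tcoord p)) ^+ 2 = tcoord v * tcoord v by field.
  by apply/eqP; rewrite -subr_eq0 addrC vv.
have sv : spat v = - (tcoord v / f (tcoord p)) *: u p.
  apply/eqP; rewrite -subr_eq0; apply/eqP/dot_eq0.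
  rewrite !(dotDl, dotDr, dotNl, dotNr, dotZl, dotZr) u1 vs (dotC (spat v)) uv.
  by ring.
have tv0 : tcoord v != 0.
  apply/eqP => E; move/eqP: v0; apply; apply: time_space_eq; first by rewrite E /tcoord mxE.
  by rewrite sv E mul0r oppr0 scale0r spat0.
rewrite rwgE sv dotZl in vw; apply: (mulfI tv0).
have : f (tcoord p) ^+ 2 * (- (tcoord v / f (tcoord p)) * dot (u p) (spat w)) =
  tcoord v * (- f (tcoord p) * dot (u p) (spat w)) by field.
by move=> <-; apply/eqP; rewrite -subr_eq0 -oppr_eq0 opprB addrC vw.
Qed.

(** Both sides are hyperplanes of the tangent space of the Robertson-Walker
    space: the left one contains the kernel of the differential of a local
    equation of [L], and the right one does not contain [dt]. *)
Lemma tangent_nullE p w : L p -> tangent L p w <->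
  dot (spat p) (spat w) = 0 /\ tcoord w = - f (tcoord p) * dot (u p) (spat w).
Proof.
move=> Lp; split=> [tw|[pw wt]].
  by split; [exact: tangent_orth (tangent_subset LM tw)|exact: tangent_null].
have [[_ _ _ /(_ p Lp)[U [F [Up Fs LF /(_ p Up Lp)[v tv DF]]]]] _] := L_null.
have pv := tangent_orth tv.
have [N [beta [Np bs Ps bp [PL PLid PD]]]] :=
  hypersurface_retraction I_open LM Lp Up Fs LF pv DF.
have Pp := PLid p Np Lp.
have ker w' : dot (spat p) (spat w') = 0 -> 'D_w' F p = 0 -> tangent L p w'.
  move=> pw' Fw'; rewrite -(PD w' pw' Fw') -[X in tangent L X]Pp.
  exact: tangent_image Ps PL Np.
have Fdp := smooth_diff Fs Up.
pose th w' := tcoord w' + f (tcoord p) * dot (u p) (spat w').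
have thP w' : dot (spat p) (spat w') = 0 ->
    th w' = ('D_w' F p / 'D_v F p) * th v.
  move=> pw'; pose c := 'D_w' F p / 'D_v F p.
  have : th (1 *: w' + (- c) *: v) = 0.
    rewrite /th (@tangent_null p)//; first by ring.
    apply: ker.
      by rewrite scale1r spatD spatZ dotDr dotZr pw' pv mulr0 addr0.
    by rewrite derive_lincomb// scale1r -[_ *: 'D_v F p]/(_ * _) mulNr divfK// subrr.
  rewrite /th scale1r tcoordD tcoordZ spatD spatZ dotDr dotZr => E.
  by apply/eqP; rewrite -subr_eq0 -E -/c; apply/eqP; rewrite /th; ring.
have thv : th v != 0.
  apply/eqP => E; have : th dt = 0.
    by rewrite thP ?E ?mulr0// spat_dt dot0r.
  by rewrite /th tcoord_dt spat_dt dot0r mulr0 addr0 => /eqP; rewrite oner_eq0.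
apply: ker => //; have := thP w pw; rewrite {1}/th wt mulNr addNr => /esym/eqP.
by rewrite mulf_eq0 (negbTE thv) orbF mulf_eq0 invr_eq0 (negbTE DF) orbF => /eqP.
Qed.

(** The reason why [L] is locally a graph over the sphere: [dt] is not
    tangent to [L]. *)
Lemma null_transverse_time p : L p -> exists U : set V, exists F : V -> R^o,
  [/\ U p, smooth U F, forall q, U q -> rw_space I q -> (L q <-> F q = 0) &
      'D_dt F p != 0].
Proof.
move=> Lp.
have [[_ _ _ /(_ p Lp)[U [F [Up Fs LF /(_ p Up Lp)[v tv DF]]]]] _] := L_null.
exists U, F; split=> //; apply/eqP => Fdt.
have [N [beta [Np bs Ps bp [PL PLid PD]]]] :=
  hypersurface_retraction I_open LM Lp Up Fs LF (tangent_orth tv) DF.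
have pdt : dot (spat p) (spat dt) = 0 by rewrite spat_dt dot0r.
have := tangent_image dt Ps PL Np; rewrite PLid// PD// => /(tangent_nullE _ Lp)[_].
by rewrite tcoord_dt spat_dt dot0r mulr0 => /eqP; rewrite oner_eq0.
Qed.

(** Functions on [L] are differentiated twice after composition with such a
    retraction: this makes their first derivatives along [L] smooth functions
    near [p] without changing them at [p]. *)
Lemma null_retraction p : L p -> exists N : set V, exists P : V -> V,
  [/\ N p, smooth N P, forall z, N z -> L (P z), forall z, N z -> L z -> P z = z &
      forall w, tangent L p w -> 'D_w P p = w].
Proof.
move=> Lp.
have [[_ _ _ /(_ p Lp)[U [F [Up Fs LF /(_ p Up Lp)[v tv DF]]]]] _] := L_null.
have pv := tangent_orth tv.
have [N [beta [Np bs Ps bp [PL PLid PD]]]] :=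
  hypersurface_retraction I_open LM Lp Up Fs LF pv DF.
exists N, (fun z => normz (z + beta z *: v)); split=> // w tw; apply: PD.
  exact: tangent_orth (tangent_subset LM tw).
apply: (tangent_const (k := 0) (smooth_diff Fs Up) _ tw).
apply: filterS (open_nbhs_nbhs (conj (smooth_open Fs) Up)) => q Uq Lq.
by apply/(LF q Uq (LM Lq)).
Qed.

Lemma smooth_time (g : R^o -> R^o) : smooth I g ->
  smooth [set z : V | I (tcoord z)] (fun z : V => g (tcoord z) : R^o).
Proof.
move=> gs; have ts : smooth (setT : set V) (fun z : V => tcoord z : R^o).
  by apply: smooth_tcoord; apply: smooth_id; exact: openT.
have oI : open [set z : V | I (tcoord z)].
  by have := smooth_preimage_open ts I_open; rewrite setTI.
apply: (smooth_comp_real (U' := I)) gs => //.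
exact: smooth_subset oI _ ts.
Qed.

Lemma smooth_null_direction : exists2 U : set V, L `<=` U & smooth U u.
Proof.
have [[U LU xs] _] := xi_null; have fs := smooth_time f_smooth.
pose U' := U `&` [set z : V | I (tcoord z)].
have oU' : open U' by apply: openI; [exact: smooth_open xs|exact: smooth_open fs].
exists U'; first by move=> p Lp; split; [exact: LU|exact: LI].
have xs' : smooth U' xi by apply: smooth_subset oU' _ xs => z [].
have fs' : smooth U' (fun z : V => f (tcoord z) : R^o).
  by apply: smooth_subset oU' _ fs => z [].
rewrite (_ : u = fun z => (f (tcoord z) * f (tcoord z)) *: spat (xi z)).
  by apply: smooth_scale; [exact: smoothM|exact: smooth_spat].
by apply/funext => z; rewrite null_directionE expr2.
Qed.

Lemma diff_null_direction p : L p -> differentiable u p.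
Proof. by have [U LU us] := smooth_null_direction => /LU; exact: smooth_diff us. Qed.

(** The form [dot (u p) (spat _)] on [L] is closed, as it is minus the
    differential of the conformal time; this is the symmetry of the second
    derivatives of the time coordinate. *)
Lemma null_direction_sym p v w : L p -> tangent L p v -> tangent L p w ->
  dot ('D_w u p) (spat v) = dot ('D_v u p) (spat w).
Proof.
move=> Lp tv tw; have [N [P [Np Ps PL PLid PD]]] := null_retraction Lp.
have Pp := PLid p Np Lp.
have [U LU us] := smooth_null_direction.
pose T (z : V) : R^o := tcoord (P z); pose X (z : V) := spat (P z).
pose u' (z : V) := u (P z).
have Ts : smooth N T by exact: smooth_tcoord.
have Xs : smooth N X by exact: smooth_spat.
have u's : smooth N u' by apply: (smooth_comp_rowrow _ Ps us) => z /PL /LU.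
have Pd z : N z -> differentiable P z by exact: smooth_diff.
have Tp : T p = tcoord p by rewrite /T Pp.
have u'p : u' p = u p by rewrite /u' Pp.
have DT a z : N z -> 'D_a T z = - f (T z) * dot (u' z) ('D_a X z).
  move=> Nz; have := tangent_image a Ps PL Nz.
  move=> /(tangent_nullE _ (PL z Nz))[_].
  by rewrite (derive_tcoord a (Pd z Nz)) (derive_spat a (Pd z Nz)).
have DX a : tangent L p a -> 'D_a X p = spat a.
  by move=> ta; rewrite (derive_spat a (Pd p Np)) PD.
have Du' a : tangent L p a -> 'D_a u' p = 'D_a u p.
  move=> ta; have ud : differentiable u (P p) by rewrite Pp; exact: diff_null_direction.
  by have := derive_comp a (Pd p Np) ud; rewrite (PD a ta) Pp.
have Td := smooth_diff Ts Np.
have u'd := smooth_diff u's Np.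
have fTd : differentiable (f : R^o -> R^o) (T p) by rewrite Tp; exact: fd.
have Fd : differentiable (fun z => f (T z) : R^o) p.
  exact: (differentiable_comp Td fTd).
have DF a : 'D_a (fun z => f (T z) : R^o) p = 'D_a T p * df (T p).
  exact: (etrans (derive_comp a Td fTd) (derive_real _ fTd)).
have oN := smooth_open Ps.
have H a b : tangent L p a -> tangent L p b ->
    'D_b (fun z => 'D_a T z) p = - f (tcoord p) *
      (dot ('D_b u p) (spat a) + dot (u p) ('D_b (fun z => 'D_a X z) p)) +
      dot (u p) (spat a) * - (- f (tcoord p) * dot (u p) (spat b) * df (tcoord p)).
  move=> ta tb; have Xd := smooth_diff (smoothDer a Xs) Np.
  have dd := diff_dot u'd Xd.
  have -> : 'D_b (fun z => 'D_a T z) p =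
      'D_b (fun z => - f (T z) * dot (u' z) ('D_a X z) : R^o) p.
    apply: near_eq_derive; apply: filterS (open_nbhs_nbhs (conj oN Np)).
    by move=> z /DT.
  rewrite (deriveM_fun b (diffN_fun Fd) dd) (deriveN_fun b Fd) DF (derive_dot b u'd Xd).
  by rewrite (DT b p Np) Tp u'p (DX a ta) (DX b tb) (Du' b tb).
have := @derive_sym R V N T p v w Ts Np; rewrite (H v w tv tw) (H w v tw tv).
rewrite (@derive_sym_row R V n N X p v w Xs Np) => E.
apply: (mulfI (f0 Lp)); apply: oppr_inj.
set A := dot ('D_w u p) _ in E *; set B := dot ('D_v u p) _ in E *.
by rewrite -!mulNr; move: E; rewrite !mulrDr => E; lra.
Qed.

Variables (rho : V -> R^o).
Hypotheses (rho_smooth : smooth_along L rho)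
  (umbilic : forall p X Y, L p -> screen f L p X -> screen f L p Y ->
      null_second_form f xi p X Y = rho p * rwg f p X Y).

(** The principal curvature of the sections of [L] at constant time, as
    hypersurfaces of the unit sphere with normal [u]. *)
Definition null_curvature (z : V) : R^o :=
  'D_1 (f : R^o -> R^o) (tcoord z) - rho z * (f (tcoord z) * f (tcoord z)).
Local Notation kap := null_curvature.

Lemma diff_null_curvature p : L p -> differentiable kap p.
Proof.
move=> Lp; have [U LU rs] := rho_smooth.
have [d1 _] := derive_time 0 (smooth_diff (smoothDer (1 : R^o) f_smooth) (LI Lp)).
have [d2 _] := derive_time 0 (fd Lp).
apply: diffD_fun => //; apply: diffN_fun; apply: diffM_fun; last exact: diffM_fun.
exact: smooth_diff rs (LU _ Lp).
Qed.

Lemma screen_spat p (X : V) : L p -> tcoord X = 0 -> dot (spat p) X = 0 -> dot (u p) X = 0 ->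
  screen f L p X.
Proof.
move=> Lp X0 pX uX; have sX : spat X = X by rewrite [RHS]time_space_split X0 scale0r add0r.
split; first by apply/tangent_nullE => //; rewrite sX pX uX X0 mulr0.
by rewrite rwgE X0 mulr0 oppr0 /zeta spatZ spat_dt scaler0 dot0l mulr0 addr0.
Qed.

Lemma umbilic_derive_screen p X Y : L p -> screen f L p X -> screen f L p Y ->
  tcoord X = 0 -> tcoord Y = 0 -> dot ('D_X u p) (spat Y) = kap p * dot (spat X) (spat Y).
Proof.
move=> Lp sX sY X0 Y0; have fp := f0 Lp.
have := umbilic Lp sX sY; have [/(tangent_nullE _ Lp)[pY _] _] := sY.
rewrite (null_second_formE xi (L1 Lp) fp (fd Lp) X0 Y0 pY) rwgE X0 mul0r oppr0 add0r.
rewrite tcoord_null_field// => E.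
have [[U LU xs] _] := xi_null; have xd := smooth_diff xs (LU p Lp).
have [d2 D2] := derive_time X (fd Lp).
have -> : 'D_X u p = f (tcoord p) ^+ 2 *: spat ('D_X xi p).
  rewrite (_ : u = fun z => (f (tcoord z) * f (tcoord z)) *: spat (xi z)); last first.
    by apply/funext => z; rewrite null_directionE expr2.
  rewrite (derive_scale X (diffM_fun d2 d2) (diff_spat xd)) (deriveM_fun X d2 d2) D2 X0.
  by rewrite !mul0r !mulr0 addr0 scale0r add0r derive_spat// expr2.
rewrite dotZl /kap; set A := dot (spat ('D_X xi p)) _ in E *.
set B := dot _ _ in E *; move: E.
have -> : df (tcoord p) / f (tcoord p) * - (f (tcoord p))^-1 * B =
  - (df (tcoord p) * B / f (tcoord p) ^+ 2) by field.
rewrite mulrBr => E; have E2 : f (tcoord p) ^+ 2 * (df (tcoord p) * B / f (tcoord p) ^+ 2) = df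
  (tcoord p) * B by field.
rewrite E2 in E; rewrite mulrBl -expr2; lra.
Qed.

(** The structure equation of an umbilic null hypersurface. The components
    along [u p] and [spat p] come from differentiating [dot u u = 1] and
    [dot u (spat p) = 0]; the screen components come from umbilicity if [w] is
    in the screen, and [null_direction_sym] reduces the general case to it. *)
Lemma umbilic_derive p w : L p -> tangent L p w ->
  'D_w u p = kap p *: (spat w - dot (u p) (spat w) *: u p)
             - dot (u p) (spat w) *: spat p.
Proof.
move=> Lp tw; have ud := diff_null_direction Lp.
have idd : differentiable (fun z : V => z) p by case: (is_diff_id p).
have idD : 'D_w (fun z : V => z) p = w by exact: derive_id.
have sd := diff_spat idd.
have u1 := null_direction_unit Lp; have up := null_direction_orth Lp; have p1 := L1 Lp.
have [pw wt] := (tangent_nullE _ Lp).1 tw.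
have du v : tangent L p v -> dot ('D_v u p) (u p) = 0.
  move=> tv; have : 'D_v (fun z => dot (u z) (u z)) p = 0.
    apply: (tangent_const (k := 1) (diff_dot ud ud) _ tv).
    by apply: (@filterE _ (nbhs p)) => q; exact: null_direction_unit.
  by rewrite (derive_dot v ud ud) (dotC (u p)) => E; lra.
have dp v : tangent L p v -> dot ('D_v u p) (spat p) = - dot (u p) (spat v).
  move=> tv; have : 'D_v (fun z : V => dot (u z) (spat z)) p = 0.
    apply: (tangent_const (k := 0) (diff_dot ud sd) _ tv).
    by apply: (@filterE _ (nbhs p)) => q; exact: null_direction_orth.
  rewrite (derive_dot v ud sd) (derive_spat v idd).
  have -> : 'D_v (fun z : V => z) p = v by exact: derive_id.
  by move=> E; apply/eqP; rewrite -addr_eq0 E.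
set eta := dot (u p) (spat w); set E := (X in _ = X).
have tE : tcoord ('D_w u p) = 0.
  rewrite -(derive_tcoord w ud) (_ : (fun z => _) = fun=> 0 :> R^o) ?derive_cst//.
  by apply/funext => z; exact: tcoord_null_direction.
have scr (Y : V) : tcoord Y = 0 -> dot (spat p) Y = 0 -> dot (u p) Y = 0 ->
    dot ('D_w u p) Y = kap p * dot (spat w) Y.
  move=> Y0 pY uY; have sY : spat Y = Y by rewrite [RHS]time_space_split Y0 scale0r add0r.
  have scY := screen_spat Lp Y0 pY uY; have [tY _] := scY.
  pose w' : V := spat w - eta *: u p.
  have w'0 : tcoord w' = 0.
    by rewrite tcoordD tcoordN tcoordZ tcoord_spat tcoord_null_direction mulr0 subr0.
  have pw' : dot (spat p) w' = 0.
    by rewrite dotDr dotNr dotZr pw (dotC (spat p)) up mulr0 subr0.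
  have uw' : dot (u p) w' = 0.
    by rewrite dotDr dotNr dotZr u1 mulr1 subrr.
  have sw' : spat w' = w' by rewrite [RHS]time_space_split w'0 scale0r add0r.
  rewrite -{1}sY (null_direction_sym Lp tY tw).
  have -> : spat w = spat w' + eta *: u p by rewrite sw' subrK.
  rewrite dotDr dotZr du// mulr0 addr0.
  rewrite (umbilic_derive_screen Lp scY (screen_spat Lp w'0 pw' uw') Y0 w'0).
  by rewrite dotDl dotZl uY mulr0 addr0 sY dotC.
pose D := 'D_w u p - E.
have D0 : tcoord D = 0.
  rewrite tcoordD tE /E !(tcoordD, tcoordN, tcoordZ) !tcoord_spat tcoord_null_direction.
  by ring.
have Dp : dot (spat p) D = 0.
  rewrite dotC dotDl dotNl dp// /E !(dotDl, dotNl) !dotZl !(dotDl, dotNl) !dotZl.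
  by rewrite (dotC (spat w)) pw up p1 -/eta; ring.
have Du : dot (u p) D = 0.
  rewrite dotC dotDl dotNl du// /E !(dotDl, dotNl) !dotZl !(dotDl, dotNl) !dotZl.
  by rewrite (dotC (spat w)) (dotC (spat p)) up u1 -/eta; ring.
apply/subr0_eq/dot_eq0; rewrite -/D {1}/D dotDl dotNl scr//.
rewrite /E !(dotDl, dotNl) !dotZl !(dotDl, dotNl) !dotZl Dp Du.
by ring.
Qed.

End null_hypersurfaces.

(** * Umbilic null hypersurfaces lie in cones *)

Section umbilic_null_hypersurfaces.
Context {R : realType} {n : nat}.
Variables (I : set R) (f : R -> R).
Hypotheses (I_open : open I) (f_smooth : smooth (V := R^o) (W := R^o) I f)
  (f_pos : forall t, I t -> 0 < f t) (n_gt3 : (3 < n)%N).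
Local Notation V := 'rV[R]_n.+1.
Local Notation dt := (@partial_t R n).
Local Notation df t := ('D_1 (f : R^o -> R^o) (t : R^o)).
Variables (L : set V) (xi : V -> V) (rho : V -> R^o).
Hypotheses (L_null : null_hypersurface I f L) (xi_null : associated_null_field f L xi).
Hypotheses (rho_smooth : smooth_along L rho)
  (umbilic : forall p X Y, L p -> screen f L p X -> screen f L p Y ->
      null_second_form f xi p X Y = rho p * rwg f p X Y).
Implicit Types p v w : V.
Local Notation u := (null_direction f xi).
Local Notation kap := (null_curvature f rho).

Let LM : L `<=` rw_space I. Proof. by case: L_null => -[]. Qed.
Let LI p : L p -> I (tcoord p). Proof. by move=> /LM /rw_spaceE[]. Qed.
Let L1 p : L p -> dot (spat p) (spat p) = 1. Proof. by move=> /LM /rw_spaceE[]. Qed.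
Let f0 p : L p -> f (tcoord p) != 0. Proof. by move=> /LI /f_pos /lt0r_neq0. Qed.
Let tnE := tangent_nullE I_open f_pos L_null xi_null.
Let Du := umbilic_derive I_open f_smooth f_pos L_null xi_null umbilic.
Let ud := diff_null_direction I_open f_smooth L_null xi_null.
Let kd := diff_null_curvature f_smooth L_null rho_smooth.
Let u1 := null_direction_unit f_pos L_null xi_null.
Let uo p : L p -> dot (u p) (spat p) = 0.
Proof. exact: (null_direction_orth L_null xi_null). Qed.

(** The integrability condition of the structure equation: its component along
    a screen vector [e] orthogonal to [v] is differentiated in the directions
    [v] and [e], and the two results agree. Orthogonality removes the other
    terms with derivatives of [kap]. *)
Lemma null_curvature_derive p v : L p -> tangent L p v ->
  'D_v kap p = - (1 + kap p * kap p) * dot (u p) (spat v).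
Proof.
move=> Lp tv; have [N [P [Np Ps PL PLid PD]]] := null_retraction I_open L_null Lp.
have Pp := PLid p Np Lp.
have [U LU us] := smooth_null_direction I_open f_smooth L_null xi_null.
have [|e e1 eo] := @exists_unit_normal R n [:: dt; spat p; u p; spat v]; first by [].
have e0 : tcoord e = 0 by rewrite -dot_dt dotC; apply: eo; rewrite !inE eqxx.
have pe : dot (spat p) e = 0 by rewrite dotC; apply: eo; rewrite !inE eqxx orbT.
have ue : dot (u p) e = 0 by rewrite dotC; apply: eo; rewrite !inE eqxx !orbT.
have ve : dot (spat v) e = 0 by rewrite dotC; apply: eo; rewrite !inE eqxx !orbT.
have se : spat e = e by rewrite [RHS]time_space_split e0 scale0r add0r.
have te : tangent L p e by apply/tnE => //; rewrite se pe ue e0 mulr0.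
pose X (z : V) := spat (P z); pose u' (z : V) := u (P z).
pose K (z : V) : R^o := kap (P z).
have oN := smooth_open Ps.
have Xs : smooth N X by exact: smooth_spat.
have u's : smooth N u' by apply: (smooth_comp_rowrow _ Ps us) => z /PL /LU.
have Pd z : N z -> differentiable P z by exact: smooth_diff.
have Xd := smooth_diff Xs Np.
have u'd := smooth_diff u's Np.
have Xp : X p = spat p by rewrite /X Pp.
have u'p : u' p = u p by rewrite /u' Pp.
have kd' : differentiable kap (P p) by rewrite Pp; exact: kd.
have Kd : differentiable K p by exact: (differentiable_comp (Pd p Np) kd').
have DK a : tangent L p a -> 'D_a K p = 'D_a kap p.
  by move=> ta; have := derive_comp a (Pd p Np) kd'; rewrite (PD a ta) Pp.
have DX a : tangent L p a -> 'D_a X p = spat a.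
  by move=> ta; rewrite (derive_spat a (Pd p Np)) (PD a ta).
have DU a z : N z -> 'D_a u' z =
    K z *: ('D_a X z - dot (u' z) ('D_a X z) *: u' z) - dot (u' z) ('D_a X z) *: X z.
  move=> Nz; have LPz := PL z Nz; have ta := tangent_image a Ps PL Nz.
  have := derive_comp a (Pd z Nz) (ud LPz); rewrite (Du LPz ta).
  by rewrite (derive_spat a (Pd z Nz)).
pose h (z : V) := dot (u' z) e.
have hs : smooth N h by apply: smooth_dot => //; exact: smooth_cst.
have ed (z : V) : differentiable (fun _ : V => e) z by exact: differentiable_cst.
pose H a (z : V) := dot (u' z) ('D_a X z).
pose A a (z : V) := dot ('D_a X z) e.
pose C (z : V) := dot (X z) e.
have Dh a z : N z -> 'D_a h z = K z * (A a z - H a z * h z) - H a z * C z.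
  move=> Nz; rewrite (derive_dot a (smooth_diff u's Nz) (ed z)) derive_cst dot0r addr0.
  by rewrite (DU a z Nz) !(dotDl, dotNl) !dotZl !(dotDl, dotNl) !dotZl.
have Cd : differentiable C p by exact: diff_dot Xd (ed p).
have hd : differentiable h p by exact: diff_dot u'd (ed p).
have h0 : h p = 0 by rewrite /h u'p.
have C0 : C p = 0 by rewrite /C Xp.
have Dhe b : tangent L p b -> 'D_b h p = dot ('D_b u p) e.
  move=> tb; rewrite (derive_dot b u'd (ed p)) derive_cst dot0r addr0.
  have ud' : differentiable u (P p) by rewrite Pp; exact: ud.
  by have := derive_comp b (Pd p Np) ud'; rewrite (PD b tb) Pp => <-.
have DC b : tangent L p b -> 'D_b C p = dot (spat b) e.
  by move=> tb; rewrite (derive_dot b Xd (ed p)) derive_cst dot0r addr0 (DX b tb).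
have DDh a b : tangent L p a -> tangent L p b -> 'D_b (fun z => 'D_a h z) p =
    'D_b kap p * dot (spat a) e +
    kap p * (dot ('D_b (fun z => 'D_a X z) p) e - dot (u p) (spat a) * dot ('D_b u p) e)
    - dot (u p) (spat a) * dot (spat b) e.
  move=> ta tb; have DXd := smooth_diff (smoothDer a Xs) Np.
  have Hd : differentiable (H a) p by exact: diff_dot.
  have Ad : differentiable (A a) p by exact: diff_dot DXd (ed p).
  have -> : 'D_b (fun z => 'D_a h z) p =
      'D_b (fun z => K z * (A a z + - (H a z * h z)) + - (H a z * C z) : R^o) p.
    apply: near_eq_derive; apply: filterS (open_nbhs_nbhs (conj oN Np)).
    by move=> z; exact: Dh.
  have d1 := diffM_fun Hd hd; have d2 := diffM_fun Hd Cd.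
  have d3 := diffD_fun Ad (diffN_fun d1).
  rewrite (deriveD_fun b (diffM_fun Kd d3) (diffN_fun d2)) (deriveN_fun b d2).
  rewrite (deriveM_fun b Kd d3) (deriveM_fun b Hd Cd).
  rewrite (deriveD_fun b Ad (diffN_fun d1)) (deriveN_fun b d1) (deriveM_fun b Hd hd).
  rewrite h0 C0 (DK b tb) (Dhe b tb) (DC b tb) (derive_dot b DXd (ed p)) derive_cst dot0r addr0.
  rewrite /H /A u'p (DX a ta) /K Pp; ring.
have De : dot ('D_e u p) e = kap p.
  rewrite (Du Lp te) se !(dotDl, dotNl) !dotZl !(dotDl, dotNl) !dotZl ue e1 pe; ring.
have := @derive_sym R V N h p v e hs Np; rewrite (DDh v e tv te) (DDh e v te tv).
rewrite (@derive_sym_row R V n N X p v e Xs Np) De se ve e1 ue.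
set B := dot ('D_v _ p) e; set dk := 'D_v kap p; set eta := dot (u p) (spat v).
set k := kap p => E; lra.
Qed.

(** Locally, composing [g] with a retraction onto [L] gives a function with
    zero differential on a ball; then [L] is connected. *)
Lemma constant_along (g : V -> R^o) : (forall p, L p -> differentiable g p) ->
  (forall p w, L p -> tangent L p w -> 'D_w g p = 0) ->
  forall p q, L p -> L q -> g p = g q.
Proof.
move=> gd Dg p q Lp Lq.
have loc z : L z -> \forall y \near z, L y -> g y = g z.
  move=> Lz; have [N [P [Nz Ps PL PLid _]]] := null_retraction I_open L_null Lz.
  have oN := smooth_open Ps.
  have [r r0 rN] : exists2 r : R, 0 < r & forall y, `|y - z| < r -> N y.
    by apply: near_distP; exact: open_nbhs_nbhs.
  apply: filterS (near_dist z r0) => y yz Ly.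
  have Pd x : N x -> differentiable P x by exact: smooth_diff.
  have gP x : N x -> differentiable (g \o P) x /\ forall v, 'D_v (g \o P) x = 0.
    move=> Nx; have gd' := gd _ (PL x Nx); split; first exact: (differentiable_comp (Pd x Nx)).
    move=> v; rewrite (derive_comp v (Pd x Nx) gd'); apply: Dg; first exact: PL.
    exact: tangent_image Ps PL Nx.
  have inN (c : R) : 0 <= c <= 1 -> N (c *: (y - z) + z).
    move=> /andP[c0 c1]; apply: rN; rewrite addrK normrZ ger0_norm//.
    by rewrite (le_lt_trans _ yz)// ler_piMl.
  have [c /andP[c0 c1]] := @MVT_line R V (g \o P) (y - z) z 0 1 ltr01
    (fun c h => (gP _ (inN c h)).1).
  rewrite (gP _ (inN c _)).2 ?ltW// mul0r scale1r scale0r add0r subrK /= => /subr0_eq.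
  rewrite (PLid y)// ?(PLid z)//.
  by have := inN 1; rewrite scale1r subrK ler01 lexx; exact.
have [[_ Lc _ _] _] := L_null.
pose B := L `&` [set z | g z = g p].
pose O1 := [set z | L z -> g z = g p]; pose O2 := [set z | L z -> g z != g p].
have BL : B = L.
  apply: Lc; first by exists p.
    exists (interior O1); first exact: open_interior.
    apply/seteqP; split=> z [Lz]; last by move=> /interior_subset zO; split=> //; exact: zO.
    move=> /= gz; split=> //; apply: filterS (loc z Lz) => y yz Ly.
    by rewrite yz.
  exists (~` (interior O2)); first by apply: open_closedC; exact: open_interior.
  apply/seteqP; split=> z [Lz] /=.
    by move=> gz; split=> // /interior_subset /(_ Lz) /eqP.
  move=> zO; split=> //=; apply: contrapT => gz; apply: zO.
  by apply: filterS (loc z Lz) => y yz Ly; rewrite yz//; apply/eqP.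
have [_ /= gq] : B q by rewrite BL.
exact: esym.
Qed.

(** The arc cotangent of [kap]: a sphere of radius [th] in the unit sphere has
    principal curvature [cot th]. *)
Definition cone_angle (z : V) : R^o := pi / 2 - atan (kap z).
Local Notation th := cone_angle.

(** The end of the great circle arc of length [th] from [spat z] in the
    direction [- u z]. *)
Definition cone_centre (z : V) : V := cos (th z) *: spat z - sin (th z) *: u z.
Local Notation ctr := cone_centre.

Lemma cone_angle_gt0 z : 0 < th z.
Proof. by rewrite /cone_angle subr_gt0 atan_ltpi2. Qed.

Lemma cone_angle_ltpi z : th z < pi.
Proof. by rewrite /cone_angle ltrBlDr -ltrBlDl; have := atan_gtNpi2 (kap z); lra. Qed.

Lemma cot_cone_angle z : cos (th z) = kap z * sin (th z).
Proof.
rewrite /cone_angle cosB sinB cos_pihalf sin_pihalf !mul0r !mul1r add0r subr0.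
have c0 : cos (atan (kap z)) != 0 by rewrite gt_eqF// cos_gt0_pihalf// atan_gtNpi2 atan_ltpi2.
by rewrite -{2}[kap z]atanK /tan divfK.
Qed.

Lemma derive_cone_angle p w : L p -> tangent L p w ->
  differentiable th p /\ 'D_w th p = dot (u p) (spat w).
Proof.
move=> Lp tw; have kdp := kd Lp.
have ad : differentiable (atan : R^o -> R^o) (kap p) by exact/derivable1_diffP.
have akd : differentiable (fun z => atan (kap z) : R^o) p by exact: (differentiable_comp kdp ad).
have cd : differentiable (fun=> pi / 2 : R^o) p by exact: differentiable_cst.
split; first exact: (diffD_fun cd (diffN_fun akd)).
rewrite (deriveD_fun w cd (diffN_fun akd)) derive_cst add0r (deriveN_fun w akd).
rewrite [X in - X](_ : _ = 'D_w kap p * 'D_1 (atan : R^o -> R^o) (kap p)); last first.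
  exact: (etrans (derive_comp w kdp ad) (derive_real _ ad)).
have [_ ->] := is_derive1_atan (kap p).
rewrite (null_curvature_derive Lp tw) expr2.
by field; rewrite -expr2 gt_eqF// ltr_pwDl// sqr_ge0.
Qed.

Lemma derive_cone_centre p w : L p -> tangent L p w ->
  differentiable ctr p /\ 'D_w ctr p = 0.
Proof.
move=> Lp tw; have [thd thD] := derive_cone_angle Lp tw.
have idd : differentiable (fun z : V => z) p by case: (is_diff_id p).
have idD : 'D_w (fun z : V => z) p = w by exact: derive_id.
have sd := diff_spat idd.
have cd : differentiable (cos : R^o -> R^o) (th p) by exact/derivable1_diffP.
have snd : differentiable (sin : R^o -> R^o) (th p) by exact/derivable1_diffP.
have cthd : differentiable (fun z => cos (th z) : R^o) p by exact: (differentiable_comp thd cd).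
have sthd : differentiable (fun z => sin (th z) : R^o) p by exact: (differentiable_comp thd snd).
have cD : 'D_w (fun z => cos (th z) : R^o) p = 'D_w th p * - sin (th p).
  have [_ <-] := is_derive_cos (th p).
  exact: (etrans (derive_comp w thd cd) (derive_real _ cd)).
have sD : 'D_w (fun z => sin (th z) : R^o) p = 'D_w th p * cos (th p).
  have [_ <-] := is_derive_sin (th p).
  exact: (etrans (derive_comp w thd snd) (derive_real _ snd)).
have d1 := diff_scale cthd sd; have d2 := diff_scale sthd (ud Lp).
split; first exact: (diffD_fun d1 (diffN_fun d2)).
rewrite (deriveD_fun w d1 (diffN_fun d2)) (deriveN_fun w d2).
rewrite (derive_scale w cthd sd) (derive_scale w sthd (ud Lp)) cD sD thD.
rewrite (derive_spat w idd) idD (Du Lp tw) cot_cone_angle.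
set eta := dot _ _; set k := kap p; set s := sin _.
apply/rowP => i; rewrite !mxE; ring.
Qed.

(** The centre of the sections and the sum of conformal time and radius are
    constant; they are the position and the conformal time of the vertex. *)
Lemma umbilic_cone (S : R -> R) :
  (forall t, I t -> is_derive t (1 : R) S (f t)^-1) ->
  exists q0 : V, exists s0 : R, [/\ tcoord q0 = 0, dot q0 q0 = 1 &
    forall p, L p -> [/\ S (tcoord p) = s0 - th p,
      cos (th p) = kap p * sin (th p) &
      exists e : V, [/\ tcoord e = 0, dot e e = 1, dot q0 e = 0 &
        spat p = cos (th p) *: q0 + sin (th p) *: e]]].
Proof.
move=> dS; have [[[p0 Lp0] _ _ _] _] := L_null.
have ctrE p : L p -> ctr p = ctr p0.
  move=> Lp; apply/rowP => i; apply: (@constant_along (fun z => ctr z ord0 i)) => // q.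
    move=> Lq; have t0 : tangent L q 0.
      by apply/tnE => //; rewrite spat0 !dot0r mulr0 /tcoord mxE.
    exact: (differentiable_entry ord0 i (derive_cone_centre Lq t0).1).
  move=> w Lq tw; have [d D] := derive_cone_centre Lq tw.
  by rewrite derive_entry// D mxE.
pose g (z : V) : R^o := S (tcoord z) + th z.
have gE p : L p -> g p = g p0.
  have Sd q : L q -> differentiable (S : R^o -> R^o) (tcoord q).
    by move=> /LI /dS [? _]; exact/derivable1_diffP.
  move=> Lp; apply: constant_along => // q.
    move=> Lq; have t0 : tangent L q 0.
      by apply/tnE => //; rewrite spat0 !dot0r mulr0 /tcoord mxE.
    have [d _] := derive_time 0 (Sd q Lq).
    exact: (diffD_fun d (derive_cone_angle Lq t0).1).
  move=> w Lq tw; have [d D] := derive_time w (Sd q Lq).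
  have [d' D'] := derive_cone_angle Lq tw.
  rewrite (deriveD_fun w d d') D D'; have [_ ->] := dS _ (LI Lq).
  have [_ ->] := (tnE w Lq).1 tw.
  by rewrite mulrAC mulNr divff ?f0// mulN1r addNr.
have sup p : L p -> spat (u p) = u p by move=> _; exact: spat_null_direction.
have up0 p : tcoord (u p) = 0 by exact: tcoord_null_direction.
exists (ctr p0), (g p0); split.
- by rewrite tcoordD tcoordN !tcoordZ tcoord_spat up0 !mulr0 subr0.
- rewrite /cone_centre !(dotDl, dotDr, dotNl, dotNr) !dotZl !dotZr u1// L1//.
  by rewrite (dotC (spat p0)) uo// -[RHS](cos2Dsin2 (th p0)) !expr2; ring.
move=> p Lp; split; first by rewrite -(gE p Lp) /g addrK.
  exact: cot_cone_angle.
exists (sin (th p) *: spat p + cos (th p) *: u p); rewrite -(ctrE p Lp); split.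
- by rewrite tcoordD !tcoordZ tcoord_spat up0 !mulr0 addr0.
- rewrite !(dotDl, dotDr) !dotZl !dotZr u1// L1//.
  by rewrite (dotC (spat p)) uo// -[RHS](cos2Dsin2 (th p)) !expr2; ring.
- rewrite /cone_centre !(dotDl, dotDr, dotNl, dotNr) !dotZl !dotZr u1// L1//.
  by rewrite (dotC (spat p)) uo//; ring.
- have H := cos2Dsin2 (th p); apply/rowP => i; rewrite !mxE.
  rewrite -[LHS]mul1r -H !expr2; ring.
Qed.

End umbilic_null_hypersurfaces.

(** * Primitives and integrals over open intervals *)

Section primitives.
Context {R : realType}.
Notation mu := (@lebesgue_measure R).

Lemma interval_sub (I : set R) (a b : R) : is_interval I -> I a -> I b ->
  `[a, b] `<=` I.
Proof. by move=> Ii Ia Ib t /=; rewrite in_itv/=; exact: Ii. Qed.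

Lemma open_interval_widen (I : set R) (t : R) : open I -> I t ->
  exists a, exists b, [/\ I a, I b, a < t & t < b].
Proof.
move=> oI It; have /nbhs_ballP [e /= e0 eI] : nbhs t I by exact: open_nbhs_nbhs.
have e2 : 0 < e / 2 by rewrite divr_gt0.
exists (t - e / 2), (t + e / 2); split; [| |lra|lra].
  by apply: eI; rewrite /ball/= opprB addrCA subrr addr0 gtr0_norm//; lra.
by apply: eI; rewrite /ball/= opprD addrA subrr sub0r normrN gtr0_norm//; lra.
Qed.

Lemma continuous_in_within (I : set R) (g : R -> R) (a b : R) : `[a, b] `<=` I ->
  (forall t, I t -> {for t, continuous g}) -> {within `[a, b], continuous g}.
Proof.
move=> abI gc; apply: continuous_in_subspaceT => x; rewrite inE => /abI.
exact: gc.
Qed.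

Lemma integrable_itv (I : set R) (g : R -> R) (a b : R) : `[a, b] `<=` I ->
  (forall t, I t -> {for t, continuous g}) -> mu.-integrable `[a, b] (EFin \o g).
Proof.
move=> abI gc; apply: continuous_compact_integrable; first exact: segment_compact.
exact: continuous_in_within gc.
Qed.

Lemma exists_primitive (I : set R) (g : R -> R) : open I -> is_interval I ->
  (forall t, I t -> {for t, continuous g}) ->
  exists G : R -> R, forall t, I t -> is_derive t (1 : R) G (g t).
Proof.
move=> oI iI gc; have [[t0 It0]|I0] := pselect (I !=set0); last first.
  by exists (fun=> 0) => t It; exfalso; apply: I0; exists t.
(* The base point [Num.min t t0] avoids integrals with reversed bounds. *)
pose F a x : R := (\int[mu]_(t in [set` `[a, x]]) g t)%R.
pose G t := F (Num.min t t0) t - F (Num.min t t0) t0.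
exists G => t It.
have shift a b x : I a -> I x -> a <= b -> b <= x ->
  F a x - F a b = (\int[mu]_(t in [set` `]b, x]]) g t)%R.
  move=> Ia Ix ab bx; rewrite /F Rintegral_itvB ?bnd_simp//.
  exact: integrable_itv (interval_sub iI Ia Ix) gc.
have GE a : I a -> a <= t0 -> forall s, a <= s -> I s -> G s = F a s - F a t0.
  move=> Ia at0 s as_ Is; rewrite /G; have [st|ts] := leP s t0.
    rewrite -[LHS]opprB -[RHS]opprB; congr (- _).
    by rewrite (shift s s t0)// (shift a s t0).
  by rewrite (shift t0 t0 s) ?(shift a t0 s)// ltW.
have [a [b [Ia Ib at_ tb]]] := open_interval_widen oI It.
pose a' := Num.min a t0.
have a't0 : a' <= t0 by rewrite ge_min lexx orbT.
have a't : a' < t by rewrite gt_min at_.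
have Ia' : I a' by rewrite /a'; case: (leP a t0).
have nG : \near t, F a' t - F a' t0 = G t.
  have : \forall s \near t, a' < s /\ s < b.
    by apply: filterI; [exact: lt_nbhsr|exact: lt_nbhsl].
  apply: filterS => s [a's sb]; rewrite -(GE a' Ia' a't0 s) ?ltW//.
  by apply: (iI _ _ Ia' Ib); rewrite !ltW.
apply: near_eq_is_derive nG _.
have ig : mu.-integrable `[a', b] (EFin \o g).
  exact: integrable_itv (interval_sub iI Ia' Ib) gc.
have [Fd FD] := continuous_FTC1_closed tb ig a't (gc t It).
have dF : is_derive t (1 : R) (F a') (g t) by split; rewrite -?derive1E.
rewrite -[g t]subr0; apply: is_deriveB.
Qed.

(** The integral over [I] is the limit of the integrals over the intervals
    [K m], by monotone convergence, and each of them lies in a compact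
    subinterval of [I]. *)
Lemma integral_gt_subitv (I : set R) (g S : R -> R) (k : R) : open I -> is_interval I ->
  (forall t, I t -> {for t, continuous g}) -> (forall t, I t -> 0 <= g t) ->
  (forall t, I t -> is_derive t (1 : R) S (g t)) -> 0 <= k ->
  (k%:E < \int[mu]_(t in I) (g t)%:E)%E ->
  exists a, exists b, [/\ I a, I b, a < b & k < S b - S a].
Proof.
move=> oI iI gc g0 dS k0 kint; apply: contrapT => noab.
have Sab a b : I a -> I b -> a <= b -> S b - S a <= k.
  move=> Ia Ib; rewrite le_eqVlt => /predU1P[->|ab]; first by rewrite subrr.
  by rewrite leNgt; apply/negP => kS; apply: noab; exists a, b.
pose e m : R := (m.+1%:R)^-1.
have e0 m : 0 < e m by rewrite invr_gt0 ltr0n.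
pose K (m : nat) : set (measurableTypeR R) :=
  [set t : R | [/\ - m%:R <= t, t <= m%:R, I (t - e m) & I (t + e m)]].
have em m m' : (m <= m')%N -> e m' <= e m.
  by move=> mm; rewrite lef_pV2 ?posrE ?ltr0n// ler_nat ltnS.
have KI m t : K m t -> I t.
  by move=> [_ _ I1 I2]; apply: (iI _ _ I1 I2); have := e0 m; lra.
have Kmono : nondecreasing_seq K.
  move=> m m' mm; apply/subsetPset => t Kt; have It := KI m t Kt; have [h1 h2 I1 I2] := Kt.
  have := em m m' mm; have := e0 m'; have : m%:R <= m'%:R :> R by rewrite ler_nat.
  by move=> h3 h4 h5; split; [lra|lra|apply: (iI _ _ I1 It)|apply: (iI _ _ It I2)]; lra.
have Ki m : is_interval (K m : set R).
  move=> x y [x1 x2 x3 x4] [y1 y2 y3 y4] z /andP[xz zy]; split; [lra|lra| |].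
    by apply: (iI _ _ x3 y3); lra.
  by apply: (iI _ _ x4 y4); lra.
have Km m : measurable (K m) by exact: is_interval_measurable.
have KU : \bigcup_m K m = I.
  apply/seteqP; split=> [t [m _]|t It]; first exact: KI.
  have [a [b [Ia Ib at_ tb]]] := open_interval_widen oI It.
  pose d := Num.min (t - a) (b - t).
  have d0 : 0 < d by rewrite lt_min !subr_gt0 at_.
  have d1 : d <= t - a by rewrite ge_min lexx.
  have d2 : d <= b - t by rewrite ge_min lexx orbT.
  have b1 := archi_boundP (ltW (_ : 0 < d^-1)); rewrite invr_gt0 in b1.
  have b2 := archi_boundP (normr_ge0 t).
  pose m := (Num.bound d^-1 + Num.bound `|t|)%N.
  have tm : `|t| <= m%:R.
    by apply: (le_trans (ltW b2)); rewrite ler_nat leq_addl.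
  have emd : e m < d.
    rewrite -[d]invrK ltf_pV2 ?posrE ?invr_gt0 ?ltr0n//; apply: (lt_le_trans (b1 d0)).
    by rewrite ler_nat; apply: leqW; exact: leq_addr.
  move: tm; rewrite ler_norml => /andP[h1 h2]; have em0 := e0 m.
  exists m => //; split=> //; first by apply: (iI _ _ Ia It); lra.
  by apply: (iI _ _ It Ib); lra.
have mg m : measurable_fun (K m) (EFin \o g).
  apply/measurable_EFinP; apply: (@measurable_funS _ _ _ _ I) => //.
  - exact: is_interval_measurable.
  - by move=> t; exact: KI.
  - by apply: open_continuous_measurable_fun => // t; rewrite inE; exact: gc.
have Kk m : (\int[mu]_(t in K m) (g t)%:E <= k%:E)%E.
  have [[t Kt]|K0] := pselect (K m !=set0); last first.
    have -> : K m = set0 by apply/eqP; apply: contrapT => /negP/set0P.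
    by rewrite integral_set0 lee_fin.
  have hi : has_inf (K m) by split; [exists t|exists (- m%:R) => y []].
  have hs : has_sup (K m) by split; [exists t|exists (m%:R) => y []].
  have [x Kx xi] := inf_adherent (e0 m) hi.
  have [y Ky yi] := sup_adherent (e0 m) hs.
  have em0 := e0 m.
  pose a := x - e m; pose b := y + e m.
  have Ia : I a by case: Kx.
  have Ib : I b by case: Ky.
  have Kab : K m `<=` `[a, b].
    move=> z Kz; rewrite /= in_itv/= /a /b.
    have h1 : inf (K m) <= z by apply: ge_inf => //; exact: hi.2.
    have h2 : z <= sup (K m) by apply: sup_ubound => //; exact: hs.2.
    by apply/andP; split; lra.
  have ab : a < b by move: (Kab x Kx); rewrite /= in_itv/= /a /b; lra.
  have abI := interval_sub iI Ia Ib.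
  apply: (@le_trans _ _ (\int[mu]_(t in `[a, b]) (g t)%:E)%E).
    apply: ge0_subset_integral => //=.
    - by have /integrableP[] := integrable_itv abI gc.
    - by move=> z /abI /g0; rewrite lee_fin.
  have Sc z : I z -> {for z, continuous S}.
    by move=> /dS [? _]; apply: differentiable_continuous; exact/derivable1_diffP.
  rewrite (@continuous_FTC2 _ g S a b ab (continuous_in_within abI gc)).
  - by rewrite -EFinB lee_fin; exact: Sab (ltW ab).
  - split.
    + move=> z; rewrite in_itv/= => /andP[az zb].
      by have [] := dS z (iI _ _ Ia Ib z _); rewrite ?ltW.
    + exact: cvg_at_right_filter (Sc a Ia).
    + exact: cvg_at_left_filter (Sc b Ib).
  - move=> z; rewrite in_itv/= => /andP[az zb]; rewrite derive1E.
    by have [] := dS z (iI _ _ Ia Ib z _); rewrite ?ltW.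
have gK m t : K m t -> (0 <= (EFin \o g) t)%E by move=> /KI /g0; rewrite lee_fin.
have C := @ge0_nondecreasing_set_cvg_integral _ _ R K (EFin \o g) mu Kmono Km mg gK.
rewrite KU in C.
move: kint; rewrite ltNge => /negP; apply.
rewrite -(cvg_lim _ C)//; apply: lime_le; first by apply/cvg_ex; eexists; exact: C.
by apply: nearW => m; exact: Kk.
Qed.
End primitives.

(** * Functions of one variable *)

Section one_variable.
Context {R : realType}.
Implicit Types (a b : R -> R) (x : R).

Lemma is_derive_mul a b x (a' b' : R) : is_derive x (1 : R) a a' -> is_derive x (1 : R) b b' ->
  is_derive x (1 : R) (fun z => a z * b z) (a x * b' + b x * a').
Proof. by move=> da db; exact: (is_deriveM (f := a) (g := b)). Qed.

Lemma is_derive_add a b x (a' b' : R) : is_derive x (1 : R) a a' -> is_derive x (1 : R) b b' ->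
  is_derive x (1 : R) (fun z => a z + b z) (a' + b').
Proof. by move=> da db; exact: (is_deriveD (f := a) (g := b)). Qed.

Lemma is_derive_opp a x (a' : R) : is_derive x (1 : R) a a' ->
  is_derive x (1 : R) (fun z => - a z) (- a').
Proof. by move=> da; exact: (is_deriveN (f := a)). Qed.

Lemma is_derive_chain a b x (a' b' : R) : is_derive (b x) (1 : R) a a' ->
  is_derive x (1 : R) b b' -> is_derive x (1 : R) (fun z => a (b z)) (a' * b').
Proof. by move=> da db; exact: (is_derive1_comp (f := a) (g := b)). Qed.

Lemma is_derive_inv a x (a' : R) : a x != 0 -> is_derive x (1 : R) a a' ->
  is_derive x (1 : R) (fun z => (a z)^-1) (- ((a x) ^- 2 * a')).
Proof. by move=> a0 da; apply: is_derive_eq (is_deriveV a0 da) _; rewrite scaleNr. Qed.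

Lemma is_derive_continuous a x (a' : R) : is_derive x (1 : R) a a' -> {for x, continuous a}.
Proof. by move=> [? _]; apply: differentiable_continuous; exact/derivable1_diffP. Qed.

Lemma is_derive_diff (W : normedModType R) (a : R^o -> W) x (a' : W) :
  is_derive (x : R^o) (1 : R^o) a a' -> differentiable a x.
Proof. by move=> [? _]; exact/derivable1_diffP. Qed.

Lemma diff_is_derive (W : normedModType R) (a : R^o -> W) x :
  differentiable a x -> is_derive (x : R^o) (1 : R^o) a ('D_1 a x).
Proof. by move=> ad; split=> //; exact: diff_derivable. Qed.

Lemma derive0_const (g : R -> R) (a b : R) : a <= b ->
  (forall s, a <= s <= b -> is_derive s (1 : R) g 0) -> g b = g a.
Proof.
move=> ab dg; have gc : {within `[a, b], continuous g}.
  apply: derivable_within_continuous => s; rewrite in_itv/= => /dg.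
  by case.
have dg' s : s \in `]a, b[ -> is_derive s (1 : R) g 0.
  by rewrite in_itv/= => /andP[h1 h2]; apply: dg; rewrite !ltW.
have [c _ /eqP] := MVT_segment ab dg' gc.
by rewrite mul0r subr_eq0 => /eqP.
Qed.

Lemma derive_gt0_lt (I : set R) (G g : R -> R) (a b : R) : is_interval I ->
  (forall t, I t -> is_derive t (1 : R) G (g t)) -> (forall t, I t -> 0 < g t) ->
  I a -> I b -> a < b -> G a < G b.
Proof.
move=> iI dG g0 Ia Ib ab; have abI := interval_sub iI Ia Ib.
have Gc : {within `[a, b], continuous G}.
  by apply: continuous_in_within abI _ => t /dG; exact: is_derive_continuous.
have dG' s : s \in `]a, b[ -> is_derive s (1 : R) G (g s).
  by rewrite in_itv/= => /andP[h1 h2]; apply/dG/abI; rewrite /= in_itv/= !ltW.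
have [c] := MVT ab dG' Gc; rewrite in_itv/= => /andP[h1 h2] E.
rewrite -subr_gt0 E mulr_gt0 ?subr_gt0//; apply/g0/abI.
by rewrite /= in_itv/= !ltW.
Qed.

Lemma primitive_IVT (I : set R) (G g : R -> R) (a b y : R) : is_interval I ->
  (forall t, I t -> is_derive t (1 : R) G (g t)) ->
  I a -> I b -> a <= b -> G a <= y <= G b -> exists2 c, I c & G c = y.
Proof.
move=> iI dG Ia Ib ab /andP[ay yb]; have abI := interval_sub iI Ia Ib.
have Gc : {within `[a, b], continuous G}.
  by apply: continuous_in_within abI _ => t /dG; exact: is_derive_continuous.
have [|c cab Gcy] := @IVT R G a b y ab Gc.
  by rewrite ge_min ay/= le_max yb orbT.
by exists c => //; apply: abI.
Qed.

(** The inverse [H] of the increasing function [G] solves [H' = 1 / g (H)], so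
    it is smooth by bootstrapping. *)
Lemma primitive_inverse (I : set R) (G g : R -> R) : open I -> is_interval I ->
  smooth (V := R^o) (W := R^o) I g -> (forall t, I t -> 0 < g t) ->
  (forall t, I t -> is_derive t (1 : R) G (g t)) ->
  exists H : R -> R, let J := [set G t | t in I] in
    [/\ smooth (V := R^o) (W := R^o) J H, forall t, I t -> H (G t) = t &
        forall y, J y -> is_derive y (1 : R) H (g (H y))^-1].
Proof.
move=> oI iI gs g0 dG; pose J := [set G t | t in I].
have Glt (a b : R) : I a -> I b -> a < b -> G a < G b by exact: derive_gt0_lt iI dG g0.
have HP y : exists t, J y -> I t /\ G t = y.
  by have [[t It <-]|nJ] := pselect (J y); [exists t|exists 0].
have [H HJ] := choice HP.
have HG t : I t -> H (G t) = t.
  move=> It; have [|IH E] := HJ (G t); first by exists t.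
  have [h|h|//] := ltgtP (H (G t)) t.
    by have := Glt _ _ IH It h; rewrite E ltxx.
  by have := Glt _ _ It IH h; rewrite E ltxx.
have oJ : open J.
  rewrite openE => _ [t It <-]; have [a [b [Ia Ib at_ tb]]] := open_interval_widen oI It.
  have N : \forall y \near G t, G a < y /\ y < G b.
    by apply: filterI; [exact/lt_nbhsr/Glt|exact/lt_nbhsl/Glt].
  apply: filterS N => y [ay yb].
  have [|c Ic cy] := primitive_IVT (y := y) iI dG Ia Ib (ltW (lt_trans at_ tb)).
    by rewrite !ltW.
  by exists c.
have dH y : J y -> is_derive y (1 : R) H (g (H y))^-1.
  move=> [t It <-]; rewrite HG//.
  have N : \forall s \near t, I s by exact: open_nbhs_nbhs.
  apply: (@is_derive_inverse R G H (g t)).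
  - by apply: filterS N => s; exact: HG.
  - by apply: filterS N => s /dG; exact: is_derive_continuous.
  - exact: dG.
  - by rewrite gt_eqF// g0.
exists H; split=> //.
apply: (@smooth_real_bootstrap R J H (fun y => (g (H y))^-1)) => // k HC.
have JI y : J y -> I (H y) by move=> [t It <-]; rewrite HG.
have C1 := Ck_comp_real oJ JI HC (gs.2 k).
have [_ /(_ k) iC] := @smooth_inv R.
apply: (Ck_comp_real oJ _ C1 iC) => y /JI Iy /=.
by rewrite gt_eqF// g0.
Qed.

End one_variable.

(** * Null geodesics *)

Section null_geodesics.
Context {R : realType} {n : nat}.
Variables (I : set R) (f : R -> R).
Hypotheses (I_open : open I) (I_itv : is_interval I)
  (f_smooth : smooth (V := R^o) (W := R^o) I f) (f_pos : forall t, I t -> 0 < f t).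
Local Notation V := 'rV[R]_n.+1.
Local Notation dt := (@partial_t R n).
Local Notation df t := ('D_1 (f : R^o -> R^o) (t : R^o)).
Variables (S Phi : R -> R).
Hypotheses (dS : forall t, I t -> is_derive t (1 : R) S (f t)^-1)
  (dPhi : forall t, I t -> is_derive t (1 : R) Phi (f t)).

Let f0 t : I t -> f t != 0. Proof. by move=> /f_pos /lt0r_neq0. Qed.

Lemma is_derive_warping t : I t -> is_derive t (1 : R) f (df t).
Proof. by move=> It; apply: diff_is_derive; exact: smooth_diff f_smooth It. Qed.

Lemma smooth_conformal_time : smooth (V := R^o) (W := R^o) I S.
Proof.
apply: (smooth_primitive dS).
apply: (smooth_comp_real (U' := [set x : R^o | x != 0]) _ f_smooth smooth_inv).
by move=> t It; exact: f0.
Qed.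

Lemma derive_frame (a b d : R -> R) (q e : V) (t a' b' d' : R) :
  is_derive t (1 : R) a a' -> is_derive t (1 : R) b b' -> is_derive t (1 : R) d d' ->
  let F (s : R^o) : V := (a s *: dt + b s *: q) + d s *: e in
  differentiable F t /\ 'D_1 F t = (a' *: dt + b' *: q) + d' *: e.
Proof.
move=> da db dd F.
have H (c : R^o -> R^o) c' (w : V) : is_derive (t : R^o) (1 : R^o) c c' ->
    differentiable (fun s : R^o => c s *: w) t /\ 'D_1 (fun s : R^o => c s *: w) t = c' *: w.
  move=> dc; have cd := is_derive_diff dc.
  split; first exact: differentiableZl.
  rewrite (@derive_scale R R^o n c (fun=>
    w) t 1 cd (differentiable_cst w (t : R^o))) derive_cst scaler0 addr0.
  by case: dc => _ ->.
have [H1 H2] := H _ _ dt da; have [H3 H4] := H _ _ q db; have [H5 H6] := H _ _ e dd.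
split; first exact: diffD_fun (diffD_fun H1 H3) H5.
by rewrite (deriveD_fun (1 : R^o) (diffD_fun H1 H3) H5) (deriveD_fun (1 : R^o) H1 H3) H2 H4 H6.
Qed.

(** The null geodesic from [(s0, q)] with spatial direction [e] projects to a
    great circle parametrised by the conformal time, and a primitive [Phi] of
    [f] is affine in its affine parameter, as [f t'] is constant. *)
Lemma null_geodesic_exists (s0 s1 : R) (q e : V) : I s0 -> I s1 -> s0 != s1 ->
  tcoord q = 0 -> tcoord e = 0 -> dot q q = 1 -> dot e e = 1 -> dot q e = 0 ->
  let p := s0 *: dt + q in
  let z := s1 *: dt + (cos (S s1 - S s0) *: q + sin (S s1 - S s0) *: e) in
  exists v, [/\ null_vector I f p v, tcoord v = (Phi s1 - Phi s0) / f s0 & exp_eq I f p v z].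
Proof.
move=> I0 I1 s01 q0 e0 q1 e1 qe p z.
have [H [Hs HK dH]] := primitive_inverse I_open I_itv f_smooth f_pos dPhi.
pose J1 := [set Phi t | t in I].
pose c := Phi s1 - Phi s0.
pose l (x : R) : R := Phi s0 + x * c.
have ls : smooth (setT : set R^o) (l : R^o -> R^o).
  apply: smoothD; first by apply: smooth_cst; exact: openT.
  by apply: smoothM; [apply: smooth_id; exact: openT|apply: smooth_cst; exact: openT].
pose J : set R := [set x | J1 (l x)].
have oJ : open J.
  by have := smooth_preimage_open ls (smooth_open Hs); rewrite setTI.
pose T (x : R) : R := H (l x).
have dl x : is_derive x (1 : R) l c.
  have H1 := is_derive_mul (is_derive_id x (1 : R)) (is_derive_cst c x (1 : R)).
  have H2 := is_derive_add (is_derive_cst (Phi s0) x (1 : R)) H1.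
  by apply: (is_derive_eq H2); rewrite /= mulr0 mulr1 !add0r.
have TI x : J x -> I (T x) by move=> [t It E]; rewrite /T -E HK.
have dT x : J x -> is_derive x (1 : R) T (c / f (T x)).
  move=> Jx; apply: (is_derive_eq (is_derive_chain (dH _ Jx) (dl x))).
  by rewrite mulrC.
have Ts : smooth (V := R^o) (W := R^o) J T.
  apply: (smooth_comp_real (U' := J1) (h := l) (g := H)) => //.
  by apply: smooth_subset oJ _ ls.
pose sg s := S s - S s0.
have dsg s : I s -> is_derive s (1 : R) sg (f s)^-1.
  move=> Is; apply: (is_derive_eq (is_derive_add (dS Is) (is_derive_opp (is_derive_cst (S s0) s (1 :
    R))))).
  by rewrite oppr0 addr0.
have dcos s : I s -> is_derive s (1 : R) (fun s => cos (sg s)) (- sin (sg s) * (f s)^-1).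
  by move=> Is; apply: is_derive_chain (dsg s Is).
have dsin s : I s -> is_derive s (1 : R) (fun s => sin (sg s)) (cos (sg s) * (f s)^-1).
  by move=> Is; apply: is_derive_chain (dsg s Is).
pose F (s : R^o) : V := (s *: dt + cos (sg s) *: q) + sin (sg s) *: e.
have dF s : I s -> differentiable F s /\
    'D_1 F s = (1 *: dt + (- sin (sg s) * (f s)^-1) *: q) + (cos (sg s) * (f s)^-1) *: e.
  move=> Is; exact: (derive_frame q e (is_derive_id s (1 : R)) (dcos s Is) (dsin s Is)).
have Fs : smooth I F.
  have sgs : smooth I (sg : R^o -> R^o).
    by apply: smoothD; [exact: smooth_conformal_time|exact: smooth_cst].
  have cs : smooth I (fun s : R^o => cos (sg s) : R^o).
    by apply: (smooth_comp_real _ sgs smooth_cos).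
  have ss : smooth I (fun s : R^o => sin (sg s) : R^o).
    by apply: (smooth_comp_real _ sgs smooth_sin).
  have ids : smooth I (fun s : R^o => s) by exact: smooth_id.
  apply: smoothD; first apply: smoothD.
  - by apply: (smooth_scale ids); exact: smooth_cst.
  - by apply: (smooth_scale cs); exact: smooth_cst.
  - by apply: (smooth_scale ss); exact: smooth_cst.
pose c0 (x : R) : V := F (T x).
have c0s : smooth (V := R^o) J c0.
  by apply: (smooth_comp_realrow (U' := I) TI Ts Fs).
pose F1 (s : R^o) : V := ((c * (f s)^-1) *: dt +
  (c * (- sin (sg s) * ((f s)^-1 * (f s)^-1))) *: q) + (c * (cos (sg s) * ((f s)^-1 * (f s)^-1))) *: e.
have comp (G : R^o -> V) x : J x -> differentiable G (T x) ->
    differentiable (fun x : R^o => G (T x)) x /\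
    'D_1 (fun x : R^o => G (T x)) x = (c / f (T x)) *: 'D_1 G (T x).
  move=> Jx Gd; have Td := is_derive_diff (dT x Jx).
  split; first exact: (differentiable_comp Td Gd).
  have := @derive_comp R R^o R^o V T G x 1 Td Gd; have [_ ->] := dT x Jx.
  by move=> E; exact: (etrans E (derive_real (c / f (T x)) Gd)).
have c1 x : J x -> derive1 c0 x = F1 (T x).
  move=> Jx; have Ix := TI x Jx; have [Fd FD] := dF _ Ix.
  rewrite derive1E; have [_ ->] := comp F x Jx Fd; rewrite FD.
  by apply/rowP => i; rewrite !mxE; field; rewrite f0.
pose i1 s := (f s)^-1.
have di s : I s -> is_derive s (1 : R) i1 (- ((f s) ^- 2 * df s)).
  by move=> Is; apply: is_derive_inv; [exact: f0|exact: is_derive_warping].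
have dF1 s : I s -> differentiable F1 s /\
   'D_1 F1 s = ((- c * df s / f s ^+ 2) *: dt +
    (c * (- cos (sg s) / f s ^+ 3 + 2 * sin (sg s) * df s / f s ^+ 3)) *: q) +
    (c * (- sin (sg s) / f s ^+ 3 - 2 * cos (sg s) * df s / f s ^+ 3)) *: e.
  move=> Is.
  have dc := is_derive_cst c s (1 : R).
  have dii := is_derive_mul (di s Is) (di s Is).
  have d1 := is_derive_mul dc (di s Is).
  have d2 := is_derive_mul dc (is_derive_mul (is_derive_opp (dsin s Is)) dii).
  have d3 := is_derive_mul dc (is_derive_mul (dcos s Is) dii).
  have [Fd FD] := derive_frame q e d1 d2 d3; split; first exact: Fd.
  rewrite (FD : 'D_1 F1 s = _) /i1; congr (_ *: _ + _ *: _ + _ *: _).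
  - by rewrite /=; field; rewrite f0.
  - by rewrite /=; field; rewrite f0.
  - by rewrite /=; field; rewrite f0.
have Iz x : J x -> I (T x) by exact: TI.
have qs : spat q = q by rewrite [RHS]time_space_split q0 scale0r add0r.
have es : spat e = e by rewrite [RHS]time_space_split e0 scale0r add0r.
have tF a b d : tcoord ((a *: dt + b *: q) + d *: e : V) = a.
  by rewrite !(tcoordD, tcoordZ) tcoord_dt q0 e0 !mulr0 !addr0 mulr1.
have sF a b d : spat ((a *: dt + b *: q) + d *: e : V) = b *: q + d *: e.
  by rewrite !(spatD, spatZ) spat_dt qs es scaler0 add0r.
have dF2 a b : dot (a *: q + b *: e) (a *: q + b *: e) = a * a + b * b.
  by rewrite !(dotDl, dotDr) !dotZl !dotZr q1 e1 qe (dotC e) qe; ring.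
have cs1 s : cos (sg s) * cos (sg s) + sin (sg s) * sin (sg s) = 1.
  by rewrite -!expr2 cos2Dsin2.
have c2 x : J x -> derive1 (derive1 c0) x = (c / f (T x)) *: 'D_1 F1 (T x).
  move=> Jx; have [Fd _] := dF1 _ (TI x Jx); have [_ <-] := comp F1 x Jx Fd.
  rewrite derive1E; apply: near_eq_derive.
  by apply: filterS (open_nbhs_nbhs (conj oJ Jx)) => y; exact: c1.
have geo : geodesic I f J c0.
  split=> // x Jx; have Ix := TI x Jx; have fx := f0 Ix.
  have u1 : dot (spat (c0 x)) (spat (c0 x)) = 1 by rewrite /c0 /F sF dF2.
  have tx : tcoord (c0 x) = T x by rewrite /c0 /F tF.
  split; first by apply/rw_spaceE; rewrite u1 tx.
  apply/covariant_eq0; rewrite ?tx//; first exact: smooth_diff f_smooth Ix.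
  rewrite c2// c1//; have [_ ->] := dF1 _ Ix.
  rewrite tcoordZ tF spatZ /F1 sF tF dF2 /c0 /F sF; split.
    set C := cos _; set N := sin _; have E : C * C + N * N = 1 by exact: cs1.
    have -> : c * (- N * ((f (T x))^-1 * (f (T x))^-1)) * (c * (- N * ((f (T x))^-1 * (f (T x))^-1))) +
      c * (C * ((f (T x))^-1 * (f (T x))^-1)) * (c * (C * ((f (T x))^-1 * (f (T x))^-1))) =
      c ^+ 2 / f (T x) ^+ 4 * (C * C + N * N) by field.
    by rewrite E /=; field.
  exists (- (c ^+ 2 / f (T x) ^+ 4)); rewrite sF; apply/rowP => i; rewrite !mxE /=.
  by field.
have Plt (a b : R) : I a -> I b -> a < b -> Phi a < Phi b by exact: derive_gt0_lt I_itv dPhi f_pos.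
have c_neq0 : c != 0.
  rewrite subr_eq0; move: s01; rewrite neq_lt => /orP[h|h].
    by rewrite gt_eqF// Plt.
  by rewrite lt_eqF// Plt.
have sJ : `[0, 1] `<=` J.
  move=> x; rewrite /= in_itv/= => /andP[x0 x1].
  have [h|h] := leP s0 s1.
    have cp : 0 <= c by rewrite subr_ge0; move: h;
      rewrite le_eqVlt => /predU1P[->//|/Plt-/(_ I0 I1)/ltW].
    have [|t It E] := primitive_IVT (y := l x) I_itv dPhi I0 I1 h.
      by rewrite /l lerDl mulr_ge0//= -lerBrDl ler_piMl.
    by exists t.
  have cp : c <= 0 by rewrite subr_le0; apply/ltW/Plt.
  have [|t It E] := primitive_IVT (y := l x) I_itv dPhi I1 I0 (ltW h).
    rewrite /l gerDl mulr_ge0_le0// andbT -lerBlDl -/c.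
    by rewrite ler_niMl.
  by exists t.
have J0 : J 0 by apply: sJ; rewrite /= in_itv/= lexx ler01.
have J1' : J 1 by apply: sJ; rewrite /= in_itv/= lexx ler01.
have T0 : T 0 = s0 by rewrite /T /l mul0r addr0 HK.
have T1 : T 1 = s1 by rewrite /T /l mul1r /c addrC subrK HK.
have c00 : c0 0 = p.
  by rewrite /c0 T0 /F /sg subrr cos0 sin0 scale1r scale0r addr0.
have c01 : c0 1 = z by rewrite /c0 T1 /F /z addrA.
have f00 := f0 I0.
exists (F1 s0); split.
- split.
  + exists J, c0; split=> // [x Jx|]; first by case: (geo.2 x Jx).
    by rewrite c1// T0.
  + apply/eqP => /(congr1 (@tcoord R n)); rewrite /F1 tF /tcoord mxE => /eqP.
    by rewrite mulf_eq0 (negbTE c_neq0) invr_eq0 (negbTE f00).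
  + rewrite rwgE /F1 tF sF dF2 /p tcoordD tcoordZ tcoord_dt q0 mulr1 addr0.
    by rewrite /sg subrr cos0 sin0; field.
- by rewrite /F1 tF.
by exists J, c0; split=> //; rewrite c1// T0.
Qed.

(** Along a null geodesic [f t'] is conserved; hence the projection to the
    sphere is a great circle whose arc length is the conformal time. *)
Lemma null_geodesic_cone (p v z : V) : rwg f p v v = 0 -> tcoord v != 0 ->
  exp_eq I f p v z ->
  [/\ rw_space I z, dot (spat z) (spat p) = cos (S (tcoord z) - S (tcoord p)),
      0 < tcoord v -> tcoord p < tcoord z & tcoord v < 0 -> tcoord z < tcoord p].
Proof.
move=> vv v0 [J [c [J01 [cs cgeo] c0 c0' c1]]].
have J01' (s : R) : 0 <= s <= 1 -> J s by move=> h; apply: J01; rewrite /= in_itv.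
have oJ := smooth_open cs.
pose c' (s : R) : V := derive1 c s; pose c2 (s : R) : V := derive1 c' s.
have c's : smooth (V := R^o) J c'.
  rewrite (_ : c' = fun s => 'D_1 c s); first exact: smoothDer.
  by apply/funext => s; rewrite /c' derive1E.
pose T (s : R) : R := tcoord (c s); pose T1 (s : R) : R := tcoord (c' s).
pose X s := spat (c s); pose X1 s := spat (c' s); pose X2 s := spat (c2 s).
have cd s : J s -> differentiable (c : R^o -> V) s by exact: smooth_diff cs.
have c'd s : J s -> differentiable (c' : R^o -> V) s by exact: smooth_diff c's.
have JM s : J s -> I (T s) /\ dot (X s) (X s) = 1.
  by move=> Js; have [/rw_spaceE[]] := cgeo s Js.
have Xd s : J s -> differentiable (X : R^o -> V) s by move=> /cd; exact: diff_spat.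
have X1d s : J s -> differentiable (X1 : R^o -> V) s by move=> /c'd; exact: diff_spat.
have XD s : J s -> 'D_1 (X : R^o -> V) (s : R^o) = X1 s.
  by move=> Js; rewrite (derive_spat (1 : R^o) (cd s Js)) /X1 /c' derive1E.
have X1D s : J s -> 'D_1 (X1 : R^o -> V) (s : R^o) = X2 s.
  by move=> Js; rewrite (derive_spat (1 : R^o) (c'd s Js)) /X2 /c2 derive1E.
have dT s : J s -> is_derive s (1 : R) T (T1 s).
  move=> Js; apply: (is_derive_eq (diff_is_derive (diff_tcoord (cd s Js)))).
  by rewrite (derive_tcoord (1 : R^o) (cd s Js)) /T1 /c' derive1E.
have dT1 s : J s -> is_derive s (1 : R) T1 (tcoord (c2 s)).
  move=> Js; apply: (is_derive_eq (diff_is_derive (diff_tcoord (c'd s Js)))).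
  by rewrite (derive_tcoord (1 : R^o) (c'd s Js)) /c2 derive1E.
have ddot (A B : R^o -> V) s : differentiable A s -> differentiable B s ->
    is_derive s (1 : R) (fun s => dot (A s) (B s) : R)
      (dot ('D_1 A s) (B s) + dot (A s) ('D_1 B s)).
  by move=> Ad Bd; apply: (is_derive_eq (diff_is_derive (diff_dot Ad Bd))); rewrite derive_dot.
have XX1 s : J s -> dot (X s) (X1 s) = 0.
  move=> Js; have [_ E] := ddot X X s (Xd s Js) (Xd s Js).
  have E0 : 'D_1 (fun s : R^o => dot (X s) (X s) : R^o) (s : R^o) = 0.
    rewrite -[RHS](derive_cst (1 : R^o) (s : R^o) (1 : R^o)).
    by apply: near_eq_derive; apply: filterS (open_nbhs_nbhs (conj oJ Js)) => y /JM[].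
  by move: E; rewrite E0 (XD s Js) (dotC (X1 s)) => E; lra.
pose N2 s : R := dot (X1 s) (X1 s).
have XX2 s : J s -> dot (X s) (X2 s) = - N2 s.
  move=> Js; have [_ E] := ddot X X1 s (Xd s Js) (X1d s Js).
  have E0 : 'D_1 (fun s : R^o => dot (X s) (X1 s) : R^o) (s : R^o) = 0.
    rewrite -[RHS](derive_cst (0 : R^o) (s : R^o) (1 : R^o)).
    by apply: near_eq_derive; apply: filterS (open_nbhs_nbhs (conj oJ Js)) => y /XX1.
  by move: E; rewrite E0 (XD s Js) (X1D s Js) -/(N2 s) => E; lra.
have geo s : J s -> tcoord (c2 s) = - (f (T s) * df (T s) * N2 s) /\
    X2 s = - N2 s *: X s - (2 * df (T s) / f (T s) * T1 s) *: X1 s.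
  move=> Js; have [Is u1] := JM s Js; have [_ Hc] := cgeo s Js.
  have [|E1 [k E2]] := (covariant_eq0 (c' s) (c' s) (c2 s) u1 (f0 Is) _).1 Hc.
    exact: smooth_diff f_smooth Is.
  split; first by apply/eqP; rewrite -addr_eq0; apply/eqP.
  have {}E2 : X2 s = k *: X s - (2 * df (T s) / f (T s) * T1 s) *: X1 s.
    rewrite -E2 -/(X2 s) -/(T1 s) -/(X1 s) -/(T s); apply/rowP => i; rewrite !mxE.
    by field; exact: f0.
  suff -> : - N2 s = k by [].
  by rewrite -XX2// E2 dotDr dotNr !dotZr XX1// u1; ring.
have X1X2 s : J s -> dot (X1 s) (X2 s) = - (2 * df (T s) / f (T s) * T1 s) * N2 s.
  move=> Js; have [_ ->] := geo s Js.
  by rewrite dotDr dotNr !dotZr (dotC (X1 s)) XX1// -/(N2 s); ring.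
have dfT s : J s -> is_derive s (1 : R) (fun s => f (T s)) (df (T s) * T1 s).
  move=> Js; have [Is _] := JM s Js; apply: is_derive_chain (dT s Js).
  exact: is_derive_warping.
have dN2 s : J s -> is_derive s (1 : R) N2 (2 * dot (X1 s) (X2 s)).
  move=> Js; apply: (is_derive_eq (ddot X1 X1 s (X1d s Js) (X1d s Js))).
  by rewrite (X1D s Js) (dotC (X2 s)); ring.
have le01 : 0 <= (0 : R) <= 1 by rewrite lexx ler01.
have J0 := J01' 0 le01.
have Tp : T 0 = tcoord p by rewrite /T c0.
have Xp : X 0 = spat p by rewrite /X c0.
have T10 : T1 0 = tcoord v by rewrite /T1 /c' c0'.
have X10 : X1 0 = spat v by rewrite /X1 /c' c0'.
(* The squared length of the velocity is conserved. *)
pose E s : R := f (T s) * f (T s) * N2 s - T1 s * T1 s.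
have E0 (s : R) : 0 <= s <= 1 -> E s = 0.
  have E00 : E 0 = 0.
    by rewrite /E /N2 Tp X10 T10; move: vv; rewrite rwgE expr2 => vv0; lra.
  move=> /andP[s0 s1]; rewrite -E00; apply: derive0_const => // r /andP[r0 r1].
  have Jr : J r by apply: J01'; rewrite r0 (le_trans r1).
  have H1 := is_derive_mul (is_derive_mul (dfT r Jr) (dfT r Jr)) (dN2 r Jr).
  have H2 := is_derive_opp (is_derive_mul (dT1 r Jr) (dT1 r Jr)).
  apply: (is_derive_eq (is_derive_add H1 H2)).
  have [-> _] := geo r Jr; rewrite X1X2//=; have [Ir _] := JM r Jr.
  by field; exact: f0.
(* The conservation law of the conformal Killing field [f dt]. *)
pose K s : R := f (T s) * T1 s.
have Kc (s : R) : 0 <= s <= 1 -> K s = K 0.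
  move=> /andP[s0 s1]; apply: derive0_const => // r /andP[r0 r1].
  have r01 : 0 <= r <= 1 by rewrite r0 (le_trans r1).
  have Jr := J01' r r01.
  apply: (is_derive_eq (is_derive_mul (dfT r Jr) (dT1 r Jr))).
  have [-> _] := geo r Jr; have := E0 r r01; rewrite /E => Er.
  have -> : f (T r) * - (f (T r) * df (T r) * N2 r) + T1 r * (df (T r) * T1 r) =
    - df (T r) * (f (T r) * f (T r) * N2 r - T1 r * T1 r) by ring.
  by rewrite Er mulr0.
have fp : 0 < f (T 0) by apply: f_pos; have [] := JM 0 J0.
have K0 : K 0 != 0 by rewrite /K mulf_eq0 negb_or T10 v0 andbT gt_eqF.
have T1E (s : R) : 0 <= s <= 1 -> T1 s = K 0 / f (T s).
  move=> h; rewrite -(Kc s h) /K mulrAC mulfV ?mul1r//.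
  by apply: f0; have [] := JM s (J01' s h).
pose al s : R := dot (X s) (spat p); pose ga s : R := dot (X1 s) (spat p).
have cst s : differentiable (fun=> spat p : V) (s : R^o) by exact: differentiable_cst.
have dal s : J s -> is_derive s (1 : R) al (ga s).
  move=> Js; apply: (is_derive_eq (ddot X (fun=> spat p) s (Xd s Js) (cst s))).
  by rewrite derive_cst dot0r addr0 XD.
have dga s : J s -> is_derive s (1 : R) ga (dot (X2 s) (spat p)).
  move=> Js; apply: (is_derive_eq (ddot X1 (fun=> spat p) s (X1d s Js) (cst s))).
  by rewrite derive_cst dot0r addr0 X1D.
pose W s : R := f (T s) * f (T s) * ga s.
have dW (s : R) : 0 <= s <= 1 -> is_derive s (1 : R) W (- (K 0 ^+ 2 / f (T s) ^+ 2) * al s).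
  move=> h; have Js := J01' s h; have [Is _] := JM s Js; have fs := f0 Is.
  apply: (is_derive_eq (is_derive_mul (is_derive_mul (dfT s Js) (dfT s Js)) (dga s Js))).
  have [_ ->] := geo s Js; rewrite dotDl dotNl !dotZl -/(al s) -/(ga s).
  have N2E : N2 s = T1 s ^+ 2 / f (T s) ^+ 2.
    apply: (mulfI (mulf_neq0 fs fs)); have := E0 s h; rewrite /E => /subr0_eq ->.
    by field.
  by rewrite N2E T1E//=; field.
pose sg s : R := S (T s) - S (T 0).
have dsg (s : R) : 0 <= s <= 1 -> is_derive s (1 : R) sg (K 0 / f (T s) ^+ 2).
  move=> h; have Js := J01' s h; have [Is _] := JM s Js; have fs := f0 Is.
  have H1 := is_derive_chain (dS Is) (dT s Js).
  have H2 := is_derive_opp (is_derive_cst (S (T 0)) s (1 : R)).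
  apply: (is_derive_eq (is_derive_add H1 H2)); rewrite T1E// oppr0 addr0.
  by field.
have dcos (s : R) : 0 <= s <= 1 -> is_derive s (1 : R) (fun s =>
  cos (sg s)) (- sin (sg s) * (K 0 / f (T s) ^+ 2)).
  by move=> h; apply: is_derive_chain (dsg s h).
have dsin (s : R) : 0 <= s <= 1 -> is_derive s (1 : R) (fun s =>
  sin (sg s)) (cos (sg s) * (K 0 / f (T s) ^+ 2)).
  by move=> h; apply: is_derive_chain (dsg s h).
(* In the parameter [sg] the pair [(al, W / K)] rotates with unit speed;
   rotating it back gives the constants [A = 1] and [B = 0]. *)
pose A s : R := cos (sg s) * al s + - (sin (sg s) * (W s * (K 0)^-1)).
pose B s : R := sin (sg s) * al s + cos (sg s) * (W s * (K 0)^-1).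
have sg0 : sg 0 = 0 by rewrite /sg subrr.
have W0 : W 0 = 0 by rewrite /W /ga -Xp dotC XX1// mulr0.
have al0 : al 0 = 1 by rewrite /al -Xp; have [] := JM 0 J0.
have dWK (s : R) : 0 <= s <= 1 -> is_derive s (1 : R) (fun s => W s * (K 0)^-1)
    (- (K 0 / f (T s) ^+ 2) * al s).
  move=> h; have [Is _] := JM s (J01' s h); have fs := f0 Is.
  apply: (is_derive_eq (is_derive_mul (dW s h) (is_derive_cst (K 0)^-1 s (1 : R)))).
  by rewrite /=; field; rewrite fs K0.
have A1 : A 1 = 1.
  have A0 : A 0 = 1 by rewrite /A sg0 cos0 sin0 al0 mul0r oppr0 addr0 mulr1.
  rewrite -[RHS]A0; apply: derive0_const => // s h.
  have Js := J01' s h; have [Is _] := JM s Js; have fs := f0 Is.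
  have H1 := is_derive_mul (dcos s h) (dal s Js).
  have H2 := is_derive_opp (is_derive_mul (dsin s h) (dWK s h)).
  apply: (is_derive_eq (is_derive_add H1 H2)).
  by rewrite /W /=; field; rewrite fs K0.
have B1 : B 1 = 0.
  have B0 : B 0 = 0 by rewrite /B sg0 sin0 W0 !mul0r mulr0 addr0.
  rewrite -[RHS]B0; apply: derive0_const => // s h.
  have Js := J01' s h; have [Is _] := JM s Js; have fs := f0 Is.
  have H1 := is_derive_mul (dsin s h) (dal s Js).
  have H2 := is_derive_mul (dcos s h) (dWK s h).
  apply: (is_derive_eq (is_derive_add H1 H2)).
  by rewrite /W /=; field; rewrite fs K0.
have J1 : J 1 by apply: J01'; rewrite ler01 lexx.
have Tz : T 1 = tcoord z by rewrite /T c1.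
have Xz : X 1 = spat z by rewrite /X c1.
have itv01 : is_interval [set` `[(0 : R), 1]] by exact: interval_is_interval.
have m01 (s : R) : [set` `[(0 : R), 1]] s -> 0 <= s <= 1 by rewrite /= in_itv.
have m0 : [set` `[(0 : R), 1]] 0 by rewrite /= in_itv/= lexx ler01.
have m1 : [set` `[(0 : R), 1]] 1 by rewrite /= in_itv/= lexx ler01.
split.
- by have [+ _] := cgeo 1 J1; rewrite c1.
- rewrite -Xz -/(al 1) -Tz -Tp -/(sg 1).
  have : cos (sg 1) * A 1 + sin (sg 1) * B 1 = al 1 * (cos (sg 1) ^+ 2 + sin (sg 1) ^+ 2).
    by rewrite /A /B; ring.
  by rewrite A1 B1 cos2Dsin2 !mulr1 mulr0 addr0.
- move=> vp; rewrite -Tz -Tp.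
  apply: (derive_gt0_lt (g := T1) itv01 _ _ m0 m1 ltr01) => s sm.
    exact/dT/J01'/m01.
  rewrite T1E; last exact: m01.
  rewrite divr_gt0//; first by rewrite mulr_gt0// T10.
  by apply: f_pos; have [] := JM s (J01' s (m01 s sm)).
move=> vn; rewrite -Tz -Tp -ltrN2.
apply: (derive_gt0_lt (G := fun s => - T s) (g := fun s => - T1 s) itv01 _ _ m0 m1 ltr01) => s sm.
  exact/is_derive_opp/dT/J01'/m01.
rewrite T1E; last exact: m01.
rewrite oppr_gt0 pmulr_llt0; first by rewrite pmulr_rlt0// T10.
by rewrite invr_gt0; apply: f_pos; have [] := JM s (J01' s (m01 s sm)).
Qed.

Lemma rwg_dt (p v : V) : rwg f p v dt = - tcoord v.
Proof. by rewrite rwgE tcoord_dt mulr1 spat_dt dot0r mulr0 addr0. Qed.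

Lemma future_nullcone_sub (p z : V) : future_nullcone I f p z ->
  [/\ rw_space I z, dot (spat z) (spat p) = cos (S (tcoord z) - S (tcoord p)) &
      tcoord p < tcoord z].
Proof.
move=> [v [[_ _ vv]]]; rewrite rwg_dt oppr_lt0 => v0 e.
by have [h1 h2 h3 _] := null_geodesic_cone vv (lt0r_neq0 v0) e; split=> //; exact: h3.
Qed.

Lemma past_nullcone_sub (p z : V) : past_nullcone I f p z ->
  [/\ rw_space I z, dot (spat z) (spat p) = cos (S (tcoord z) - S (tcoord p)) &
      tcoord z < tcoord p].
Proof.
move=> [v [[_ _ vv]]]; rewrite rwg_dt oppr_gt0 => v0 e.
by have [h1 h2 _ h3] := null_geodesic_cone vv (ltr0_neq0 v0) e; split=> //; exact: h3.
Qed.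

End null_geodesics.

(** * Umbilic null hypersurfaces are open in nullcones *)

Section nullcones.
Context {R : realType} {n : nat}.
Variables (I : set R) (f : R -> R).
Hypotheses (I_open : open I) (I_itv : is_interval I)
  (f_smooth : smooth (V := R^o) (W := R^o) I f) (f_pos : forall t, I t -> 0 < f t).
Local Notation V := 'rV[R]_n.+1.
Local Notation dt := (@partial_t R n).
Variables (S Phi : R -> R).
Hypotheses (dS : forall t, I t -> is_derive t (1 : R) S (f t)^-1)
  (dPhi : forall t, I t -> is_derive t (1 : R) Phi (f t)).

Lemma conformal_time_lt a b : I a -> I b -> (S a < S b) = (a < b).
Proof.
have if0 t : I t -> 0 < (f t)^-1 by move=> /f_pos; rewrite invr_gt0.
move=> Ia Ib; have [ab|ba|->] := ltgtP a b; last by rewrite ltxx.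
  exact: derive_gt0_lt I_itv dS if0 Ia Ib ab.
by apply/negbTE; rewrite -leNgt ltW//; exact: derive_gt0_lt I_itv dS if0 Ib Ia ba.
Qed.

Lemma Phi_lt a b : I a -> I b -> a < b -> Phi a < Phi b.
Proof. exact: derive_gt0_lt I_itv dPhi f_pos. Qed.

(** The geodesic from the vertex runs backwards in conformal time, hence in
    the direction [- e]. *)
Lemma cone_past (s0 : R) (q e z : V) (th : R) : I s0 -> I (tcoord z) -> 0 < th ->
  tcoord q = 0 -> tcoord e = 0 -> dot q q = 1 -> dot e e = 1 -> dot q e = 0 ->
  S (tcoord z) = S s0 - th -> spat z = cos th *: q + sin th *: e ->
  past_nullcone I f (s0 *: dt + q) z.
Proof.
move=> I0 Iz th0 q0 e0 q1 e1 qe Sz sz.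
have zs : tcoord z < s0 by rewrite -conformal_time_lt// Sz gtrBl.
have e0' : tcoord (- e) = 0 by rewrite tcoordN e0 oppr0.
have e1' : dot (- e) (- e) = 1 by rewrite dotNl dotNr opprK.
have qe' : dot q (- e) = 0 by rewrite dotNr qe oppr0.
have s0z : s0 != tcoord z by rewrite gt_eqF.
have [v [nv tv ev]] := null_geodesic_exists I_open I_itv f_smooth f_pos dS dPhi
  I0 Iz s0z q0 e0' q1 e1' qe'.
exists v; split=> //.
  rewrite rwg_dt oppr_gt0 tv pmulr_llt0 ?invr_gt0 ?f_pos//.
  by rewrite subr_lt0 Phi_lt.
rewrite [z]time_space_split sz; move: ev; rewrite Sz addrAC subrr add0r cosN sinN.
by rewrite scalerN scaleNr opprK.
Qed.

Lemma cone_future (s0 : R) (q e z : V) (th : R) : I s0 -> I (tcoord z) -> 0 < th ->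
  tcoord q = 0 -> tcoord e = 0 -> dot q q = 1 -> dot e e = 1 -> dot q e = 0 ->
  S (tcoord z) = S s0 + th -> spat z = cos th *: q + sin th *: e ->
  future_nullcone I f (s0 *: dt + q) z.
Proof.
move=> I0 Iz th0 q0 e0 q1 e1 qe Sz sz.
have zs : s0 < tcoord z by rewrite -conformal_time_lt// Sz ltrDl.
have s0z : s0 != tcoord z by rewrite lt_eqF.
have [v [nv tv ev]] := null_geodesic_exists I_open I_itv f_smooth f_pos dS dPhi
  I0 Iz s0z q0 e0 q1 e1 qe.
exists v; split=> //.
  rewrite rwg_dt oppr_lt0 tv divr_gt0 ?f_pos//.
  by rewrite subr_gt0 Phi_lt.
by rewrite [z]time_space_split sz; move: ev; rewrite Sz addrAC subrr add0r.
Qed.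

(** Near a point of [L], the points of a regular part of a cone that contains
    [L] are points of [L]: both are graphs over the sphere. The sign [eps]
    distinguishes the two halves of the cone. *)
Lemma cone_sub_near (L : set V) (xi : V -> V) (s0 eps : R) (q p : V) :
  null_hypersurface I f L -> associated_null_field f L xi -> `|eps| = 1 ->
  (forall z, L z -> dot (spat z) q = cos (S (tcoord z) - s0)) ->
  L p -> 0 < eps * (S (tcoord p) - s0) < pi ->
  \forall z \near p, rw_space I z -> dot (spat z) q = cos (S (tcoord z) - s0) -> L z.
Proof.
move=> L_null xi_null eps1 Lq Lp /andP[p0 ppi].
have [[_ _ LM _] _] := L_null.
have [U [F [Up Fs LF DF]]] := null_transverse_time I_open f_pos L_null xi_null Lp.
have pdt : dot (spat p) (spat dt) = 0 by rewrite spat_dt dot0r.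
have [N [beta [Np bs Ps bp [PL PLid _]]]] :=
  hypersurface_retraction I_open LM Lp Up Fs LF pdt DF.
have cos_eps x : cos (eps * x) = cos x.
  move: eps1 => /eqP; rewrite eqr_norml ler01 andbT => /orP[] /eqP ->.
    by rewrite mul1r.
  by rewrite mulN1r cosN.
have Ip : I (tcoord p) by have /rw_spaceE[] := LM p Lp.
have eps0 : eps != 0 by rewrite -normr_eq0 eps1 oner_eq0.
pose g (z : V) : R^o := eps * (S (tcoord z) - s0).
have Sc : {for tcoord p, continuous (S : R^o -> R^o)} by exact: is_derive_continuous (dS Ip).
have gnear (h : V -> V) : h p = p -> {for p, continuous h} ->
    \forall z \near p, 0 < g (h z) /\ g (h z) < pi.
  move=> hp hc.
  have tc : {for p, continuous (fun z => tcoord (h z) : R^o)}.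
    apply: (@continuous_comp _ _ _ h (fun z : V => tcoord z : R^o)) => //.
    exact: coord_continuous.
  have Sc' : {for p, continuous (fun z => S (tcoord (h z)) : R^o)}.
    apply: (@continuous_comp _ _ _ (fun z => tcoord (h z) : R^o) (S : R^o -> R^o)) => //.
    by rewrite hp.
  have gc : {for p, continuous (fun z => g (h z))}.
    exact: (cvgM (cvg_cst eps) (cvgB Sc' (cvg_cst s0))).
  by apply: filterI; [apply: near_gt gc _|apply: near_lt gc _]; rewrite hp.
have N1 := gnear id erefl (@cvg_id _ _).
have pc : {for p, continuous (fun z : V => z + beta z *: dt : V)}.
  apply: smooth_cont Np; apply: smoothD; first by apply: smooth_id; exact: smooth_open bs.
  by apply: smooth_scale => //; apply: smooth_cst; exact: smooth_open bs.
have hp : p + beta p *: dt = p by rewrite bp scale0r addr0.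
have N2 := gnear _ hp pc.
have N3 : \forall z \near p, N z by apply: open_nbhs_nbhs; split=> //; exact: smooth_open bs.
have N4 : \forall z \near p, (0 < g z /\ g z < pi) /\
    (0 < g (z + beta z *: dt) /\ g (z + beta z *: dt) < pi) /\ N z.
  by apply: filterI => //; apply: filterI => //; exact: N2.
apply: filterS N4 => z [[g1 g2] [[g3 g4] Nz]] Mz zq.
have /rw_spaceE[Iz z1] := Mz.
have LPz := PL z Nz; set w := z + beta z *: dt in g3 g4 LPz.
have sw : spat w = spat z by rewrite spatD spatZ spat_dt scaler0 addr0.
have wid : normz w = w by apply: normz_id; rewrite sw.
rewrite wid in LPz; have /rw_spaceE[Iw _] := LM _ LPz.
have gw : g w = g z.
  apply: cos_inj; rewrite ?in_itv/= ?ltW//.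
  by rewrite /g !cos_eps -(Lq _ LPz) -zq sw.
have Sw : S (tcoord w) = S (tcoord z).
  by move: gw => /(mulfI eps0) /addIr.
suff <- : w = z by [].
apply: time_space_eq => //; have [h|h|//] := ltgtP (tcoord w) (tcoord z).
  by have := conformal_time_lt Iw Iz; rewrite Sw ltxx h.
by have := conformal_time_lt Iz Iw; rewrite Sw ltxx h.
Qed.

(** The interval from [S t + th - pi] to [S t + th] has length [pi] and contains
    [S t], so one of its ends lies between [S t] and one of [S a] and [S b], and [S]
    takes intermediate values. *)
Lemma cone_vertex (a b t th : R) : I a -> I b -> a < b -> pi < S b - S a -> I t ->
  0 < th -> th < pi ->
  (exists2 s, I s & S s = S t + th) \/ (exists2 s, I s & S s = S t + th - pi).
Proof.
move=> Ia Ib ab Sab It th0 thpi.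
have Sle x y : I x -> I y -> x <= y -> S x <= S y.
  by move=> Ix Iy; rewrite le_eqVlt => /predU1P[->//|xy]; rewrite ltW// conformal_time_lt.
have ivt x y r : I x -> I y -> S x <= r <= S y -> exists2 s, I s & S s = r.
  move=> Ix Iy /andP[h1 h2]; have [xy|yx] := leP x y.
    by apply: primitive_IVT I_itv dS Ix Iy xy _; rewrite h1.
  have h3 := Sle _ _ Iy Ix (ltW yx).
  by exists x => //; apply/eqP; rewrite eq_le h1 (le_trans h2).
have [h|h] := leP (S t + th) (S b).
  by left; apply: (ivt t b); rewrite // h andbT lerDl ltW.
right; apply: (ivt a t) => //; apply/andP; split; lra.
Qed.

(** Openness can be checked locally, which avoids gluing neighbourhoods. *)
Lemma open_in_local (T : topologicalType) (L A : set T) : L `<=` A ->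
  (forall p, L p -> \forall z \near p, A z -> L z) -> open_in L A.
Proof.
move=> LA AL; exists (interior [set z | A z -> L z]); first exact: open_interior.
apply/seteqP; split=> z; first by move=> Lz; split; [exact: LA|exact: AL].
by move=> [Az /interior_subset]; exact.
Qed.

Theorem umbilic_open_in_nullcone (L : set V) : (3 < n)%N ->
  (exists a, exists b, [/\ I a, I b, a < b & pi < S b - S a]) ->
  null_hypersurface I f L -> totally_umbilic f L -> open_set_of_nullcone I f L.
Proof.
move=> n_gt3 [a [b [Ia Ib ab Sab]]] L_null [xi xi_null [rho rho_smooth umb]].
have [q0 [s0 [tq0 q1 Lcone]]] :=
  umbilic_cone I_open f_smooth f_pos n_gt3 L_null xi_null rho_smooth umb dS.
have [[[p0 Lp0] _ LM _] _] := L_null.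
have LI z : L z -> I (tcoord z) by move=> /LM /rw_spaceE[].
pose th := cone_angle f rho.
have th0 z : 0 < th z by exact: cone_angle_gt0.
have thpi z : th z < pi by exact: cone_angle_ltpi.
have dotq z : L z -> dot (spat z) q0 = cos (th z).
  move=> Lz; have [_ _ [e [te e1 qe ->]]] := Lcone z Lz.
  by rewrite dotDl !dotZl q1 (dotC e) qe mulr0 addr0 mulr1.
have sq0 : spat q0 = q0 by rewrite [RHS]time_space_split tq0 scale0r add0r.
have [[s Is Ss]|[s Is Ss]] := cone_vertex Ia Ib ab Sab (LI _ Lp0) (th0 p0) (thpi p0).
  have {}Ss : S s = s0 by rewrite Ss; have [-> _ _] := Lcone _ Lp0; rewrite subrK.
  have tv : tcoord (s *: dt + q0) = s by rewrite tcoordD tcoordZ tcoord_dt tq0 mulr1 addr0.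
  have sv : spat (s *: dt + q0) = q0 by rewrite spatD spatZ spat_dt scaler0 add0r.
  exists (s *: dt + q0); first by apply/rw_spaceE; rewrite tv sv.
  right; apply: open_in_local => [z Lz|p Lp].
    have [Sz _ [e [te e1 qe sz]]] := Lcone z Lz.
    by apply: (cone_past Is (LI z Lz) (th0 z) tq0 te q1 e1 qe); rewrite ?Ss.
  have Lq z : L z -> dot (spat z) q0 = cos (S (tcoord z) - s0).
    move=> Lz; have [-> _ _] := Lcone z Lz.
    by rewrite dotq// addrAC subrr add0r cosN.
  have Np1 : `|-1 : R| = 1 by rewrite normrN normr1.
  have rng : 0 < -1 * (S (tcoord p) - s0) < pi.
    have [-> _ _] := Lcone p Lp.
    by rewrite addrAC subrr add0r mulN1r opprK th0 thpi.
  apply: filterS (cone_sub_near L_null xi_null Np1 Lq Lp rng) => z H.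
  move=> /(past_nullcone_sub f_smooth f_pos dS)[Mz + _].
  by rewrite sv tv Ss; exact: H.
have {}Ss : S s = s0 - pi by rewrite Ss; have [-> _ _] := Lcone _ Lp0; rewrite subrK.
have tv : tcoord (s *: dt - q0) = s by rewrite tcoordD tcoordN tcoordZ tcoord_dt tq0 oppr0 mulr1 addr0.
have sv : spat (s *: dt - q0) = - q0 by rewrite spatD spatN spatZ spat_dt scaler0 add0r sq0.
exists (s *: dt - q0); first by apply/rw_spaceE; rewrite tv sv dotNl dotNr opprK.
left; apply: open_in_local => [z Lz|p Lp].
  have [Sz _ [e [te e1 qe sz]]] := Lcone z Lz.
  have tqN : tcoord (- q0) = 0 by rewrite tcoordN tq0 oppr0.
  have qN1 : dot (- q0) (- q0) = 1 by rewrite dotNl dotNr opprK.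
  have qNe : dot (- q0) e = 0 by rewrite dotNl qe oppr0.
  have thN : 0 < pi - th z by rewrite subr_gt0.
  apply: (cone_future Is (LI z Lz) thN tqN te qN1 e1 qNe).
    by rewrite Ss Sz addrA subrK.
  by rewrite sz (cosB pi (th z)) (sinB pi (th z)) cospi sinpi !mul0r addr0 sub0r !mulN1r opprK
    scalerN scaleNr opprK.
have Lq z : L z -> dot (spat z) (- q0) = cos (S (tcoord z) - S s).
  move=> Lz; have [-> _ _] := Lcone z Lz.
  rewrite dotNr dotq// Ss (_ : s0 - th z - (s0 - pi) = pi - th z); last by ring.
  by rewrite (cosB pi (th z)) cospi sinpi mul0r addr0 mulN1r.
have p1 : `|1 : R| = 1 by rewrite normr1.
have rng : 0 < 1 * (S (tcoord p) - S s) < pi.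
  have [-> _ _] := Lcone p Lp; rewrite mul1r Ss.
  rewrite (_ : s0 - th p - (s0 - pi) = pi - th p); last by ring.
  by rewrite subr_gt0 thpi gtrBl th0.
apply: filterS (cone_sub_near L_null xi_null p1 Lq Lp rng) => z H.
move=> /(future_nullcone_sub f_smooth f_pos dS)[Mz + _].
by rewrite sv tv; exact: H.
Qed.

End nullcones.

(** * The cone between two consecutive vertices *)

Section full_cones.
Context {R : realType} {n : nat}.
Variables (I : set R) (f : R -> R).
Hypotheses (I_open : open I) (I_itv : is_interval I)
  (f_smooth : smooth (V := R^o) (W := R^o) I f) (f_pos : forall t, I t -> 0 < f t).
Local Notation V := 'rV[R]_n.+1.
Local Notation dt := (@partial_t R n).
Local Notation df t := ('D_1 (f : R^o -> R^o) (t : R^o)).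
Variables (S : R -> R).
Hypotheses (dS : forall t, I t -> is_derive t (1 : R) S (f t)^-1).
Variables (s0 : R) (q0 : V).
Hypotheses (tq0 : tcoord q0 = 0) (q1 : dot q0 q0 = 1).

Definition cone_times : set R := [set t | [/\ I t, s0 - pi < S t & S t < s0]].
Local Notation I' := cone_times.

(** The cone between the vertices at conformal times [s0 - pi] over [- q0] and
    [s0] over [q0]; the vertices may lie outside of the space. *)
Definition full_cone : set V := [set z | [/\ rw_space I z, I' (tcoord z) &
  dot (spat z) q0 = cos (s0 - S (tcoord z))]].

Let f0 t : I t -> f t != 0. Proof. by move=> /f_pos /lt0r_neq0. Qed.

Let Ss : smooth (V := R^o) (W := R^o) I S.
Proof. exact: (smooth_conformal_time f_smooth f_pos dS). Qed.

Let sq0 : spat q0 = q0. Proof. by rewrite [RHS]time_space_split tq0 scale0r add0r. Qed.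

Lemma open_cone_times : open I'.
Proof.
have -> : I' = I `&` S @^-1` [set y : R^o | s0 - pi < y /\ y < s0].
  by apply/seteqP; split=> t [It] ; [move=> h1 h2|move=> [h1 h2]].
apply: (smooth_preimage_open Ss).
have -> : [set y : R^o | s0 - pi < y /\ y < s0] = [set y | s0 - pi < y] `&` [set y | y < s0] by [].
by apply: openI; [exact: open_gt|exact: open_lt].
Qed.

Lemma cone_times_itv : is_interval I'.
Proof.
move=> a b [Ia a1 a2] [Ib b1 b2] t /andP[at_ tb].
have It : I t by apply: (I_itv Ia Ib); rewrite at_.
have le x y : I x -> I y -> x <= y -> S x <= S y.
  move=> Ix Iy; rewrite le_eqVlt => /predU1P[->//|xy]; rewrite ltW//.
  by rewrite (conformal_time_lt I_itv f_pos dS).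
split=> //; first exact: lt_le_trans a1 (le _ _ Ia It at_).
exact: le_lt_trans (le _ _ It Ib tb) b2.
Qed.

Lemma sin_cone t : I' t -> 0 < sin (s0 - S t).
Proof. by move=> [_ h1 h2]; apply: sin_gt0_pi; apply/andP; split; lra. Qed.

Let I'I : I' `<=` I. Proof. by move=> t []. Qed.

Lemma smooth_cone_trig : smooth (V := R^o) (W := R^o) I' (fun t => cos (s0 - S t)) /\
  smooth (V := R^o) (W := R^o) I' (fun t => sin (s0 - S t)).
Proof.
have oI' := open_cone_times.
have gs : smooth (V := R^o) (W := R^o) I' (fun t => s0 + - S t).
  apply: smoothD; first exact: smooth_cst.
  by apply: smoothN; exact: smooth_subset oI' I'I Ss.
split; first exact: (smooth_comp_real _ gs smooth_cos).
exact: (smooth_comp_real _ gs smooth_sin).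
Qed.

Definition cone_coef (t : R) : R := (f t * f t * sin (s0 - S t))^-1.
(** Up to normalisation, minus the gradient of the equation [cone_eq] of the
    cone, written with coefficients that depend on time only. *)
Definition cone_field (z : V) : V := - (f (tcoord z))^-1 *: dt +
  ((cone_coef (tcoord z) * cos (s0 - S (tcoord z))) *: spat z + - cone_coef (tcoord z) *: q0).

(** The solution [rho] of [f' - rho f ^ 2 = cot (s0 - S)], as the section of the
    cone at time [t] is a sphere of radius [s0 - S t]. *)
Definition cone_rho (z : V) : R^o :=
  (df (tcoord z) - cos (s0 - S (tcoord z)) / sin (s0 - S (tcoord z))) *
  (f (tcoord z) * f (tcoord z))^-1.

Let U' : set V := [set z | I' (tcoord z)].

Let fs' : smooth (V := R^o) (W := R^o) I' f.
Proof. exact: smooth_subset open_cone_times I'I f_smooth. Qed.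

Let smooth_V (g : R^o -> R^o) : (forall t, I' t -> g t != 0) -> smooth I' g ->
  smooth I' (fun t => (g t)^-1 : R^o).
Proof. by move=> g0 gs; apply: (smooth_comp_real _ gs smooth_inv). Qed.

Lemma smooth_cone_coef : smooth (V := R^o) (W := R^o) I' cone_coef.
Proof.
apply: smooth_V => [t It|]; last by apply: smoothM; [exact: smoothM|exact: smooth_cone_trig.2].
by rewrite !mulf_neq0 ?f0 ?gt_eqF ?sin_cone//; exact: I'I.
Qed.

Lemma smooth_cone_field : smooth U' cone_field.
Proof.
have oI' := open_cone_times.
have H (g : R^o -> R^o) : smooth I' g -> smooth U' (fun z : V => g (tcoord z) : R^o).
  exact: smooth_time.
have idV : smooth U' (fun z : V => z).
  by apply: smooth_id; have := smooth_open (H _ fs').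
have cst (w : V) : smooth U' (fun _ : V => w).
  by apply: smooth_cst; have := smooth_open (H _ fs').
have fV : smooth (V := R^o) (W := R^o) I' (fun t => (f t)^-1).
  by apply: smooth_V => // t /I'I; exact: f0.
apply: smoothD; first by apply: smooth_scale => //; exact: (H (fun t => - (f t)^-1)) (smoothN fV).
apply: smoothD.
  apply: smooth_scale; last exact: smooth_spat.
  exact: (H (fun t => cone_coef t * cos (s0 - S t))) (smoothM smooth_cone_coef smooth_cone_trig.1).
by apply: smooth_scale => //; exact: (H (fun t => - cone_coef t)) (smoothN smooth_cone_coef).
Qed.

Lemma smooth_cone_rho : smooth U' cone_rho.
Proof.
have oI' := open_cone_times.
have H (g : R^o -> R^o) : smooth I' g -> smooth U' (fun z : V => g (tcoord z) : R^o).
  exact: smooth_time.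
have sV : smooth (V := R^o) (W := R^o) I' (fun t => (sin (s0 - S t))^-1).
  apply: smooth_V => [t It|]; last exact: smooth_cone_trig.2.
  by rewrite gt_eqF// sin_cone.
have fV : smooth (V := R^o) (W := R^o) I' (fun t => (f t * f t)^-1).
  by apply: smooth_V => [t /I'I It|]; [rewrite mulf_neq0 ?f0|exact: smoothM].
apply: smoothM; last exact: (H _ fV).
apply: smoothD; first exact: (H _ (smoothDer (1 : R^o) fs')).
by apply: smoothN; exact: (H _ (smoothM smooth_cone_trig.1 sV)).
Qed.

Definition cone_eq (z : V) : R^o := dot (spat z) q0 - cos (s0 - S (tcoord z)).

Lemma derive_cone_eq z w : I' (tcoord z) ->
  'D_w cone_eq z = dot (spat w) q0 - sin (s0 - S (tcoord z)) * (tcoord w / f (tcoord z)).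
Proof.
move=> Iz; have idd : differentiable (fun z : V => z) z by case: (is_diff_id z).
have cd : differentiable (fun _ : V => q0) z by exact: differentiable_cst.
have gd : differentiable ((fun t : R => cos (s0 - S t)) : R^o -> R^o) (tcoord z).
  exact: smooth_diff smooth_cone_trig.1 Iz.
have [d D] := derive_time w gd.
have sd := diff_dot (diff_spat idd) cd.
rewrite (deriveD_fun w sd (diffN_fun d)) (deriveN_fun w d) D.
rewrite (derive_dot w (diff_spat idd) cd) derive_cst dot0r addr0 (derive_spat w idd).
have -> : 'D_w (fun z : V => z) z = w by exact: derive_id.
congr (_ - _).
have H1 := is_derive_add (is_derive_cst s0 (tcoord z) (1 : R)) (is_derive_opp (dS (I'I Iz))).
have [_ ->] := is_derive_chain (is_derive_cos _) H1.
by rewrite add0r; ring.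
Qed.

Lemma smooth_cone_eq : smooth U' cone_eq.
Proof.
have oI' := open_cone_times.
have H (g : R^o -> R^o) : smooth I' g -> smooth U' (fun z : V => g (tcoord z) : R^o).
  exact: smooth_time.
have oU' : open U' by have := smooth_open (H _ fs').
apply: smoothD; last by apply: smoothN; exact: (H _ smooth_cone_trig.1).
by apply: smooth_dot; [apply: smooth_spat; exact: smooth_id|exact: smooth_cst].
Qed.

Let coneP z : U' z -> rw_space I z -> full_cone z <-> cone_eq z = 0.
Proof.
move=> Uz Mz; split; first by move=> [_ _ E]; rewrite /cone_eq E subrr.
by move=> /subr0_eq E; split.
Qed.

Let coneM : full_cone `<=` rw_space I. Proof. by move=> z []. Qed.

Let cone_dt z : full_cone z -> 'D_dt cone_eq z != 0.
Proof.
move=> [/rw_spaceE[Iz _] I'z _]; rewrite derive_cone_eq// spat_dt dot0l tcoord_dt sub0r.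
by rewrite oppr_eq0 !mulf_neq0 ?invr_eq0 ?f0 ?gt_eqF ?sin_cone// ltr01.
Qed.

Lemma tangent_full_cone z w : full_cone z -> tangent full_cone z w <->
  dot (spat z) (spat w) = 0 /\
  dot (spat w) q0 = sin (s0 - S (tcoord z)) * (tcoord w / f (tcoord z)).
Proof.
move=> Lz; have [Mz Iz zq] := Lz; split=> [tw|[zw wq]].
  split; first exact: tangent_orth (tangent_subset coneM tw).
  apply/subr0_eq; rewrite -derive_cone_eq//.
  apply: (tangent_const (k := 0) (smooth_diff smooth_cone_eq Iz) _ tw).
  by apply: (@filterE _ (nbhs z)) => q [_ _]; rewrite /cone_eq => ->; rewrite subrr.
have pdt : dot (spat z) (spat dt) = 0 by rewrite spat_dt dot0r.
have [N [beta [Np bs Ps bp [PL PLid PD]]]] :=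
  hypersurface_retraction I_open coneM Lz (Iz : U' z) smooth_cone_eq coneP pdt (cone_dt Lz).
have Dw : 'D_w cone_eq z = 0 by rewrite derive_cone_eq// wq subrr.
have := tangent_image w Ps PL Np; rewrite PLid// PD//.
Qed.

Lemma spat_cone_field z :
  spat (cone_field z) = (cone_coef (tcoord z) * cos (s0 - S (tcoord z))) *: spat z
    + - cone_coef (tcoord z) *: q0.
Proof. by rewrite /cone_field !(spatD, spatZ) spat_dt spatK sq0 scaler0 add0r. Qed.

Lemma tcoord_cone_field z : tcoord (cone_field z) = - (f (tcoord z))^-1.
Proof.
by rewrite /cone_field !(tcoordD, tcoordZ) tcoord_dt tcoord_spat tq0 !mulr0 !addr0 mulr1.
Qed.

Lemma rwg_cone_field z w : full_cone z -> tangent full_cone z w ->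
  rwg f z (cone_field z) w = 0.
Proof.
move=> Lz; have [_ I'z _] := Lz; have Iz := I'I I'z.
move=> /(tangent_full_cone _ Lz)[zw wq].
rewrite rwgE tcoord_cone_field spat_cone_field dotDl !dotZl zw (dotC q0) wq /cone_coef.
by have s0' := lt0r_neq0 (sin_cone I'z); have fz := f0 Iz; field; rewrite fz s0'.
Qed.

Lemma tangent_cone_field z : full_cone z -> tangent full_cone z (cone_field z).
Proof.
move=> Lz; have [/rw_spaceE[_ z1] I'z zq] := Lz; have Iz := I'I I'z.
have s0' := lt0r_neq0 (sin_cone I'z); have fz := f0 Iz.
apply/tangent_full_cone => //; rewrite spat_cone_field tcoord_cone_field; split.
  by rewrite dotDr !dotZr z1 zq; ring.
rewrite dotDl !dotZl q1 zq /cone_coef.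
have c2 := cos2Dsin2 (s0 - S (tcoord z)).
set C := cos _ in c2 *; set N := sin _ in c2 s0' *.
have -> : (f (tcoord z) * f (tcoord z) * N)^-1 * C * C + - (f (tcoord z) * f (tcoord z) * N)^-1 * 1 =
  (f (tcoord z) * f (tcoord z) * N)^-1 * (C ^+ 2 - 1) by ring.
by rewrite -c2; field; rewrite fz s0'.
Qed.

Lemma associated_cone_field : associated_null_field f full_cone cone_field.
Proof.
split; first by exists U'; [move=> z []|exact: smooth_cone_field].
move=> z Lz; have tz := tangent_cone_field Lz; split=> //.
  exact: rwg_cone_field.
have [_ I'z _] := Lz; have fz := f0 (I'I I'z).
rewrite rwgE tcoord_cone_field /zeta spatZ spat_dt scaler0 dot0l mulr0 addr0 tcoordZ tcoord_dt.
by field.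
Qed.

(** Along the screen, time is constant, so the derivative of [cone_field] in a
    screen direction [X] is a multiple of [X]. *)
Lemma full_cone_umbilic : totally_umbilic f full_cone.
Proof.
exists cone_field; first exact: associated_cone_field.
exists cone_rho; first by exists U'; [move=> z []|exact: smooth_cone_rho].
move=> z X Y Lz [tX X0] [tY Y0]; have [/rw_spaceE[_ z1] I'z zq] := Lz; have Iz := I'I I'z.
have s0' := lt0r_neq0 (sin_cone I'z); have fz := f0 Iz.
have screen0 w : rwg f z (zeta f z) w = 0 -> tcoord w = 0.
  rewrite rwgE /zeta spatZ spat_dt scaler0 dot0l mulr0 addr0 tcoordZ tcoord_dt mulr1.
  by move=> /eqP; rewrite oppr_eq0 mulf_eq0 (negbTE fz) => /eqP.
have {}X0 := screen0 X X0; have {}Y0 := screen0 Y Y0.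
have [zY _] := (tangent_full_cone Y Lz).1 tY.
have fd : differentiable (f : R^o -> R^o) (tcoord z) by exact: smooth_diff f_smooth Iz.
rewrite (null_second_formE cone_field z1 fz fd X0 Y0 zY) rwgE X0 mul0r oppr0 add0r.
have cstd (w : V) : differentiable (fun _ : V => w) z by exact: differentiable_cst.
have idd : differentiable (fun z : V => z) z by case: (is_diff_id z).
have tim (g : R^o -> R^o) : smooth I' g -> differentiable (fun z : V => g (tcoord z) : R^o) z /\
    'D_X (fun z : V => g (tcoord z) : R^o) z = 0.
  by move=> gs; have [d ->] := derive_time X (smooth_diff gs I'z); rewrite X0 mul0r.
have fV : smooth (V := R^o) (W := R^o) I' (fun t => - (f t)^-1).
  by apply: smoothN; apply: smooth_V => // t /I'I; exact: f0.
have [d1 D1] := tim _ fV.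
have [d2 D2] := tim _ (smoothM smooth_cone_coef smooth_cone_trig.1).
have [d3 D3] := tim _ (smoothN smooth_cone_coef).
have e1 := diff_scale d1 (cstd dt); have e2 := diff_scale d2 (diff_spat idd).
have e3 := diff_scale d3 (cstd q0).
have -> : 'D_X cone_field z = (cone_coef (tcoord z) * cos (s0 - S (tcoord z))) *: spat X.
  rewrite /cone_field (deriveD_fun X e1 (diffD_fun e2 e3)) (deriveD_fun X e2 e3).
  rewrite (derive_scale X d1 (cstd dt)) (derive_scale X d2 (diff_spat idd)).
  rewrite (derive_scale X d3 (cstd q0)) D1 D2 D3 !derive_cst !scaler0 !scale0r (derive_spat X idd).
  have -> : 'D_X (fun z : V => z) z = X by exact: derive_id.
  by rewrite !addr0 !add0r.
rewrite spatZ spatK dotZl tcoord_cone_field /cone_rho /cone_coef.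
by field; rewrite fz s0'.
Qed.

(** This lemma and [full_coneP] are polar coordinates on the cone, by time and
    the direction [e] at the vertex. *)
Lemma full_cone_point t (e : V) : I' t -> tcoord e = 0 -> dot e e = 1 -> dot q0 e = 0 ->
  full_cone (t *: dt + (cos (s0 - S t) *: q0 + sin (s0 - S t) *: e)).
Proof.
move=> It te e1 qe; have se : spat e = e by rewrite [RHS]time_space_split te scale0r add0r.
set z := _ + _.
have tz : tcoord z = t by rewrite !(tcoordD, tcoordZ) tcoord_dt tq0 te !mulr0 !addr0 mulr1.
have sz : spat z = cos (s0 - S t) *: q0 + sin (s0 - S t) *: e.
  by rewrite !(spatD, spatZ) spat_dt sq0 se scaler0 add0r.
split; rewrite ?tz//.
  apply/rw_spaceE; rewrite tz sz; split; first exact: I'I.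
  rewrite !(dotDl, dotDr) !dotZl !dotZr q1 e1 qe (dotC e) qe -[RHS](cos2Dsin2 (s0 - S t)) !expr2.
  by ring.
by rewrite sz dotDl !dotZl q1 (dotC e) qe mulr0 addr0 mulr1.
Qed.

Lemma full_coneP z : full_cone z -> exists e : V, [/\ tcoord e = 0, dot e e = 1, dot q0 e = 0 &
  z = tcoord z *: dt + (cos (s0 - S (tcoord z)) *: q0 + sin (s0 - S (tcoord z)) *: e)].
Proof.
move=> [/rw_spaceE[_ z1] I'z zq]; have s0' := lt0r_neq0 (sin_cone I'z).
set C := cos _ in zq *; set N := sin _ in s0' *.
have c2 : C ^+ 2 + N ^+ 2 = 1 by exact: cos2Dsin2.
exists (N^-1 *: (spat z - C *: q0)); split.
- by rewrite tcoordZ tcoordD tcoordN tcoordZ tcoord_spat tq0 mulr0 subr0 mulr0.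
- rewrite dotZl dotZr !(dotDl, dotDr, dotNl, dotNr) !dotZl !dotZr z1 q1 zq (dotC q0) zq.
  have -> : 1 + - (C * C) + (- (C * C) + - - (C * (C * 1))) = N ^+ 2 by lra.
  by field.
- by rewrite dotZr dotDr dotNr dotZr (dotC q0) zq q1 mulr1 subrr mulr0.
by rewrite scalerA mulfV// scale1r [C *: q0 + _]addrC subrK -time_space_split.
Qed.

(** The sphere of directions at the vertex is connected because any two of its
    points are orthogonal to a third one. *)
Lemma full_cone_connected : (3 < n)%N -> connected full_cone.
Proof.
move=> n_gt3; have [[z0 Lz0]|L0] := pselect (full_cone !=set0); last first.
  have -> : full_cone = set0 by apply/eqP; apply: contrapT => /negP/set0P.
  exact: connected0.
have [e0 [te0 e01 qe0 z0E]] := full_coneP Lz0; have [_ I'z0 _] := Lz0.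
pose G (t : R) (e : V) : V := t *: dt + (cos (s0 - S t) *: q0 + sin (s0 - S t) *: e).
have oI' := open_cone_times.
have Gt (e : V) : connected [set G t e | t in I'].
  apply: connected_continuous_connected.
    by apply/connected_intervalP; exact: cone_times_itv.
  apply: continuous_in_subspaceT => t; rewrite inE => It.
  have Gs : smooth (V := R^o) I' (fun t => G t e).
    apply: smoothD.
      by apply: (@smooth_scale _ R^o); [exact: smooth_id|exact: smooth_cst].
    apply: smoothD; apply: smooth_scale; first [exact: smooth_cone_trig.1|exact:
      smooth_cone_trig.2|exact: smooth_cst].
  exact: smooth_cont Gs It.
pose E (e e2 : V) (th : R) : V := cos th *: e + sin th *: e2.
have GE t e e2 : connected (range (fun th => G t (E e e2 th))).
  apply: connected_continuous_connected.
    by apply/connected_intervalP => a b _ _ x _.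
  apply: continuous_subspaceT => th.
  have oT : open (setT : set R^o) by exact: openT.
  have Gs : smooth (V := R^o) setT (fun th => G t (E e e2 th)).
    apply: smoothD; first exact: smooth_cst.
    apply: smoothD; first exact: smooth_cst.
    apply: smooth_scale; first exact: smooth_cst.
    by apply: smoothD; apply: smooth_scale;
      first [exact: smooth_cos|exact: smooth_sin|exact: smooth_cst].
  by apply: (smooth_cont Gs).
have EP e e2 th : tcoord e = 0 -> dot e e = 1 -> dot q0 e = 0 ->
    tcoord e2 = 0 -> dot e2 e2 = 1 -> dot q0 e2 = 0 -> dot e e2 = 0 ->
    [/\ tcoord (E e e2 th) = 0, dot (E e e2 th) (E e e2 th) = 1 & dot q0 (E e e2 th) = 0].
  move=> te e1 qe te2 e21 qe2 ee2; split.
  - by rewrite tcoordD !tcoordZ te te2 !mulr0 addr0.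
  - rewrite !(dotDl, dotDr) !dotZl !dotZr e1 e21 ee2 (dotC e2) ee2 -[RHS](cos2Dsin2 th) !expr2.
    by ring.
  - by rewrite dotDr !dotZr qe qe2 !mulr0 addr0.
have E0 e e2 : E e e2 0 = e by rewrite /E cos0 sin0 scale1r scale0r addr0.
have Epi e e2 : E e e2 (pi / 2) = e2 by rewrite /E cos_pihalf sin_pihalf scale1r scale0r add0r.
have CP z : full_cone z -> exists B : set V, [/\ connected B, B `<=` full_cone, B z0 & B z].
  move=> Lz; have [e1 [te1 e11 qe1 zE]] := full_coneP Lz; have [_ I'z _] := Lz.
  have [|e2 e21 e2o] := @exists_unit_normal R n [:: dt; q0; e0; e1]; first by [].
  have te2 : tcoord e2 = 0 by rewrite -dot_dt dotC; apply: e2o; rewrite !inE eqxx.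
  have qe2 : dot q0 e2 = 0 by rewrite dotC; apply: e2o; rewrite !inE eqxx orbT.
  have e0e2 : dot e0 e2 = 0 by rewrite dotC; apply: e2o; rewrite !inE eqxx !orbT.
  have e1e2 : dot e1 e2 = 0 by rewrite dotC; apply: e2o; rewrite !inE eqxx !orbT.
  pose t := tcoord z.
  pose B1 := [set G t e0 | t in I'].
  pose B2 := range (fun th => G t (E e0 e2 th)).
  pose B3 := range (fun th => G t (E e1 e2 th)).
  exists (B1 `|` (B2 `|` B3)); split.
  - apply: connectedU; [|exact: Gt|apply: connectedU; [|exact: GE|exact: GE]].
      exists (G t e0); split; first by exists t.
      by left; exists 0 => //; rewrite E0.
    by exists (G t e2); split; exists (pi / 2) => //; rewrite Epi.
  - move=> _ [[t' It' <-]|[[th _ <-]|[th _ <-]]].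
    + exact: full_cone_point.
    + by have [? ? ?] := EP e0 e2 th te0 e01 qe0 te2 e21 qe2 e0e2; exact: full_cone_point.
    + by have [? ? ?] := EP e1 e2 th te1 e11 qe1 te2 e21 qe2 e1e2; exact: full_cone_point.
  - by left; exists (tcoord z0).
  - by right; right; exists 0 => //; rewrite E0 /G -zE.
have -> : full_cone = \bigcup_(B in [set B | [/\ connected B, B `<=` full_cone & B z0]]) B.
  apply/seteqP; split=> [z /CP[B [h1 h2 h3 h4]]|z [B [_ BL _] /BL]//].
  by exists B.
apply: bigcup_connected; first by exists z0 => B [].
by move=> B [].
Qed.

Lemma full_cone_null : (3 < n)%N -> full_cone !=set0 -> null_hypersurface I f full_cone.
Proof.
move=> n_gt3 L0; split.
  split=> // [|p Lp]; first exact: full_cone_connected.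
  have [Mp I'p _] := Lp.
  exists U', cone_eq; split=> //; first exact: smooth_cone_eq.
  move=> q Uq Lq; exists dt; last exact: cone_dt.
  apply: (tangent_rw_space I_open); first exact: coneM.
  by rewrite spat_dt dot0r.
move=> p Lp; exists (cone_field p); split.
- exact: tangent_cone_field.
- apply/eqP => /(congr1 (@tcoord R n)) /eqP; rewrite tcoord_cone_field {2}/tcoord mxE.
  by rewrite oppr_eq0 invr_eq0; have [_ /I'I/f0/negbTE-> _] := Lp.
- by move=> w; exact: rwg_cone_field.
Qed.

End full_cones.

(** * Totally geodesic null hypersurfaces *)

Section no_totally_geodesic.
Context {R : realType} {n : nat}.
Variables (I : set R) (f : R -> R).
Hypotheses (I_open : open I) (I_itv : is_interval I)
  (f_smooth : smooth (V := R^o) (W := R^o) I f) (f_pos : forall t, I t -> 0 < f t).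
Local Notation V := 'rV[R]_n.+1.
Local Notation dt := (@partial_t R n).
Local Notation df t := ('D_1 (f : R^o -> R^o) (t : R^o)).
Variables (S : R -> R).
Hypotheses (dS : forall t, I t -> is_derive t (1 : R) S (f t)^-1).

(** By inextendibility, [L] is a full cone, on which [f' = cot (s0 - S)]; the
    right-hand side is unbounded near the vertex. *)
Theorem no_inextendible_totally_geodesic (L : set V) : (3 < n)%N ->
  (exists a, exists b, [/\ I a, I b, a < b & pi < S b - S a]) ->
  null_hypersurface I f L -> inextendible I f L -> totally_geodesic f L -> False.
Proof.
move=> n_gt3 [a [b [Ia Ib ab Sab]]] L_null Lmax [xi xi_null geo].
pose rho (_ : V) : R^o := 0.
have rho_smooth : smooth_along L rho.
  by exists setT => //; apply: smooth_cst; exact: openT.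
have umb p X Y : L p -> screen f L p X -> screen f L p Y ->
    null_second_form f xi p X Y = rho p * rwg f p X Y.
  by move=> Lp sX sY; rewrite mul0r; exact: geo.
have [q0 [s0 [tq0 q1 Lcone]]] :=
  umbilic_cone I_open f_smooth f_pos n_gt3 L_null xi_null rho_smooth umb dS.
have [[[p0 Lp0] _ LM _] _] := L_null.
have LI z : L z -> I (tcoord z) by move=> /LM /rw_spaceE[].
pose th := cone_angle f rho.
have th0 z : 0 < th z by exact: cone_angle_gt0.
have thpi z : th z < pi by exact: cone_angle_ltpi.
have thE z : L z -> s0 - S (tcoord z) = th z.
  by move=> /Lcone[-> _ _]; rewrite opprB addrCA subrr addr0.
have Lsub : L `<=` full_cone I S s0 q0.
  move=> z Lz; have [Sz _ [e [te e1 qe sz]]] := Lcone z Lz; split; first exact: LM.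
    by split; [exact: LI|rewrite Sz ltrD2l ltrN2; exact: thpi|rewrite Sz gtrBl; exact: th0].
  by rewrite sz dotDl !dotZl q1 (dotC e) qe mulr0 addr0 mulr1 thE.
have full_null : null_hypersurface I f (full_cone I S s0 q0).
  by apply: (full_cone_null I_open I_itv f_smooth f_pos dS tq0 q1 n_gt3); exists p0; exact: Lsub.
have fullE := Lmax _ full_null (full_cone_umbilic I_open f_smooth f_pos dS s0 tq0 q1) Lsub.
(* The equation [f' = cot (s0 - S)], multiplied by the sine to make sense at
   the vertex. *)
pose h (t : R^o) : R^o := cos (s0 - S t) - df t * sin (s0 - S t).
have h0 t : cone_times I S s0 t -> h t = 0.
  move=> I't; have [|e e1 eo] := @exists_unit_normal R n [:: dt; q0].
    by rewrite /= (leq_trans _ n_gt3).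
  have te : tcoord e = 0 by rewrite -dot_dt dotC; apply: eo; rewrite !inE eqxx.
  have qe : dot q0 e = 0 by rewrite dotC; apply: eo; rewrite !inE eqxx orbT.
  have := full_cone_point tq0 q1 I't te e1 qe; rewrite fullE; set z := _ + _ => Lz.
  have tz : tcoord z = t by rewrite !(tcoordD, tcoordZ) tcoord_dt tq0 te !mulr0 !addr0 mulr1.
  have [_ E _] := Lcone z Lz.
  rewrite /h -tz thE// E /null_curvature /rho mul0r subr0; exact: subrr.
have Ss : smooth (V := R^o) (W := R^o) I S.
  exact: (smooth_conformal_time f_smooth f_pos dS).
have hs : smooth I h.
  have gs : smooth (V := R^o) (W := R^o) I (fun t => s0 + - S t).
    by apply: smoothD; [exact: smooth_cst|exact: smoothN].
  apply: smoothD; first exact: (smooth_comp_real _ gs smooth_cos).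
  apply: smoothN; apply: smoothM; first exact: smoothDer (1 : R^o) f_smooth.
  exact: (smooth_comp_real _ gs smooth_sin).
(* [h] does not vanish at the time of the vertex, so it vanishes at no time
   close to it; those on the side of the cone are times of points of [L]. *)
have near_vertex s : I s -> h s != 0 -> exists2 e : R, 0 < e & forall t, `|t - s| < e ->
    [/\ I t, h t != 0, S s - pi < S t & S t < S s + pi].
  move=> Is hs0; apply: near_distP.
  have Sc := smooth_cont Ss Is; have hc := smooth_cont hs Is.
  have N1 : \forall t \near s, I t by exact: open_nbhs_nbhs.
  have N2 : \forall t \near s, h t != 0.
    have := hc _ (open_nbhs_nbhs (conj (@open_neq R 0) hs0)); exact.
  have pi0 := @pi_gt0 R.
  have N3 : \forall t \near s, S s - pi < S t by apply: near_gt Sc _; rewrite gtrBl.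
  have N4 : \forall t \near s, S t < S s + pi by apply: near_lt Sc _; rewrite ltrDl.
  by apply: filterS (filterI (filterI N1 N2) (filterI N3 N4)) => t [[? ?] [? ?]].
have lt x y : I x -> I y -> x < y -> S x < S y.
  by move=> Ix Iy xy; rewrite (conformal_time_lt I_itv f_pos dS).
have [[s Is Ss0]|[s Is Ss0]] :=
    cone_vertex I_itv f_pos dS Ia Ib ab Sab (LI _ Lp0) (th0 p0) (thpi p0).
  have {}Ss0 : S s = s0 by rewrite Ss0 -(thE _ Lp0) addrCA subrr addr0.
  have [|e e0 eP] := near_vertex s Is.
    by rewrite /h Ss0 subrr cos0 sin0 mulr0 subr0 oner_eq0.
  have e2 : 0 < e / 2 by rewrite divr_gt0.
  have [|It ht S1 S2] := eP (s - e / 2).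
    by rewrite addrAC subrr add0r normrN gtr0_norm//; lra.
  move: ht; rewrite h0 ?eqxx//; split=> //; first by rewrite -Ss0.
  by rewrite -Ss0; apply: lt => //; rewrite gtrBl.
have {}Ss0 : S s = s0 - pi by rewrite Ss0 -(thE _ Lp0) [S _ + _]addrCA subrr addr0.
have [|e e0 eP] := near_vertex s Is.
  by rewrite /h Ss0 opprB addrCA subrr addr0 cospi sinpi mulr0 subr0 oppr_eq0 oner_eq0.
have e2 : 0 < e / 2 by rewrite divr_gt0.
have [|It ht S1 S2] := eP (s + e / 2).
  by rewrite addrAC subrr add0r gtr0_norm//; lra.
move: ht; rewrite h0 ?eqxx//; split=> //.
  by rewrite -Ss0; apply: lt => //; rewrite ltrDl.
by move: S2; rewrite Ss0 subrK.
Qed.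

End no_totally_geodesic.

Theorem theorem4p11 (R : realType) (n : nat) (I : set R) (f : R -> R)
    (n_gt3 : (3 < n)%N)
    (I_open : open I) (I_itv : is_interval I)
    (f_smooth : smooth (V := R^o) (W := R^o) I f)
    (f_pos : forall t, I t -> 0 < f t)
    (int_gt_pi :
      ((pi : R)%:E < \int[@lebesgue_measure R]_(r in I) (1 / f r)%:E)%E) :
  (forall L : set 'rV[R]_n.+1,
      null_hypersurface I f L -> totally_umbilic f L ->
      open_set_of_nullcone I f L) /\
  ~ (exists L : set 'rV[R]_n.+1,
      [/\ null_hypersurface I f L, inextendible I f L
        & totally_geodesic f L]).
Proof.
have f0 t : I t -> f t != 0 by move=> /f_pos /lt0r_neq0.
have fVs : smooth (V := R^o) (W := R^o) I (fun t => (f t)^-1).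
  by apply: (smooth_comp_real _ f_smooth smooth_inv) => t; exact: f0.
have fVc t : I t -> {for t, continuous (fun t => (f t)^-1 : R)}.
  exact: smooth_cont fVs.
have fc t : I t -> {for t, continuous f} by exact: smooth_cont f_smooth.
have [S dS] := exists_primitive I_open I_itv fVc.
have [Phi dPhi] := exists_primitive I_open I_itv fc.
have fV0 t : I t -> 0 <= (f t)^-1 by move=> /f_pos; rewrite invr_ge0 => /ltW.
have intS : ((pi : R)%:E < \int[@lebesgue_measure R]_(r in I) ((f r)^-1)%:E)%E.
  by under eq_integral do rewrite -div1r.
have width := integral_gt_subitv I_open I_itv fVc fV0 dS (pi_ge0 R) intS.
split=> [L L_null L_umb|[L [L_null L_max L_geo]]].
  exact: (umbilic_open_in_nullcone I_open I_itv f_smooth f_pos dS dPhi n_gt3 width L_null L_umb).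
exact: (no_inextendible_totally_geodesic I_open I_itv f_smooth f_pos dS n_gt3 width L_null L_max L_geo).
Qed.
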